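(* Consider the dead leaves model in dimension $d=2$, with notation as in the context. Suppose that $\mathbb Q$ is such that $\mathcal H_1(\cdot\cap\partial S)$ is a random measure on $\mathbb R^2$, and that $\mathbb E[\mathcal H_2(S\oplus B(1))]<\infty$. Then $\phi$ is a stationary random measure and its intensity is $\lambda^{-1}\,\mathbb E[\mathcal H_1(\partial S)]$.
   Context: Notation: $\mathcal H_k$ is $k$-dimensional Hausdorff measure ($\mathcal H_2$ on $\mathbb R^2$ is Lebesgue measure). For $A\subset\mathbb R^2$, $A^o$ is its interior and $\partial A=\overline A\setminus A^o$ its topological boundary; $A+x:=\{a+x:a\in A\}$; $A\oplus B:=\{a+b:a\in A,b\in B\}$; $B(r)$ is the closed Euclidean ball of radius $r$ centred on the origin. A random measure on $\mathbb R^2$ is a measurable map from a probability space to the space of locally finite Borel measures on $\mathbb R^2$ (with the smallest $\sigma$-algebra making all maps $\mu\mapsto\mu(A)$, $A$ Borel, measurable). It is stationary if its distribution is shift invariant; its intensity is then the constant $\gamma$ such that the expected measure of every Borel $B$ is $\gamma\mathcal H_2(B)$. Dead leaves model in $d=2$: Let $\mathcal C$ be the space of compact subsets of $\mathbb R^2$, with the $\sigma$-algebra generated by the Fell topology (generated by all sets $\{F\in\mathcal C:F\cap G\ne\emptyset\}$ with $G$ open and $\{F\in\mathcal C:F\cap K=\emptyset\}$ with $K$ compact). Let $\mathbb Q$ be a probability measure on $\mathcal C$ (the grain distribution) assigning strictly positive measure to the collection of sets having non-empty interior. $S$ denotes a random element of $\mathcal C$ with distribution $\mathbb Q$; $\lambda:=\mathbb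 E[\mathcal H_2(S)]$. Let $\sum_{i=1}^\infty\delta_{(x_i,t_i)}$ be a homogeneous Poisson process of unit intensity in $\mathbb R^2\times\mathbb R$ and, independently of it, let $(S_i)_{i\ge1}$ be independent random elements of $\mathcal C$ with distribution $\mathbb Q$. (Leaf $i$ is $S_i+x_i$, arriving at time $t_i$.) The boundary of the time-reversed DLM tessellation is $$\Phi:=\bigcup_{i:t_i\ge0}\Big[(\partial S_i+x_i)\setminus\bigcup_{j:0\le t_j<t_i}(S_j^o+x_j)\Big],$$ and $\phi:=\mathcal H_1(\Phi\cap\cdot)$. *)

(* Defs.v *)
From HB Require Import structures.
From mathcomp Require Import all_boot all_order all_algebra finmap.
From mathcomp Require Import all_classical all_reals all_analysis.
From mathcomp Require Import measurable_realfun.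

Set Implicit Arguments.
Unset Strict Implicit.
Unset Printing Implicit Defensive.

Import Order.TTheory GRing.Theory Num.Theory.
Import numFieldNormedType.Exports.

Local Open Scope classical_set_scope.
Local Open Scope ring_scope.

(* The library's norm on [R * R] is the sup norm. Topology, Borel sets and
   bounded sets are the usual ones, but metric notions must use [enorm]. *)
Definition enorm (R : realType) (z : R * R) : R :=
  Num.sqrt (z.1 ^+ 2 + z.2 ^+ 2).

Definition eball (R : realType) (r : R) : set (R * R) :=
  [set z | enorm z <= r].

Definition boundary (T : topologicalType) (A : set T) : set T :=
  closure A `\` A°.

Definition translate (R : realType) (A : set (R * R)) (x : R * R) :
  set (R * R) := [set a + x | a in A].

Definition minkowski_sum (R : realType) (A B : set (R * R)) : set (R * R) :=
  [set a + b | a in A & b in B].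

Section measures_on_the_plane.
Local Open Scope ereal_scope.
Variable R : realType.

Definition area : set (R * R) -> \bar R :=
  @lebesgue_measure R \x @lebesgue_measure R.

Definition volume : set (R * R * R) -> \bar R :=
  @lebesgue_measure R \x @lebesgue_measure R \x @lebesgue_measure R.

(* [maxe 0] only matters for the empty set, whose diameter is 0. *)
Definition diameter (A : set (R * R)) : \bar R :=
  maxe 0 (ereal_sup [set (enorm (a - b))%:E | a in A & b in A]).

Definition hausdorff1_pre (delta : R) (A : set (R * R)) : \bar R :=
  ereal_inf [set \sum_(i <oo) diameter (U i) |
    U in [set U : (set (R * R))^nat |
      A `<=` \bigcup_i U i /\ forall i, diameter (U i) <= delta%:E]].

Definition hausdorff1 (A : set (R * R)) : \bar R :=
  ereal_sup [set hausdorff1_pre delta A | delta in [set delta : R | (0 < delta)%R]].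

End measures_on_the_plane.

Section space_of_compact_sets.
Variable R : realType.

Record grain := Grain {
  grain_set :> set (R * R) ;
  grain_compact : compact grain_set }.

HB.instance Definition _ := gen_eqMixin grain.
HB.instance Definition _ := gen_choiceMixin grain.
HB.instance Definition _ := isPointed.Build grain (Grain (@compact0 _)).

Definition fell_subbase : set (set grain) :=
  [set [set F : grain | F `&` G !=set0] | G in @open (R * R)%type] `|`
  [set [set F : grain | F `&` K = set0] | K in @compact (R * R)%type].

HB.instance Definition _ :=
  @isSubBaseTopological.Build grain (set grain) fell_subbase id.

HB.instance Definition _ :=
  Measurable.copy grain (g_sigma_algebraType (@open grain)).

End space_of_compact_sets.

Section space_of_locally_finite_measures.
Local Open Scope ereal_scope.
Variable R : realType.

Record lfmeasure := LFMeasure {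
  lfmeasure_val :> {measure set (R * R) -> \bar R} ;
  lfmeasure_finite : forall A : set (R * R), measurable A -> bounded_set A ->
    lfmeasure_val A < +oo }.

HB.instance Definition _ := gen_eqMixin lfmeasure.
HB.instance Definition _ := gen_choiceMixin lfmeasure.

Let mzero_finite (A : set (R * R)) : measurable A -> bounded_set A ->
  (mzero : {measure set (R * R) -> \bar R}) A < +oo.
Proof. by move=> _ _; rewrite /= /mzero ltry. Qed.

HB.instance Definition _ := isPointed.Build lfmeasure (LFMeasure mzero_finite).

Definition lfmeasure_evaluations : set (set lfmeasure) :=
  \bigcup_(A in @measurable _ (R * R)%type)
    preimage_set_system setT (fun mu : lfmeasure => mu A) measurable.

HB.instance Definition _ :=
  Measurable.copy lfmeasure (g_sigma_algebraType lfmeasure_evaluations).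

Lemma measurable_translation (x : R * R) :
  measurable_fun setT (fun z : R * R => z + x)%R.
Proof.
by apply/measurable_fun_pairP; split; apply: measurable_funD;
  [exact: measurable_fst|exact: measurable_cst|
   exact: measurable_snd|exact: measurable_cst].
Qed.

Lemma bounded_translation (x : R * R) (A : set (R * R)) :
  bounded_set A -> bounded_set ((fun z => z + x)%R @^-1` A).
Proof.
move=> [M [Mr MA]]; exists (M + `|x| + 1)%R; split; first exact: num_real.
move=> y My z /= Az.
rewrite -(addrK x z) (le_trans (ler_normB _ _))// -lerBrDr.
by apply: MA _ Az; rewrite ltrBrDr (lt_trans _ My)// ltrDl.
Qed.

Definition shift_measure (x : R * R) (mu : {measure set (R * R) -> \bar R}) :
  {measure set (R * R) -> \bar R}.
Proof.
refine (pushforward mu (fun z => z + x)%R : {measure set (R * R) -> \bar R}).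
exact: measurable_translation.
Defined.

Lemma shift_measure_finite (x : R * R) (mu : lfmeasure) (A : set (R * R)) :
  measurable A -> bounded_set A -> shift_measure x mu A < +oo.
Proof.
move=> mA bA; apply: lfmeasure_finite; last exact: bounded_translation.
by rewrite -[X in measurable X]setTI; exact: measurable_translation.
Qed.

Definition shift_lfmeasure (x : R * R) (mu : lfmeasure) : lfmeasure :=
  LFMeasure (@shift_measure_finite x mu).

End space_of_locally_finite_measures.

Section independence.
Local Open Scope ereal_scope.
Context d (Omega : measurableType d) (R : realType) (P : probability Omega R).

Definition sigma_generated d' (T : measurableType d') (X : Omega -> T) :
  set (set Omega) := preimage_set_system setT X measurable.

Definition sigma_generated_seq d' (T : measurableType d')
  (X : nat -> Omega -> T) : set (set Omega) :=
  <<s \bigcup_i sigma_generated (X i) >>.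

Definition mutually_independent (I : choiceType) (F : I -> set (set Omega)) :=
  forall (J : {fset I}) (E : I -> set Omega),
    (forall i, i \in J -> F i (E i)) ->
    P (\bigcap_(i in [set` J]) E i) = \prod_(i <- J) P (E i).

Definition independent (F G : set (set Omega)) :=
  forall A B, F A -> G B -> P (A `&` B) = P A * P B.

End independence.

Section random_measures.
Local Open Scope ereal_scope.
Context d (Omega : measurableType d) (R : realType) (P : probability Omega R).
Implicit Type xi : Omega -> set (R * R) -> \bar R.

(* As usual for random elements, [xi] is only required to be a locally finite
   measure almost surely: it must agree, as a set function on Borel sets and
   outside a null event, with an everywhere defined measurable map into the
   space of locally finite measures. *)
Definition version xi (X : {RV P >-> lfmeasure R}) :=
  {ae P, forall w, forall A, measurable A -> xi w A = X w A}.

Definition random_measure xi := exists X : {RV P >-> lfmeasure R}, version xi X.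

Definition shift_invariant (mu : set (lfmeasure R) -> \bar R) :=
  forall (x : R * R) (B : set (lfmeasure R)), measurable B ->
    mu (shift_lfmeasure x @^-1` B) = mu B.

Definition stationary_random_measure xi :=
  exists2 X : {RV P >-> lfmeasure R},
    version xi X & shift_invariant (distribution P X).

Definition has_intensity xi (gamma : \bar R) :=
  forall B, measurable B -> \int[P]_w xi w B = gamma * area B.

End random_measures.

Section poisson_process.
Local Open Scope ereal_scope.
Context d (Omega : measurableType d) (R : realType) (P : probability Omega R).
Context d' (T : measurableType d').

Definition point_count (p : nat -> Omega -> T) (A : set T) (w : Omega) : \bar R :=
  \sum_(i <oo) \d_(p i w) A.

(* The point process [\sum_i \d_(p i)] is Poisson with intensity measure [mu].
   The second argument of [poisson_prob] is a dummy. *)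
Definition poisson_process (mu : set T -> \bar R) (p : nat -> Omega -> T) :=
  [/\ forall A, measurable A -> mu A < +oo -> forall k : nat,
        P [set w | point_count p A w = k%:R%:E] =
          poisson_prob (fine (mu A)) 0%N [set k],
      forall A, measurable A -> mu A = +oo ->
        P [set w | point_count p A w = +oo] = 1
    & forall (n : nat) (A : 'I_n -> set T),
        (forall i, measurable (A i)) -> trivIset setT A ->
        mutually_independent P (fun i => sigma_generated (point_count p (A i)))].

End poisson_process.

Section dead_leaves.
Local Open Scope ereal_scope.
Context d (Omega : measurableType d) (R : realType) (P : probability Omega R).
Context (x : nat -> {RV P >-> (R * R)%type}) (t : nat -> {RV P >-> R})
  (S : nat -> {RV P >-> grain R}).

(* The marks are independent of the sequence of points itself, not merely of
   the random measure [\sum_i \d_(x i, t i)]: otherwise the numbering of the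
   points could depend on the marks. *)
Definition dead_leaves_model (Q : probability (grain R) R) :=
  [/\ poisson_process P (@volume R) (fun i w => (x i w, t i w)),
      forall i B, measurable B -> distribution P (S i) B = Q B,
      mutually_independent P (fun i => sigma_generated (S i))
    & independent P (sigma_generated_seq (fun i w => (x i w, t i w)))
                    (sigma_generated_seq (fun i => S i : Omega -> grain R))].

Definition dlm_boundary (w : Omega) : set (R * R) :=
  \bigcup_(i in [set i | (0 <= t i w)%R])
    (translate (boundary (S i w : set (R * R))) (x i w) `\`
     \bigcup_(j in [set j | (0 <= t j w < t i w)%R])
       translate ((S j w : set (R * R))°) (x j w)).

End dead_leaves.

(* Main.v *)
Require Import Defs.
From HB Require Import structures.
From mathcomp Require Import all_boot all_order all_algebra finmap.
From mathcomp Require Import all_classical all_reals all_analysis.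
From mathcomp Require Import measurable_realfun.
From mathcomp Require Import ring lra.

Set Implicit Arguments.
Unset Strict Implicit.
Unset Printing Implicit Defensive.

Import Order.TTheory GRing.Theory Num.Theory.
Import numFieldNormedType.Exports.

Local Open Scope classical_set_scope.
Local Open Scope ring_scope.
Local Open Scope ereal_scope.

(** The length of the visible boundary is a sum over the leaves: a leaf that
    arrives at time [s >= 0] contributes the length of that part of its boundary
    which no earlier leaf has covered ([hausdorff1_visible_boundary]).  Lengths
    add up because two leaves almost surely share no boundary of positive length:
    a grain boundary of finite length has area 0 ([area_hausdorff1_finite]), so
    the pairs of overlapping leaves form a null set ([overlapping_null]), and
    such pairs do not occur in a Poisson process ([null_pairs]).  The sum is
    locally finite because in the neighbourhood of any point some leaf soon
    covers everything, and only finitely many leaves arrive there before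
    ([visible_boundary_locally_finite]).

    Everything about the process of leaves is derived from its void
    probabilities: the leaves, as points with coordinates place, time and grain,
    avoid a measurable set [A] with probability [exp (- Lam A)], where [Lam] is
    the product of Lebesgue measure and the law of the grain ([marked_void]).
    This follows from the generating functional of a Poisson process, which is
    computed from the independent Poisson counts on the level sets of simple
    functions ([thinned_cvg]), by treating points and marks as functions of two
    independent sample points ([independent_copies]).  Since the points have
    distinct times ([distinct_times]), their number in a bounded set is the limit
    of the number of occupied cells of a partition by time; this yields
    Campbell's formula jointly with void events ([campbell_missing]) and then
    Mecke's formula ([mecke]).

    Stationarity.  The intensity measure [Lam] is invariant under shifts of the
    place, so shifted leaves have the same void probabilities and therefore the
    same law ([eq_void_eq_law]).  The length of the visible boundary is a
    measurable functional of the set of leaves ([visible_length_event]) that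
    commutes with shifts.  As a random measure must be defined surely, it is
    composed with a map that redirects the null event of bad samples.

    Intensity.  By Mecke's formula the mean length in [A] is the integral over a
    leaf, with place [x], time [s] and grain [F], of the length of the part of
    its boundary that lies in [A] and is exposed in an independent copy of the
    process.  A point is exposed at time [s] with probability
    [exp (- lambda s)], where the mean area [lambda] of the grain is also the mean
    area of its interior, and lies in [(0, oo)].  Integration over [x] gives the
    area of [A], integration over [s >= 0] gives [1 / lambda], and integration
    over [F] gives the mean boundary length. *)

(** * Hausdorff measure as an outer measure *)

Section hausdorff_outer_measure.
Context {R : realType}.
Implicit Types (A B : set (R * R)) (u v : R * R).

(** Covers range over arbitrary sets, which are all measurable here. *)
Let allsets : Type := g_sigma_algebraType (@setT (set (R * R))).

Let meas_all (A : set allsets) : measurable A.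
Proof. exact: sub_sigma_algebra. Qed.

Lemma diameter_ge0 A : 0 <= diameter A.
Proof. by rewrite /diameter le_max lexx. Qed.

Lemma diameter0 : diameter (set0 : set (R * R)) = 0.
Proof.
rewrite /diameter [X in ereal_sup X](_ : _ = set0).
  by rewrite ereal_sup0; apply/max_idPl; exact: leNye.
by apply/seteqP; split=> // z [? []].
Qed.

Lemma le_enorm_diameter A u v : A u -> A v -> (enorm (u - v))%:E <= diameter A.
Proof.
move=> Au Av; rewrite /diameter le_max; apply/orP; right.
by apply: ereal_sup_ubound; exists u => //; exists v.
Qed.

Lemma diameter_le A (r : \bar R) : 0 <= r ->
  (forall u v, A u -> A v -> (enorm (u - v))%:E <= r) -> diameter A <= r.
Proof.
move=> r0 Ar; rewrite /diameter ge_max r0 /=.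
by apply: ge_ereal_sup => _ [u Au [v Av <-]]; exact: Ar.
Qed.

Lemma le_diameter : {homo (@diameter R) : A B / A `<=` B >-> A <= B}.
Proof.
move=> A B AB; apply: diameter_le (diameter_ge0 _) _ => u v Au Av.
by apply: le_enorm_diameter; exact: AB.
Qed.

(** Allowing only covers by sets of diameter at most [delta] amounts to giving
    all other sets infinite gauge; the pre-measure is then an instance of the
    general construction of an outer measure from a gauge. *)
Let gauge (delta : R) (A : set allsets) : \bar R :=
  if diameter (A : set (R * R)) <= delta%:E then diameter (A : set (R * R))
  else +oo.

Let gauge_ge0 delta A : 0 <= gauge delta A.
Proof. by rewrite /gauge; case: ifP => // _; exact: diameter_ge0. Qed.

Let hausdorff1_preE delta A :
  hausdorff1_pre delta A = mu_ext (gauge delta) (A : set allsets).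
Proof.
apply/eqP; rewrite eq_le; apply/andP; split.
  apply: le_ereal_inf_tmp => _ [U [_ AU] <-].
  have [Ud|] := pselect (forall i, diameter (U i : set (R * R)) <= delta%:E).
    apply: ereal_inf_lbound; exists U => //.
    by apply: eq_eseriesr => i _; rewrite /gauge Ud.
  move=> /existsNP[i /negP Ui].
  rewrite (eseries_pinfty _ (_ : xpredT i)) ?leey//.
    by move=> n _; rewrite -ltNye (lt_le_trans _ (gauge_ge0 _ _)).
  by rewrite /gauge (negbTE Ui).
apply: le_ereal_inf_tmp => _ [U [AU Ud] <-].
apply: ereal_inf_lbound; exists U; first by split => //; move=> i; exact: meas_all.
by apply: eq_eseriesr => i _; rewrite /gauge Ud.
Qed.

Lemma hausdorff1_pre_le delta A : (0 < delta)%R ->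
  hausdorff1_pre delta A <= hausdorff1 A.
Proof. by move=> d0; apply: ereal_sup_ubound; exists delta. Qed.

Lemma hausdorff1_le A (r : \bar R) :
  (forall delta, (0 < delta)%R -> hausdorff1_pre delta A <= r) ->
  hausdorff1 A <= r.
Proof. by move=> Ar; apply: ge_ereal_sup => _ [delta /= d0 <-]; exact: Ar. Qed.

Lemma hausdorff1_pre_ge0 delta A : 0 <= hausdorff1_pre delta A.
Proof. by rewrite hausdorff1_preE; exact: mu_ext_ge0. Qed.

Let hausdorff1_ge0 A : 0 <= hausdorff1 A.
Proof. exact: le_trans (hausdorff1_pre_ge0 1 _) (hausdorff1_pre_le _ ltr01). Qed.

Let hausdorff1_set0 : hausdorff1 (set0 : set (R * R)) = 0.
Proof.
apply/eqP; rewrite eq_le hausdorff1_ge0 andbT; apply: hausdorff1_le => d d0.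
rewrite hausdorff1_preE mu_ext0//.
- by rewrite /gauge diameter0 lee_fin (ltW d0).
Qed.

Let le_hausdorff1 : {homo (@hausdorff1 R) : A B / A `<=` B >-> A <= B}.
Proof.
move=> A B AB; apply: hausdorff1_le => d d0.
rewrite (le_trans _ (hausdorff1_pre_le B d0))// !hausdorff1_preE.
exact: le_mu_ext.
Qed.

Let hausdorff1_sigma_subadditive : sigma_subadditive (@hausdorff1 R).
Proof.
move=> F; apply: hausdorff1_le => d d0; rewrite hausdorff1_preE.
apply: le_trans (mu_ext_sigma_subadditive _ _) _.
  by move=> X; exact: gauge_ge0.
apply: lee_nneseries => [i _ _|i _]; first by rewrite -hausdorff1_preE hausdorff1_pre_ge0.
by rewrite -hausdorff1_preE; exact: hausdorff1_pre_le.
Qed.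

HB.instance Definition _ := isOuterMeasure.Build R (R * R)%type (@hausdorff1 R)
  hausdorff1_set0 hausdorff1_ge0 le_hausdorff1 hausdorff1_sigma_subadditive.

End hausdorff_outer_measure.

(** * Level sets of Lipschitz functions are Caratheodory measurable *)

Section hausdorff_caratheodory.
Context {R : realType}.
Implicit Types (A B X Z : set (R * R)).
Local Notation H := (@hausdorff1 R).

Lemma hausdorff1_pre_anti A (d1 d2 : R) : (d1 <= d2)%R ->
  hausdorff1_pre d2 A <= hausdorff1_pre d1 A.
Proof.
move=> d12; apply: le_ereal_inf_tmp => _ [U [AU Ud] <-].
apply: ereal_inf_lbound; exists U => //; split=> // i.
by rewrite (le_trans (Ud i))// lee_fin.
Qed.

Section level_sets.
Variables (f : R * R -> R) (f_lip : forall u v, (`|f u - f v| <= enorm (u - v))%R).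

(** Sets of diameter less than the gap between the levels [a] and [b] meet at
    most one of [A] and [B], so a fine cover of the union splits. *)
Lemma hausdorff1_pre_separated (a b d : R) A B : (d < b - a)%R ->
  A `<=` [set z | f z <= a]%R -> B `<=` [set z | b <= f z]%R ->
  hausdorff1_pre d A + hausdorff1_pre d B <= hausdorff1_pre d (A `|` B).
Proof.
move=> dba Aa Bb; apply: le_ereal_inf_tmp => _ [U [ABU Ud] <-].
pose V i := U i `&` [set z | f z <= a]%R.
pose W i := U i `&` [set z | b <= f z]%R.
apply: (@le_trans _ _ (\sum_(i <oo) diameter (V i) + \sum_(i <oo) diameter (W i))).
  apply: leeD; apply: ereal_inf_lbound.
    exists V => //; split=> [z Az|i].
      by have [i _ Ui] := ABU z (or_introl Az); exists i => //; split=> //; exact: Aa.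
    by rewrite (le_trans _ (Ud i))//; apply: le_diameter => z [].
  exists W => //; split=> [z Bz|i].
    by have [i _ Ui] := ABU z (or_intror Bz); exists i => //; split=> //; exact: Bb.
  by rewrite (le_trans _ (Ud i))//; apply: le_diameter => z [].
rewrite -nneseriesD; [|by move=> *; exact: diameter_ge0..].
apply: lee_nneseries => [i _ _|i _]; first by rewrite adde_ge0 ?diameter_ge0.
have [W0|/set0P[v [Uv /= bv]]] := eqVneq (W i) set0.
  by rewrite W0 diameter0 adde0; apply: le_diameter => z [].
have [V0|/set0P[u [Uu /= ua]]] := eqVneq (V i) set0.
  by rewrite V0 diameter0 add0e; apply: le_diameter => z [].
have := le_trans (le_enorm_diameter Uv Uu) (Ud i); rewrite lee_fin => /(le_trans (f_lip v u)).
move=> /(le_trans (ler_norm _)) fd; exfalso; lra.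
Qed.

Lemma hausdorff1_separated (a b : R) A B : (a < b)%R ->
  A `<=` [set z | f z <= a]%R -> B `<=` [set z | b <= f z]%R ->
  H A + H B <= H (A `|` B).
Proof.
move=> ab Aa Bb; have [->|] := eqVneq (H (A `|` B)) +oo; first by rewrite leey.
rewrite -ltey => Hfin.
have HAfin : H A \is a fin_num.
  rewrite ge0_fin_numE ?outer_measure_ge0// (le_lt_trans _ Hfin)//.
  by apply: le_outer_measure; exact: subsetUl.
have HBfin : H B \is a fin_num.
  rewrite ge0_fin_numE ?outer_measure_ge0// (le_lt_trans _ Hfin)//.
  by apply: le_outer_measure; exact: subsetUr.
have prefin d C : (0 < d)%R -> H C \is a fin_num -> hausdorff1_pre d C \is a fin_num.
  move=> d0 HC; rewrite ge0_fin_numE ?hausdorff1_pre_ge0//.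
  by rewrite (le_lt_trans (hausdorff1_pre_le C d0))// ltey_eq HC.
rewrite -leeBrDr//; apply: hausdorff1_le => d1 d10.
rewrite leeBrDr// addeC -leeBrDr ?prefin//.
apply: hausdorff1_le => d2 d20; rewrite leeBrDr ?prefin// addeC.
(* Half of the gap, as [hausdorff1_pre_separated] asks for a strict inequality. *)
pose d := Num.min (Num.min d1 d2) ((b - a) / 2)%R.
have d0 : (0 < d)%R by rewrite !lt_min d10 d20/= divr_gt0// subr_gt0.
apply: (@le_trans _ _ (hausdorff1_pre d A + hausdorff1_pre d B)).
  by apply: leeD; apply: hausdorff1_pre_anti; rewrite /d !ge_min lexx ?orbT.
apply: le_trans (hausdorff1_pre_le _ d0).
apply: (@hausdorff1_pre_separated a b) => //.
rewrite /d (@le_lt_trans _ _ ((b - a) / 2)%R)//; first by rewrite ge_min lexx orbT.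
by rewrite ltr_pdivrMr// mulr_natr mulr2n ltrDl subr_gt0.
Qed.

(** The part of [X] just above the level [a] is cut into rings whose measures
    are summable, because every second ring is at positive distance from the
    previous ones; hence the parts of [X] on both sides of the level can be
    separated up to a set of small measure. *)
Lemma level_set_caratheodory (a : R) :
  H.-caratheodory [set z | (f z <= a)%R].
Proof.
set C := [set z | _]; apply: le_caratheodory_measurable => X.
change (H (X `&` C) + H (X `&` ~` C) <= H X).
have [->|] := eqVneq (H X) +oo; first by rewrite leey.
rewrite -ltey => HX.
pose c (n : nat) : R := (a + n.+1%:R^-1)%R.
have cS n : (c n.+1 < c n)%R.
  by rewrite /c ltrD2l ltf_pV2 ?posrE ?ltr0n// ltr_nat.
have ac n : (a < c n)%R by rewrite /c ltrDl invr_gt0.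
pose above n := X `&` [set z | (c n <= f z)%R].
pose ring k := X `&` [set z | (c k.+2 <= f z < c k.+1)%R].
have cN n m : (n <= m)%N -> (c m <= c n)%R.
  by move=> nm; rewrite /c lerD2l lef_pV2 ?posrE ?ltr0n// ler_nat.
have every_second o m :
    \sum_(0 <= k < m) H (ring (k.*2 + o)%N) <= H (above (m.*2 + o)%N).
  elim: m => [|m IH]; first by rewrite big_geq// outer_measure_ge0.
  rewrite big_nat_recr//= addeC.
  apply: le_trans (leeD2l _ IH) _.
  apply: (@le_trans _ _ (H (ring (m.*2 + o)%N `|` above (m.*2 + o)%N))).
    apply: (@hausdorff1_separated (c (m.*2 + o).+1) (c (m.*2 + o)%N)) => //.
      by move=> z [_ /= /andP[_ /ltW]].
    by move=> z [].
  apply: le_outer_measure => z [[Xz /= /andP[cz _]]|[Xz /= cz]]; split => //=.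
  by rewrite (le_trans _ cz)// cN// leq_add2r leq_double.
have sum_rings : \sum_(k <oo) H (ring k) < +oo.
  apply: (@le_lt_trans _ _ (H X + H X)); last by rewrite lte_add_pinfty.
  apply: lime_le; first by apply: is_cvg_nneseries => *; exact: outer_measure_ge0.
  apply: nearW => n.
  apply: (@le_trans _ _ (\sum_(0 <= k < n.*2) H (ring k))).
    apply: lee_sum_nneg_natr => [k _ _|]; first exact: outer_measure_ge0.
    by rewrite -addnn leq_addr.
  have -> : \sum_(0 <= k < n.*2) H (ring k) =
      \sum_(0 <= k < n) H (ring (k.*2 + 0)%N) + \sum_(0 <= k < n) H (ring (k.*2 + 1)%N).
    rewrite -big_split/=; elim: n => [|n IH]; first by rewrite !big_geq.
    by rewrite doubleS !big_nat_recr//= IH addn0 addn1 addeA.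
  apply: leeD; apply: le_trans (every_second _ _) _;
    by apply: le_outer_measure => z [].
have tail0 := nneseries_tail_cvg sum_rings (fun k _ => outer_measure_ge0 _ (ring k)).
apply/lee_addgt0Pr => e e0.
have [n _ /(_ n (leqnn n)) /= tail_n] : \forall n \near \oo,
    (\sum_(n <= k <oo) H (ring k) < e%:E).
  move/fine_cvgP : tail0 => [fin_tail /cvgrPdist_lt /(_ e e0) tail0].
  near=> n.
  have fn : \sum_(n <= k <oo) H (ring k) \is a fin_num by near: n.
  have /= : (`|0 - fine (\sum_(n <= k <oo) H (ring k))%E| < e)%R by near: n.
  rewrite sub0r normrN => /(le_lt_trans (ler_norm _)).
  by rewrite -lte_fin fineK.
have Xabove : X `&` ~` C `<=` above n.+1 `|` \bigcup_(k in ~` `I_n) ring k.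
  move=> z [Xz /negP]; rewrite /C /= -ltNge => az.
  have [cz|zc] := leP (c n.+1) (f z); [by left; split|right].
  have [m0 m0z] : exists m, (c m <= f z)%R.
    have az0 : (0 < f z - a)%R by rewrite subr_gt0.
    exists (Num.truncn (f z - a)^-1); rewrite /c -lerBrDl.
    rewrite -[leRHS]invrK lef_pV2 ?posrE ?invr_gt0 ?ltr0n//.
    by rewrite ltW// -natr1 natr1 truncnS_gt.
  have exm : exists m, (c m <= f z)%R by exists m0.
  pose m := ex_minn exm.
  have [mz mmin] : (c m <= f z)%R /\ forall k, (c k <= f z)%R -> (m <= k)%N.
    by rewrite /m; case: ex_minnP.
  have nm : (n.+1 < m)%N.
    rewrite ltnNge; apply/negP => mn.
    by have := le_lt_trans (le_trans (cN _ _ mn) mz) zc; rewrite ltxx.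
  exists m.-2.
    by rewrite /= -ltnNge || (move=> /=; apply/negP; rewrite -leqNgt -ltnS -ltnS; case: (m) nm => [|[|?]]).
  case: (m) nm mz mmin => [|[|k]]// nk kz kmin; split => //=; rewrite kz/= ltNge.
  by apply/negP => /kmin; rewrite ltnn.
apply: (@le_trans _ _ (H (X `&` C) + (H (above n.+1) + e%:E))).
  apply: leeD2l; apply: le_trans (le_outer_measure H _ _ Xabove) _.
  apply: le_trans (outer_measureU2 _ _ _) _; apply: leeD2l.
  exact: le_trans (outer_measure_sigma_subadditive_tail _ _ _) (ltW tail_n).
rewrite addeA leeD2r//.
apply: (@le_trans _ _ (H ((X `&` C) `|` above n.+1))).
  by apply: (@hausdorff1_separated a (c n.+1)) => // z [].
by apply: le_outer_measure => z [] [].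
Unshelve. all: by end_near. Qed.

End level_sets.
End hausdorff_caratheodory.

(** * Hausdorff measure on Borel sets *)

Section hausdorff_borel.
Context {R : realType}.
Implicit Types (A B X Z : set (R * R)).
Local Notation H := (@hausdorff1 R).

Lemma enorm_fst (z : R * R) : (`|z.1| <= enorm z)%R.
Proof.
rewrite /enorm -sqrtr_sqr ler_wsqrtr//.
by rewrite lerDl sqr_ge0.
Qed.

Lemma enorm_snd (z : R * R) : (`|z.2| <= enorm z)%R.
Proof.
rewrite /enorm -sqrtr_sqr ler_wsqrtr//.
by rewrite lerDr sqr_ge0.
Qed.

(** The coordinates are Lipschitz for the Euclidean norm, and strips between
    their level sets generate the Borel sets. *)
Lemma borel_caratheodory A : measurable A -> H.-caratheodory A.
Proof.
move=> mA.
have mcoord (f : R * R -> R) : (forall u v, (`|f u - f v| <= enorm (u - v))%R) ->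
    measurable_fun [set: caratheodory_type H] (f : caratheodory_type H -> R).
  move=> f_lip; apply: (measurability _ (RGenOInfty.measurableE R)).
  move=> _ [_ [a ->] <-]; rewrite setTI -[X in measurable X]setCK; apply: measurableC.
  rewrite (_ : ~` _ = [set z | (f z <= a)%R]); first exact: (level_set_caratheodory f_lip).
  apply/seteqP; split=> z /=; rewrite in_itv/= andbT leNgt; first by move/negP.
  by move=> /negP.
have mid : measurable_fun [set: caratheodory_type H]
    (id : caratheodory_type H -> (R * R)%type).
  apply/measurable_fun_pairP; split.
    by apply: mcoord => u v; exact: (enorm_fst (u - v)%R).
  by apply: mcoord => u v; exact: (enorm_snd (u - v)%R).
by have := mid measurableT _ mA; rewrite setTI.
Qed.

Lemma hausdorff1_bigcup (Z : set (R * R)) (F : (set (R * R))^nat) :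
  (forall n, measurable (F n)) -> trivIset setT F ->
  H (Z `&` \bigcup_n F n) = \sum_(n <oo) H (Z `&` F n).
Proof.
move=> mF tF; apply/eqP; rewrite eq_le outer_measure_bigcup_lim/=.
have := caratheodory_lime_le (fun n => borel_caratheodory (mF n)) tF (Z `&` \bigcup_n F n).
move=> /(le_trans _) ->//; rewrite -[leLHS]adde0; apply: leeD; last exact: outer_measure_ge0.
apply: lee_nneseries => [*|n _]; first exact: outer_measure_ge0.
by apply: le_outer_measure => z [Zz Fz]; split => //; split => //; exists n.
Qed.

Definition hausdorff_restr Z A : \bar R := H (Z `&` A).

Section hausdorff_restr.
Variable Z : set (R * R).

Let hausdorff_restr0 : hausdorff_restr Z set0 = 0.
Proof. by rewrite /hausdorff_restr setI0 outer_measure0. Qed.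

Let hausdorff_restr_ge0 A : 0 <= hausdorff_restr Z A.
Proof. exact: outer_measure_ge0. Qed.

Let hausdorff_restr_sigma : semi_sigma_additive (hausdorff_restr Z).
Proof.
move=> F mF tF mUF; rewrite /hausdorff_restr hausdorff1_bigcup//.
by apply: is_cvg_nneseries => *; exact: outer_measure_ge0.
Qed.

HB.instance Definition _ := isMeasure.Build _ (R * R)%type R (hausdorff_restr Z)
  hausdorff_restr0 hausdorff_restr_ge0 hausdorff_restr_sigma.

End hausdorff_restr.

Lemma translateE A (v : R * R) : translate A v = [set z | A (z - v)%R].
Proof.
apply/seteqP; split=> [_ [a Aa <-]|z Az] /=; first by rewrite addrK.
by exists (z - v)%R => //; rewrite subrK.
Qed.

Let hausdorff1_translate_le A v : H (translate A v) <= H A.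
Proof.
apply: hausdorff1_le => d d0; apply: le_trans (hausdorff1_pre_le A d0).
have dtr U : diameter (translate U v) <= diameter U.
  apply: diameter_le (diameter_ge0 _) _ => _ _ [a Ua <-] [b Ub <-].
  by rewrite opprD addrACA subrr addr0; exact: le_enorm_diameter.
apply: le_ereal_inf_tmp => _ [U [AU Ud] <-].
apply: (@le_trans _ _ (\sum_(i <oo) diameter (translate (U i) v))).
  apply: ereal_inf_lbound; exists (fun i => translate (U i) v) => //; split.
    by move=> _ [a /AU[i _ Ua] <-]; exists i => //; exists a.
  by move=> i; exact: le_trans (dtr _) (Ud i).
by apply: lee_nneseries => [*|i _]; [exact: diameter_ge0|exact: dtr].
Qed.

Lemma hausdorff1_translate A v : H (translate A v) = H A.
Proof.
apply/eqP; rewrite eq_le hausdorff1_translate_le/=.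
rewrite -[X in H X <= _](_ : translate (translate A v) (- v)%R = A).
  exact: hausdorff1_translate_le.
by rewrite !translateE; apply/seteqP; split=> z /=; rewrite opprK addrK.
Qed.

End hausdorff_borel.

Definition image_measure d1 d2 (T1 : measurableType d1) (T2 : measurableType d2)
  (R : realType) (m : {measure set T1 -> \bar R}) (f : T1 -> T2)
  (mf : measurable_fun setT f) : {measure set T2 -> \bar R}.
Proof. by refine (pushforward m f : {measure set T2 -> \bar R}). Defined.

Lemma ge0_integral_image d1 d2 (T1 : measurableType d1) (T2 : measurableType d2)
    (R : realType) (m : {measure set T1 -> \bar R}) (f : T1 -> T2)
    (mf : measurable_fun setT f) (g : T2 -> \bar R) :
  measurable_fun setT g -> (forall y, 0 <= g y) ->
  \int[image_measure m mf]_y g y = \int[m]_x g (f x).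
Proof.
move=> mg g0.
by rewrite (ge0_integral_pushforward mf)// preimage_setT.
Qed.

Lemma sigma_finite_product d1 d2 (T1 : measurableType d1) (T2 : measurableType d2)
  (R : realType) (m1 : {sigma_finite_measure set T1 -> \bar R})
  (m2 : {sigma_finite_measure set T2 -> \bar R}) : sigma_finite setT (m1 \x m2).
Proof.
have /sigma_finiteP[F [TF ndF Ffin]] := sigma_finiteT m1.
have /sigma_finiteP[G [TG ndG Gfin]] := sigma_finiteT m2.
exists (fun n => F n `*` G n) => [|n].
  apply/seteqP; split=> // -[x y] _.
  have [i _ Fx] : (\bigcup_i F i) x by rewrite -TF.
  have [j _ Gy] : (\bigcup_j G j) y by rewrite -TG.
  exists (maxn i j) => //; split.
    by move: x Fx; exact/subsetPset/ndF/leq_maxl.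
  by move: y Gy; exact/subsetPset/ndG/leq_maxr.
have [mF Ffn] := Ffin n; have [mG Gfn] := Gfin n.
split; first exact: measurableX.
by rewrite product_measure1E// lte_mul_pinfty// ge0_fin_numE.
Qed.

(** * Area and volume *)

Section area_volume_measures.
Context {R : realType}.
Local Notation leb := (@lebesgue_measure R).

(** Lebesgue measure on [R] rather than on the alias of [R] over which it is
    constructed; the two are different factors for product measures. *)
Definition length : set R -> \bar R := leb.

HB.instance Definition _ := isMeasure.Build default_measure_display R R length
  (measure0 leb) (measure_ge0 leb) (@measure_semi_sigma_additive _ _ _ leb).
HB.instance Definition _ := Measure_isSigmaFinite.Build default_measure_display R R
  length (sigma_finiteT leb).

HB.instance Definition _ := isMeasure.Build _ (R * R)%type R (@area R)
  (measure0 (leb \x leb)) (measure_ge0 (leb \x leb))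
  (@measure_semi_sigma_additive _ _ _ (leb \x leb)).
HB.instance Definition _ := Measure_isSigmaFinite.Build _ (R * R)%type R (@area R)
  (sigma_finite_product leb leb).

Let leb2 := leb \x leb.
HB.instance Definition _ := Measure.on leb2.
HB.instance Definition _ := Measure_isSigmaFinite.Build _ _ _ leb2
  (sigma_finite_product leb leb).

HB.instance Definition _ := isMeasure.Build _ (R * R * R)%type R (@volume R)
  (measure0 (leb2 \x leb)) (measure_ge0 (leb2 \x leb))
  (@measure_semi_sigma_additive _ _ _ (leb2 \x leb)).
HB.instance Definition _ := Measure_isSigmaFinite.Build _ (R * R * R)%type R
  (@volume R) (sigma_finite_product leb2 leb).

Lemma areaX (A B : set R) : measurable A -> measurable B ->
  area (A `*` B) = length A * length B.
Proof. by move=> mA mB; exact: (@product_measure1E _ _ _ _ _ leb leb). Qed.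

Lemma volumeX (A : set (R * R)) (B : set R) : measurable A -> measurable B ->
  volume (A `*` B) = area A * length B.
Proof. by move=> mA mB; exact: (@product_measure1E _ _ _ _ _ leb2 leb). Qed.

Lemma volumeE (A : set (R * R * R)) : measurable A ->
  volume A = (@area R \x length) A.
Proof.
move=> mA; apply/esym; apply: product_measure_unique mA => B C mB mC.
exact: volumeX.
Qed.

End area_volume_measures.

Section area.
Context {R : realType}.
Implicit Types (A : set (R * R)).

Let square (d : R) (u : R * R) : set (R * R) :=
  `[(u.1 - d)%R, (u.1 + d)%R]%classic `*` `[(u.2 - d)%R, (u.2 + d)%R]%classic.

Let measurable_square d u : measurable (square d u).
Proof. by apply: measurableX; exact: measurable_itv. Qed.

Let area_square d u : (0 <= d)%R -> area (square d u) = (d *+ 2 * d *+ 2)%:E.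
Proof.
move=> d0; rewrite areaX//.
have itv (a : R) : length `[(a - d)%R, (a + d)%R]%classic = (d *+ 2)%:E.
  rewrite /length lebesgue_measure_itv/= lte_fin.
  have [h|h] := ltP (a - d)%R (a + d)%R; first by rewrite -EFinD; congr EFin; lra.
  have -> : d = 0%R by lra.
  by rewrite mul0rn.
by rewrite !itv -EFinM mulrnAr.
Qed.

(** A set of diameter [d] sits in a square of area [4 d ^ 2], so a cover by
    sets of diameter at most [delta] and of total diameter [M] bounds the area
    by [4 delta M]. *)
Lemma area_hausdorff1_finite A : measurable A -> hausdorff1 A < +oo -> area A = 0.
Proof.
move=> mA HA; apply/eqP; rewrite eq_le measure_ge0 andbT.
have HAfin : hausdorff1 A \is a fin_num by rewrite ge0_fin_numE ?outer_measure_ge0.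
pose M : R := (fine (hausdorff1 A) + 1)%R.
have M0 : (0 < M)%R by rewrite /M ltr_wpDl// fine_ge0// outer_measure_ge0.
suff small (d : R) : (0 < d)%R -> area A <= (4 * d * M)%:E.
  apply/lee_addgt0Pr => e e0; rewrite add0e.
  apply: le_trans (small (e / (4 * M))%R _) _; first by rewrite divr_gt0// mulr_gt0.
  by rewrite (_ : 4 * (e / (4 * M)) * M = e)%R//; field; rewrite gt_eqF.
move=> d0.
have preM : hausdorff1_pre d A < M%:E.
  apply: le_lt_trans (hausdorff1_pre_le A d0) _.
  by rewrite -[ltLHS]fineK// lte_fin ltrDl.
have [_ [U [AU Ud] <-] SM] := ereal_inf_lt preM.
have rfin i : diameter (U i) \is a fin_num.
  by rewrite ge0_fin_numE ?diameter_ge0// (le_lt_trans (Ud i))// ltry.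
pose r i := fine (diameter (U i)).
have r0 i : (0 <= r i)%R by rewrite fine_ge0// diameter_ge0.
have rd i : (r i <= d)%R by rewrite -lee_fin fineK.
have [c cU] : {c : nat -> R * R & forall i, U i `<=` square (r i) (c i)}.
  apply: (choice (P := fun i c => U i `<=` square (r i) c)) => i.
  have [->|/set0P[u Uu]] := eqVneq (U i) set0; first by exists 0%R.
  exists u => z Uz.
  have := le_enorm_diameter Uz Uu; rewrite -[leRHS]fineK// lee_fin -/(r i) => zu.
  have := le_trans (enorm_fst _) zu; rewrite ler_norml => /andP[z1 z1'].
  have := le_trans (enorm_snd _) zu; rewrite ler_norml => /andP[z2 z2'].
  move: z1 z1' z2 z2' => /=; split; rewrite /= in_itv/=; apply/andP; split; lra.
apply: (@le_trans _ _ (\sum_(i <oo) area (square (r i) (c i)))).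
  apply: measure_sigma_subadditive => //.
  by move=> z /AU[i _ Uz]; exists i => //; exact: cU.
apply: (@le_trans _ _ (\sum_(i <oo) ((4 * d)%:E * diameter (U i)))).
  apply: lee_nneseries => [*|i _]; first exact: measure_ge0.
  rewrite area_square// -[diameter _]fineK// -/(r i) -EFinM lee_fin.
  have -> : (r i *+ 2 * r i *+ 2 = 4 * r i * r i)%R by ring.
  by rewrite ler_wpM2r// ler_wpM2l.
rewrite nneseriesZl; last by move=> *; exact: diameter_ge0.
by rewrite [leRHS]EFinM lee_wpmul2l ?lee_fin ?mulr_ge0 ?(ltW d0)//; exact: ltW.
Qed.

Let lebesgue_translate (c : R) (A : set R) : measurable A ->
  length [set t | A (t + c)%R] = length A.
Proof.
have mf : measurable_fun setT (fun t : measurableTypeR R => (t + c)%R : measurableTypeR R).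
  by apply: measurable_funD; [exact: measurable_id|exact: measurable_cst].
move=> mA; apply/esym.
apply: (@lebesgue_measure_unique R (image_measure lebesgue_measure mf)) => //.
move=> _ [[a b] /= _ <-]; rewrite /pushforward.
have -> : (fun t : R => (t + c)%R) @^-1` `]a, b]%classic = `](a - c)%R, (b - c)%R]%classic.
  by apply/seteqP; split=> t /=; rewrite !in_itv/= ltrBlDr lerBrDr.
rewrite /length !lebesgue_measure_itv/= !lte_fin ltrD2r.
by case: ifPn => // _; rewrite -!EFinD; congr EFin; lra.
Qed.

Let lebesgue_reflect (c : R) (A : set R) : measurable A ->
  length [set t | A (c - t)%R] = length A.
Proof.
move=> mA; rewrite -(lebesgue_translate c mA) /length -[RHS]lebesgue_measureN.
  by rewrite /length /pushforward; congr (@lebesgue_measure R); apply/seteqP; split=> t /=; rewrite addrC.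
rewrite -[X in measurable X]setTI.
have mf : measurable_fun setT (fun t : R => (t + c)%R).
  by apply: measurable_funD; [exact: measurable_id|exact: measurable_cst].
exact: mf.
Qed.

Let area_coordinatewise (f g : R -> R) A :
  measurable_fun setT f -> measurable_fun setT g ->
  (forall B, measurable B -> length (f @^-1` B) = length B) ->
  (forall B, measurable B -> length (g @^-1` B) = length B) ->
  measurable A -> area [set z | A (f z.1, g z.2)] = area A.
Proof.
move=> mf mg fE gE mA.
have mh : measurable_fun setT (fun z : R * R => (f z.1, g z.2)).
  apply/measurable_fun_pairP; split.
    exact: measurableT_comp mf measurable_fst.
  exact: measurableT_comp mg measurable_snd.
have <- : (@length R \x @length R) A = area A.
  by apply: product_measure_unique mA => B C mB mC; exact: areaX.
apply/esym; apply: (@product_measure_unique _ _ _ _ _ _ _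
  (image_measure (@area R) mh)) => //.
move=> B C mB mC; rewrite /= /pushforward -(fE B mB) -(gE C mC).
rewrite -areaX; first by [].
  by rewrite -[X in measurable X]setTI; exact: mf.
by rewrite -[X in measurable X]setTI; exact: mg.
Qed.

Lemma area_translate (v : R * R) A : measurable A ->
  area [set z | A (z + v)%R] = area A.
Proof.
apply: (area_coordinatewise (f := fun t => (t + v.1)%R) (g := fun t => (t + v.2)%R)).
- by apply: measurable_funD; [exact: measurable_id|exact: measurable_cst].
- by apply: measurable_funD; [exact: measurable_id|exact: measurable_cst].
- by move=> B; exact: lebesgue_translate.
- by move=> B; exact: lebesgue_translate.
Qed.

Lemma area_reflect (v : R * R) A : measurable A ->
  area [set z | A (v - z)%R] = area A.
Proof.
apply: (area_coordinatewise (f := fun t => (v.1 - t)%R) (g := fun t => (v.2 - t)%R)).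
- by apply: measurable_funB; [exact: measurable_cst|exact: measurable_id].
- by apply: measurable_funB; [exact: measurable_cst|exact: measurable_id].
- by move=> B; exact: lebesgue_reflect.
- by move=> B; exact: lebesgue_reflect.
Qed.

End area.

(** * Integrals and kernels *)

Section integral_of_arbitrary_functions.
Import HBNNSimple.
Context d (T : measurableType d) (R : realType) (mu : {measure set T -> \bar R}).
Implicit Types f g : T -> \bar R.

Lemma ge0_le_integral_any f g : (forall x, 0 <= f x) -> (forall x, f x <= g x) ->
  \int[mu]_x f x <= \int[mu]_x g x.
Proof.
move=> f0 fg.
have g0 x : 0 <= g x by exact: le_trans (f0 x) (fg x).
rewrite !ge0_integralTE//; apply: ge_ereal_sup => _ [h hf <-].
apply: ereal_sup_ubound; exists h => // x; exact: le_trans (hf x) (fg x).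
Qed.

Let ae_le_integral_any f g : (forall x, 0 <= f x) -> (forall x, 0 <= g x) ->
  {ae mu, forall x, f x = g x} -> \int[mu]_x f x <= \int[mu]_x g x.
Proof.
move=> f0 g0 [N [mN N0 fgN]].
rewrite [leLHS]ge0_integralTE//; apply: ge_ereal_sup => _ [h hf <-].
have mh' : measurable_fun setT (fun x => (\1_(~` N) x * h x)%R).
  by apply: measurable_funM => //; apply: measurable_indic; exact: measurableC.
rewrite -[leLHS](@integralT_nnsfun _ _ _ mu h).
apply: (@le_trans _ _ (\int[mu]_x (\1_(~` N) x * h x)%:E)).
  rewrite le_eqVlt; apply/orP; left; apply/eqP; apply: ge0_ae_eq_integral => //.
  - exact/measurable_EFinP.
  - exact/measurable_EFinP.
  - by move=> x _; rewrite lee_fin.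
  - by move=> x _; rewrite lee_fin mulr_ge0.
  - exists N; split=> // x /=; apply: contra_notP => Nx; move=> _.
    by rewrite /= indicE mem_set// mul1r.
apply: ge0_le_integral_any => x; first by rewrite lee_fin mulr_ge0.
rewrite indicE; case: (boolP (x \in ~` N)) => [/set_mem Nx|_]; last by rewrite mul0r.
rewrite mul1r -(_ : f x = g x)//; apply: contrapT => fgx; apply: Nx; exact: fgN.
Qed.

(** The integral of a nonnegative function is a supremum over the simple
    functions below it, so changing the function on a null set is harmless even
    when measurability is lost. *)
Lemma ae_eq_integral_any f g : (forall x, 0 <= f x) -> (forall x, 0 <= g x) ->
  {ae mu, forall x, f x = g x} -> \int[mu]_x f x = \int[mu]_x g x.
Proof.
move=> f0 g0 fg; apply/eqP; rewrite eq_le !ae_le_integral_any//.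
by apply: filterS fg => x.
Qed.

End integral_of_arbitrary_functions.

Lemma le_limn_einf (R : realType) (u : (\bar R)^nat) (y : \bar R) :
  (\forall n \near \oo, y <= u n) -> y <= limn_einf u.
Proof.
move=> [N _ yu]; rewrite limn_einf_lim; apply: lime_ge; first exact: is_cvg_einfs.
exists N => // n /= Nn; apply: le_ereal_inf_tmp => _ [k /= nk <-].
by apply: yu; rewrite /= (leq_trans Nn).
Qed.


Lemma lee_limn_einf (R : realType) (u v : (\bar R)^nat) :
  (forall n, u n <= v n) -> limn_einf u <= limn_einf v.
Proof.
move=> uv; rewrite !limn_einf_lim.
apply: lee_lim; [exact: is_cvg_einfs|exact: is_cvg_einfs|apply: nearW => N].
apply: le_ereal_inf_tmp => _ [n /= Nn <-]; apply: le_trans (uv n).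
by apply: ereal_inf_lbound; exists n.
Qed.

Lemma le_nneseries_term (R : realType) (u : (\bar R)^nat) i :
  (forall n, 0 <= u n) -> u i <= \sum_(j <oo) u j.
Proof.
move=> u0; apply: le_trans (nneseries_lim_ge i.+1 _) => [|j _]; last by [].
by rewrite big_nat_recr//= leeDr// sume_ge0.
Qed.

(** Rectangles over a generator that contains the whole space generate the
    product, since the sections of their sigma-algebra form a sigma-algebra. *)
Lemma measurable_prod_generator d1 (T1 : measurableType d1) (T2 : pointedType)
    (G : set (set T2)) : G setT ->
  @measurable _ (T1 * g_sigma_algebraType G)%type =
  <<s [set A `*` B | A in @measurable _ T1 & B in G] >>.
Proof.
move=> GT; rewrite measurable_prod_measurableType; apply/seteqP; split; last first.
  apply: smallest_sub; first exact: smallest_sigma_algebra.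
  move=> _ [A mA [B GB <-]]; apply: sub_sigma_algebra.
  by exists A => //; exists B => //; exact: sub_sigma_algebra.
apply: smallest_sub; first exact: smallest_sigma_algebra.
move=> _ [A mA [B mB <-]].
have [S0 SC SU] := smallest_sigma_algebra setT
  [set A `*` B | A in @measurable _ T1 & B in G].
suff : <<s G >> `<=` [set B | <<s [set A `*` B | A in @measurable _ T1 & B in G] >> (A `*` B)].
  exact.
apply: smallest_sub => [|D GD]; last first.
  by apply: sub_sigma_algebra; exists A => //; exists D.
split => [|D GD|F GF] /=.
- by rewrite setX0.
- have -> : A `*` (setT `\` D) = (A `*` setT) `\` (A `*` D).
    apply/seteqP; split=> -[x y] /=; first by move=> [Ax [_ nD]]; split=> // -[].
    by move=> [[Ax _] nD]; split=> //; split=> // Dy; exact: nD.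
  apply: (@measurableD _ (g_sigma_algebraType
    [set A `*` B | A in @measurable _ T1 & B in G])) => //.
  by apply: sub_sigma_algebra; exists A => //; exists setT.
- by rewrite setX_bigcupr; exact: SU.
Qed.

Section kernel_integral.
Import HBNNSimple.
Context d d' (X : measurableType d) (Y : measurableType d') (R : realType).
Variables (l : R.-ker X ~> Y) (D : nat -> set Y).
Hypotheses (mD : forall m, measurable (D m)) (D_nd : nondecreasing_seq D)
  (D_cover : \bigcup_m D m = setT) (l_fin : forall x m, l x (D m) < +oo).

(** The measures of the kernel are finite along a fixed exhaustion, with no
    bound uniform in the parameter: restriction to the sets of the exhaustion
    gives bounded measures, and the passage to the limit preserves
    measurability. *)
Lemma measurable_kernel_xsection (A : set (X * Y)) : measurable A ->
  measurable_fun setT (fun x => l x (xsection A x)).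
Proof.
move=> mA; apply: (emeasurable_fun_cvg (fun m x => mrestr (l x) (mD m) (xsection A x))).
  move=> m; have [] // := @measurable_prod_subset_xsection_kernel _ _ _ _ _ l _ (mD m) _ A mA.
  move=> x; exists (fine (l x (D m)) + 1)%R => B mB.
  apply: (@le_lt_trans _ _ (l x (D m))).
    by rewrite /mrestr; apply: le_measure; rewrite ?inE//; exact: measurableI.
  by rewrite -[ltLHS]fineK ?ge0_fin_numE// lte_fin ltrDl.
move=> x _.
have := @nondecreasing_cvg_mu _ _ _ (l x) (fun m => xsection A x `&` D m).
rewrite -setI_bigcupr D_cover setIT; apply.
- by move=> m; apply: measurableI => //; exact: measurable_xsection.
- exact: measurable_xsection.
- move=> m n mn; apply/subsetPset => y [Ay Dy]; split => //.
  by move: y Dy {Ay}; exact/subsetPset/D_nd.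
Qed.

Lemma measurable_kernel_integral (k : X * Y -> \bar R) :
  (forall z, 0 <= k z) -> measurable_fun setT k ->
  measurable_fun setT (fun x => \int[l x]_y k (x, y)).
Proof.
move=> k0 mk; pose k_ := nnsfun_approx measurableT mk.
apply: (@measurable_fun_xsection_integral _ _ _ _ _ k _ k_).
- by move=> a b ab; exact/nd_nnsfun_approx.
- by move=> z; exact/cvg_nnsfun_approx.
- by move=> n r; apply: measurable_kernel_xsection; rewrite -[X in measurable X]setTI; exact: (measurable_funP (k_ n)).
Qed.

End kernel_integral.


(** * Campbell's and Mecke's formulas *)

Lemma measurable_slab dE (E : measurableType dE) (R : realType) (tau : E -> R) (a b : R) :
  measurable_fun setT tau -> measurable [set p | (a <= tau p < b)%R].
Proof.
move=> mtau; have := mtau measurableT _ (measurable_itv `[a, b[).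
by rewrite setTI; congr measurable; apply/seteqP; split=> p /=; rewrite in_itv.
Qed.

Section configurations.
Context dE (E : measurableType dE) (R : realType).

Definition missing (A : set E) : set (set E) := [set Z | Z `&` A = set0].

Definition void_events : set (set (set E)) := [set missing A | A in measurable].

(** Point configurations, with the sigma-algebra generated by the events that a
    given set contains no point; on these events the probabilities of a Poisson
    process are explicit. *)
Definition configuration : Type := g_sigma_algebraType void_events.
HB.instance Definition _ := Measurable.on configuration.

Definition support (p : nat -> E) : configuration := range p.

Lemma missing_supportE (p : nat -> E) (A : set E) :
  missing A (support p) <-> forall i, ~ A (p i).
Proof.
split=> [pA i Ai|pA].
  have : (support p `&` A) (p i) by split => //; exists i.
  by rewrite pA.
by apply/seteqP; split=> // _ [[i _ <-]]; exact: pA.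
Qed.

Lemma missing_setU (A B : set E) : missing (A `|` B) = missing A `&` missing B.
Proof.
apply/seteqP; split=> [Z|Z [ZA ZB]]; rewrite /missing /=.
  by rewrite setIUr setU_eq0.
by rewrite setIUr ZA ZB setU0.
Qed.

Lemma missing0 : missing set0 = setT.
Proof. by apply/seteqP; split=> // Z _; rewrite /missing /= setI0. Qed.

Lemma measurable_missing (A : set E) : measurable A ->
  measurable (missing A : set configuration).
Proof. by move=> mA; apply: sub_sigma_algebra; exists A. Qed.


Section counting_by_cells.
Variables (tau : E -> R) (m : nat) (B Km : set E).
Hypotheses (mtau : measurable_fun setT tau) (mB : measurable B)
  (mKm : measurable Km) (Km_tau : forall p, Km p -> (- m%:R <= tau p < m%:R)%R).

Definition slices (n : nat) := ((m + m) * 2 ^ n)%N.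

(** The part of [B] in a box, sorted by slices of time of length [2 ^- n]. Time
    alone separates the points, whatever the other coordinates are. *)
Definition cell (n k : nat) : set E :=
  B `&` (Km `&` [set p | (k%:R <= (tau p + m%:R) * 2 ^+ n < k.+1%:R)%R]).

Lemma measurable_cell n k : measurable (cell n k).
Proof.
apply: measurableI => //; apply: measurableI => //.
apply: measurable_slab.
by apply: measurable_funM => //; apply: measurable_funD.
Qed.

Section bounded_rate.
Variables (mu : {measure set E -> \bar R}) (C : R).
Hypothesis mu_slab : forall a h, (0 < h)%R ->
  mu (Km `&` [set p | (a <= tau p < a + h)%R]) <= (C * h)%:E.

Lemma cell_le n k : mu (cell n k) <= (C * (2 ^+ n)^-1)%:E.
Proof.
have n0 : (0 < (2 ^+ n)^-1 :> R)%R by rewrite invr_gt0 exprn_gt0.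
apply: le_trans (mu_slab (k%:R / 2 ^+ n - m%:R)%R n0); apply: le_measure.
- by rewrite inE; exact: measurable_cell.
- by rewrite inE; apply: measurableI => //; exact: measurable_slab.
- move=> p [_ [Kp /= /andP[kp pk]]]; split => //=.
  rewrite lerBlDr ler_pdivrMr ?exprn_gt0// kp/=.
  rewrite addrAC ltrBrDr -[X in (_ < _ + X)%R]mul1r -mulrDl ltr_pdivlMr ?exprn_gt0//.
  by rewrite natr1.
Qed.

Lemma box_fin : mu Km < +oo.
Proof.
apply: (@le_lt_trans _ _ (C * (m + m).+1%:R)%:E); last by rewrite ltry.
have := @mu_slab (- m%:R)%R (m + m).+1%:R; rewrite ltr0n => /(_ isT).
by congr (mu _ <= _); apply/setIidl => p /Km_tau /=; rewrite -natr1 natrD; lra.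
Qed.

End bounded_rate.

Lemma cell_disjoint n : trivIset setT (cell n).
Proof.
move=> i j _ _ [p [[_ [_ /andP[ip pi]]] [_ [_ /andP[jp pj]]]]].
apply/eqP; rewrite eqn_leq; apply/andP; split; rewrite -ltnS -(ltr_nat R).
  exact: le_lt_trans ip pj.
exact: le_lt_trans jp pi.
Qed.

Lemma cell_cover n : \big[setU/set0]_(k < slices n) cell n k = B `&` Km.
Proof.
rewrite -bigcup_mkord; apply/seteqP; split=> [p [k _ [Bp [Kp _]]]//|p [Bp Kp]].
have /andP[mp pm] := Km_tau Kp.
have x0 : (0 <= (tau p + m%:R) * 2 ^+ n)%R.
  by rewrite mulr_ge0 ?exprn_ge0//; lra.
exists (Num.truncn ((tau p + m%:R) * 2 ^+ n)%R); last first.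
  by split => //; split => //=; rewrite truncn_le ?truncnS_gt ?x0.
rewrite /= /slices -(ltr_nat R) (le_lt_trans _ (_ : ((tau p + m%:R) * 2 ^+ n)%R < _)%R)//.
  by rewrite truncn_le x0.
by rewrite natrM natrX natrD ltr_pM2r ?exprn_gt0//; lra.
Qed.

(** A functional of the set of points which counts them in the limit. *)
Definition occupied_cells (n : nat) (s : nat -> E) : \bar R :=
  \sum_(k < slices n) (\1_(~` missing (cell n k)) (support s) : R)%:E.

Lemma sum_cell_indic n p :
  (\1_(B `&` Km) p : R)%:E = \sum_(k < slices n) (\1_(cell n k) p : R)%:E.
Proof.
have diracE_indic (X : set E) : (\1_X p : R)%:E = \d_p X by rewrite diracE indicE.
rewrite -(cell_cover n) diracE_indic measure_semi_additive_ord//.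
- by move=> k; exact: measurable_cell.
- by move=> k j _ _ kj; apply/val_inj; exact: (@cell_disjoint n).
- by apply: bigsetU_measurable => k _; exact: measurable_cell.
Qed.

Lemma occupied_cells_le n (s : nat -> E) :
  occupied_cells n s <= \sum_(i <oo) (\1_(B `&` Km) (s i) : R)%:E.
Proof.
under eq_eseriesr do rewrite (sum_cell_indic n).
rewrite nneseries_sum; last by move=> *; rewrite lee_fin.
apply: lee_sum => k _; rewrite indicE.
case: (boolP (_ \in _)) => [/set_mem occ|_]; last first.
  by apply: nneseries_ge0 => *; rewrite lee_fin.
have [i ci] : exists i, cell n k (s i).
  by apply: contrapT => /forallNP none; apply: occ; exact/missing_supportE.
apply: le_trans (nneseries_lim_ge i.+1 _) => [|j _]; last by rewrite lee_fin.
rewrite big_nat_recr//= indicE mem_set// leeDr//.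
by apply: sume_ge0 => j _; rewrite lee_fin.
Qed.

(** Two points at distinct times lie in distinct cells as soon as the cells are
    short enough. *)
Lemma occupied_cells_ge (s : nat -> E) M : injective (tau \o s) ->
  \forall n \near \oo,
    \sum_(0 <= i < M) (\1_(B `&` Km) (s i) : R)%:E <= occupied_cells n s.
Proof.
move=> inj.
have far : \forall n \near \oo, forall i j : 'I_M, i != j ->
    (1 <= `|tau (s i) - tau (s j)| * 2 ^+ n)%R.
  apply: filter_forall => i; apply: filter_forall => j.
  have [ij|ij] := eqVneq i j; first exact: nearW.
  have gap : (0 < `|tau (s i) - tau (s j)|)%R.
    rewrite normr_gt0 subr_eq0; apply: contra ij => /eqP /inj /val_inj ->.
    by [].
  have := @near_infty_natSinv_expn_lt R (PosNum gap); apply: filterS => n /= ltn _.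
  by rewrite -ler_pdivrMr ?exprn_gt0// ltW.
apply: filterS far => n far; rewrite big_mkord.
under eq_bigr do rewrite (sum_cell_indic n).
rewrite exchange_big/=; apply: lee_sum => k _.
have [[i0 ci0]|none] := pselect (exists i0 : 'I_M, cell n k (s i0)); last first.
  rewrite big1 => [|i _]; first by rewrite lee_fin.
  by rewrite indicE memNset// => ci; apply: none; exists i.
rewrite (bigD1 i0)//= big1 ?adde0 => [|i ii0].
  rewrite !indicE !mem_set//=.
  by move=> /missing_supportE /(_ i0).
rewrite indicE memNset// => ci; have := far i i0 ii0; apply/negP; rewrite -ltNge.
move: ci ci0 => [_ [_ /= /andP[a b]]] [_ [_ /= /andP[c e]]].
rewrite -[X in (_ * X)%R](@ger0_norm _ (2 ^+ n)%R) ?exprn_ge0// -normrM mulrBl.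
move: a b c e; rewrite !mulrDl -!natr1 => a b c e.
by rewrite ltr_norml; apply/andP; split; lra.
Qed.

Lemma count_points_lim (s : nat -> E) : injective (tau \o s) ->
  \sum_(i <oo) (\1_(B `&` Km) (s i) : R)%:E = limn_einf (occupied_cells ^~ s).
Proof.
move=> inj; apply/eqP; rewrite eq_le; apply/andP; split.
  apply: lime_le; first by apply: is_cvg_nneseries => *; rewrite lee_fin.
  by apply: nearW => M; apply: le_limn_einf; exact: occupied_cells_ge.
rewrite limn_einf_lim; apply: lime_le; first exact: is_cvg_einfs.
apply: nearW => N; apply: le_trans (occupied_cells_le N s).
by apply: ereal_inf_lbound; exists N => /=.
Qed.

End counting_by_cells.
End configurations.
Arguments support {dE E} p.

Section enumerated_process.
Context d (Omega : measurableType d) (R : realType) (P : probability Omega R).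
Context dE (E : measurableType dE).
Variables (pt : nat -> Omega -> E) (mpt : forall i, measurable_fun setT (pt i)).

Let xi w : configuration E := support (pt ^~ w).

Lemma measurable_support : measurable_fun setT xi.
Proof.
apply: (@measurability _ _ Omega (configuration E) setT xi (void_events (E := E)) (erefl _)).
move=> _ [_ [A mA <-] <-].
have -> : setT `&` xi @^-1` (missing A) = \bigcap_i (pt i @^-1` (~` A)).
  rewrite setTI; apply/seteqP; split=> w /=; last first.
    by move=> pA; apply/missing_supportE => i; exact: pA.
  by move=> /missing_supportE pA i _; exact: pA.
apply: bigcap_measurableType => i _; rewrite -[X in measurable X]setTI.
by apply: mpt => //; exact: measurableC.
Qed.

Let mxi (A : set E) : measurable A -> measurable (xi @^-1` missing A).
Proof.
move=> mA; rewrite -[X in measurable X]setTI.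
by apply: measurable_support => //; exact: measurable_missing.
Qed.

Variable Lam : {sigma_finite_measure set E -> \bar R}.
Hypothesis void_prob : forall A, measurable A ->
  P (xi @^-1` missing A) = expeR (- Lam A).

Variables (tau : E -> R) (K : nat -> set E) (C : nat -> R).
Hypotheses (mtau : measurable_fun setT tau) (mK : forall m, measurable (K m))
  (K_nd : nondecreasing_seq K) (K_cover : \bigcup_m K m = setT)
  (K_tau : forall m p, K m p -> (- m%:R <= tau p < m%:R)%R)
  (K_fin : forall m a h, (0 < h)%R ->
     Lam (K m `&` [set p | (a <= tau p < a + h)%R]) <= (C m * h)%:E)
  (tau_inj : {ae P, forall w, injective (fun i => tau (pt i w))}).

Section campbell.
Variables (A B : set E) (mA : measurable A) (mB : measurable B).
Hypothesis AB : A `&` B = set0.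
Variable m : nat.

Let v : R := fine (P (xi @^-1` missing A)).
Let vE : P (xi @^-1` missing A) = v%:E.
Proof. by rewrite /v fineK// fin_num_measure//; exact: mxi. Qed.
Let v0 : (0 <= v)%R. Proof. by rewrite fine_ge0. Qed.

Let Bm := B `&` K m.
Let mBm : measurable Bm. Proof. exact: measurableI. Qed.

Let cell n k := cell tau m B (K m) n k.
Let L := slices m.
Let mcell n k : measurable (cell n k). Proof. exact: measurable_cell. Qed.
Let cell_disjoint n : trivIset setT (cell n). Proof. exact: cell_disjoint. Qed.
Let cell_cover n : \big[setU/set0]_(k < L n) cell n k = Bm.
Proof. by apply: cell_cover; exact: K_tau. Qed.

Let Lam_cell n k : Lam (cell n k) <= (C m * (2 ^+ n)^-1)%:E.
Proof. exact: (cell_le m mtau mB (mK m) (@K_fin m) n k). Qed.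

Let eps n : R := (C m * (2 ^+ n)^-1)%R.
Let r n k : R := fine (Lam (cell n k)).
Let rE n k : Lam (cell n k) = (r n k)%:E.
Proof.
by rewrite /r fineK// ge0_fin_numE// (le_lt_trans (Lam_cell n k))// ltry.
Qed.
Let r0 n k : (0 <= r n k)%R. Proof. by rewrite fine_ge0. Qed.
Let r_eps n k : (r n k <= eps n)%R. Proof. by rewrite -lee_fin -rE Lam_cell. Qed.

Let LamBmE n : Lam Bm = (\sum_(k < L n) r n k)%:E.
Proof.
rewrite -(cell_cover n) measure_semi_additive_ord//.
- by rewrite -sumEFin; apply: eq_bigr => k _; exact: rE.
- by move=> i j _ _ ij; apply/val_inj; exact: (@cell_disjoint n).
- exact: bigsetU_measurable.
Qed.

Let hit n k : set Omega := xi @^-1` missing A `&` ~` (xi @^-1` missing (cell n k)).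
Let mhit n k : measurable (hit n k).
Proof. by apply: measurableI; [exact: mxi|apply: measurableC; exact: mxi]. Qed.

Let P_hit n k : P (hit n k) = (v * (1 - expR (- r n k)))%:E.
Proof.
rewrite /hit -setDE measureD; [|exact: mxi|exact: mxi|by rewrite /= vE ltry].
rewrite /=.
rewrite -preimage_setI -missing_setU (void_prob (measurableU _ _ mA (mcell n k))).
rewrite measureU//; last first.
  by apply/seteqP; split=> // p [Ap [Bp _]]; rewrite -[X in X p]AB; split.
rewrite /= oppeD; last by rewrite rE; apply: fin_num_adde_defl.
rewrite expeRD -(void_prob mA) vE rE -[expeR (- _)]/(expR (- r n k))%:E.
by rewrite -EFinM -EFinB; congr EFin; ring.
Qed.

Let P_hit_le n k : P (hit n k) <= (v * r n k)%:E.
Proof.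
by rewrite P_hit lee_fin ler_wpM2l//; have := expR_ge1Dx (- r n k); lra.
Qed.

Let P_hit_ge n k : (v * r n k * (1 - eps n))%:E <= P (hit n k).
Proof.
rewrite P_hit lee_fin -mulrA ler_wpM2l//.
apply: (@le_trans _ _ (r n k - r n k * r n k)%R).
  by rewrite mulrBr mulr1 lerD2l lerN2 ler_wpM2l.
(* [1 - exp (- r) >= r - r ^ 2], because [exp r >= 1 + r]. *)
rewrite expRN; suff : ((expR (r n k))^-1 <= 1 - (r n k - r n k * r n k))%R by lra.
have r1 : (0 < 1 + r n k)%R by rewrite ltr_wpDr.
apply: (@le_trans _ _ (1 + r n k)^-1%R).
  by rewrite lef_pV2 ?posrE ?expR_gt0 ?expR_ge1Dx.
rewrite -[leLHS]mul1r ler_pdivrMr//.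
have -> : ((1 - (r n k - r n k * r n k)) * (1 + r n k) = 1 + r n k * r n k * r n k)%R by ring.
by rewrite lerDl !mulr_ge0.
Qed.

Let at_void (i : nat) (D : set E) : set Omega := pt i @^-1` D `&` xi @^-1` missing A.
Let mat_void i (D : set E) : measurable D -> measurable (at_void i D).
Proof.
move=> mD; apply: measurableI; last exact: mxi.
by rewrite -[X in measurable X]setTI; exact: mpt.
Qed.

(** Every occupied cell contains at least one point. *)
Let campbell_ge : Lam Bm * v%:E <= \sum_(i <oo) P (at_void i Bm).
Proof.
have lower n : Lam Bm * v%:E * (1 - eps n)%:E <= \sum_(i <oo) P (at_void i Bm).
  apply: (@le_trans _ _ (\sum_(k < L n) P (hit n k))).
    rewrite (LamBmE n) -!EFinM 2!big_distrl/= -sumEFin; apply: lee_sum => k _.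
    by rewrite (mulrC (r n k)); exact: P_hit_ge.
  apply: (@le_trans _ _ (\sum_(k < L n) \sum_(i <oo) P (at_void i (cell n k)))).
    apply: lee_sum => k _; apply: measure_sigma_subadditive.
    - by move=> i; exact: mat_void.
    - exact: mhit.
    - move=> w [wA /= wk]; apply: contrapT => nw; apply: wk.
      apply/missing_supportE => i cp; apply: nw; exists i => //; by split.
  rewrite -nneseries_sum//; apply: lee_nneseries => [i _ _|i _]; first exact: sume_ge0.
  rewrite -(cell_cover n) [X in _ <= P X](_ : _ = \big[setU/set0]_(k < L n) at_void i (cell n k)).
    rewrite measure_semi_additive_ord//.
    - by move=> k; exact: mat_void.
    - move=> k j _ _ [w [[wk _] [wj _]]]; apply/val_inj; apply: (@cell_disjoint n) => //.
      by exists (pt i w); split.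
    - by apply: bigsetU_measurable => k _; exact: mat_void.
  rewrite /at_void -!bigcup_mkord preimage_bigcup setI_bigcupl.
  by rewrite bigcup_mkord.
have cvg_lower : (Lam Bm * v%:E * (1 - eps n)%:E) @[n --> \oo] --> Lam Bm * v%:E * 1%:E.
  apply: cvgeZl; first by rewrite (LamBmE 0).
  apply: cvg_EFin; first by apply: nearW.
  rewrite -[X in _ --> X]subr0; apply: cvgB; first exact: cvg_cst.
  rewrite -[X in _ --> X](mulr0 (C m)); apply: cvgM; first exact: cvg_cst.
  under eq_fun do rewrite -exprVn.
  apply: cvg_expr; rewrite ger0_norm ?invr_ge0// invf_lt1//.
  by rewrite ltr1n.
rewrite -[leLHS]mule1 -(cvg_lim _ cvg_lower)//; apply: lime_le; first exact: cvgP cvg_lower.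
by apply: nearW => n; exact: lower.
Qed.

(** At distinct times the number of points is the limit of the numbers of
    occupied cells, so Fatou's lemma bounds its mean. *)
Let campbell_le : \sum_(i <oo) P (at_void i Bm) <= Lam Bm * v%:E.
Proof.
have mi i : measurable_fun setT (fun w => (\1_(at_void i Bm) w : R)%:E : \bar R).
  by apply/measurable_EFinP; apply: measurable_indic; exact: mat_void.
have mh n k : measurable_fun setT (fun w => (\1_(hit n k) w : R)%:E : \bar R).
  by apply/measurable_EFinP; apply: measurable_indic; exact: mhit.
have -> : \sum_(i <oo) P (at_void i Bm) =
    \int[P]_w (\sum_(i <oo) (\1_(at_void i Bm) w : R)%:E).
  rewrite integral_nneseries//.
  by apply: eq_eseriesr => i _; rewrite integral_indic ?setIT//; exact: mat_void.
apply: (@le_trans _ _ (\int[P]_w limn_einf (fun n => \sum_(k < L n) (\1_(hit n k) w : R)%:E))).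
  apply: ae_ge0_le_integral => //.
  - by move=> w _; apply: nneseries_ge0 => i _ _; rewrite lee_fin.
  - by apply: ge0_emeasurable_sum => // i w _ _; rewrite lee_fin.
  - move=> w _; apply: le_limn_einf; apply: nearW => n; apply: sume_ge0 => k _.
    by rewrite lee_fin.
  - apply: measurableT_comp => //; apply: measurable_fun_limn_esup => n.
    by apply: measurableT_comp => //; apply: emeasurable_sum.
  - apply: filterS tau_inj => w inj _.
    have [wA|wA] := pselect (missing A (xi w)); last first.
      rewrite eseries0 => [|i _ _]; last by rewrite indicE memNset// => -[].
      by apply: le_limn_einf; apply: nearW => n; apply: sume_ge0 => k _; rewrite lee_fin.
    rewrite (eq_eseriesr (g := fun i => (\1_(B `&` K m) (pt i w) : R)%:E)).
      rewrite (count_points_lim mtau mB (mK m) (@K_tau m) inj).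
      apply: lee_limn_einf => n; apply: lee_sum => k _; rewrite !indicE.
      case: (boolP (_ \in _)) => [/set_mem occ|_]; last by rewrite lee_fin.
      by rewrite mem_set.
    move=> i _; rewrite !indicE; congr (_%:R%:E); congr nat_of_bool.
    by apply/idP/idP => [/set_mem[iB _]|/set_mem iB]; apply/mem_set.
apply: le_trans (fatou _ _ _ _) _ => //.
- by move=> n; apply: emeasurable_sum.
- by move=> n w _; apply: sume_ge0 => k _; rewrite lee_fin.
apply: (@le_trans _ _ (limn_einf (fun=> Lam Bm * v%:E))); last first.
  by have [-> _] := cvg_limn_einf_sup (cvg_cst (Lam Bm * v%:E) : _ @ \oo --> _).
rewrite !limn_einf_lim; apply: lee_lim; [exact: is_cvg_einfs|exact: is_cvg_einfs|].
apply: nearW => N; apply: le_ereal_inf_tmp => _ [n /= Nn <-].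
apply: (@le_trans _ _ (\int[P]_w \sum_(k < L n) (\1_(hit n k) w : R)%:E)).
  by apply: ereal_inf_lbound; exists n.
rewrite ge0_integral_sum//.
rewrite (LamBmE n) -EFinM big_distrl/= -sumEFin; apply: lee_sum => k _.
by rewrite integral_indic// setIT mulrC P_hit_le.
Qed.

Lemma campbell_box :
  \sum_(i <oo) P (pt i @^-1` (B `&` K m) `&` xi @^-1` missing A) =
  Lam (B `&` K m) * P (xi @^-1` missing A).
Proof. by apply/eqP; rewrite eq_le vE campbell_le campbell_ge. Qed.

End campbell.

(** Campbell's formula jointly with a void event: points in disjoint sets are
    independent. The means of the counts in boxes increase to those in the whole
    space. *)
Theorem campbell_missing (A B : set E) : measurable A -> measurable B ->
  A `&` B = set0 ->
  \sum_(i <oo) P (pt i @^-1` B `&` xi @^-1` missing A) =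
  Lam B * P (xi @^-1` missing A).
Proof.
move=> mA mB AB.
pose nu := mseries (fun i => image_measure (mrestr P (mxi mA)) (mpt i)) 0.
have nuE D : nu D = \sum_(i <oo) P (pt i @^-1` D `&` xi @^-1` missing A).
  by rewrite /nu /mseries ereal_series.
have nd : nondecreasing_seq (fun m => B `&` K m).
  move=> m n mn; apply/subsetPset => p [Bp Kp]; split => //.
  by move: p Kp {Bp}; exact/subsetPset/K_nd.
have cup : \bigcup_m (B `&` K m) = B by rewrite -setI_bigcupr K_cover setIT.
have mBK m : measurable (B `&` K m) by exact: measurableI.
have mcup : measurable (\bigcup_m (B `&` K m)) by rewrite cup.
have nu_cvg : nu \o (fun m => B `&` K m) @ \oo --> nu B.
  by rewrite -[X in nu X]cup; exact: nondecreasing_cvg_mu.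
have Lam_cvg : Lam \o (fun m => B `&` K m) @ \oo --> Lam B.
  by rewrite -[X in Lam X]cup; exact: nondecreasing_cvg_mu.
rewrite nuE in nu_cvg.
have vfin : P (xi @^-1` missing A) \is a fin_num.
  by rewrite fin_num_measure//; exact: mxi.
have := cvgeZr vfin Lam_cvg.
have -> : (fun m => (Lam \o (fun m => B `&` K m)) m * P (xi @^-1` missing A)) =
    nu \o (fun m => B `&` K m).
  by apply/funext => m /=; rewrite nuE campbell_box.
by move=> /(cvg_unique _ nu_cvg) ->.
Qed.

Let Lam_K m : Lam (K m) < +oo.
Proof. exact: (box_fin (@K_tau m) (@K_fin m)). Qed.

Let mjoint i : measurable_fun setT (fun w => (pt i w, xi w)).
Proof. by apply: measurable_fun_pair; [exact: mpt|exact: measurable_support]. Qed.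

Let add_point (z : E * Omega) : E * configuration E :=
  (z.1, xi z.2 `|` [set z.1]).

Let missing_add_point (A : set E) z :
  missing A (add_point z).2 <-> ~ A z.1 /\ missing A (xi z.2).
Proof.
rewrite /missing /= setIUl setU_eq0; split=> [[-> zA]|[nA ->]].
  by split => // Az; have : ([set z.1] `&` A) z.1 by []; rewrite zA.
by split => //; apply/seteqP; split=> // _ [->] /nA.
Qed.

Let madd_point : measurable_fun setT add_point.
Proof.
apply: measurable_fun_pair; first exact: measurable_fst.
apply: (@measurability _ _ _ (configuration E) setT _ (void_events (E := E)) (erefl _)).
move=> _ [_ [A mA <-] <-]; rewrite setTI.
have -> : (fun z => (add_point z).2) @^-1` missing A =
    (~` A) `*` (xi @^-1` missing A).
  by apply/seteqP; split=> z /missing_add_point.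
by apply: measurableX; [exact: measurableC|exact: mxi].
Qed.

(** Mecke's formula: a typical point of the process sees an independent copy of
    the process, with itself added. Both sides are integrals of [f], for measures
    that agree on products of a set [B] of points and the event that [A] is
    void: there only the points of [B] outside [A] contribute, and Campbell's
    formula applies to the disjoint sets [A] and [B \ A]. *)
Theorem mecke (f : E * configuration E -> \bar R) :
  measurable_fun setT f -> (forall z, 0 <= f z) ->
  \sum_(i <oo) \int[P]_w f (pt i w, xi w) =
  \int[Lam]_p \int[P]_w f (p, xi w `|` [set p]).
Proof.
move=> mf f0.
pose m1 := mseries (fun i => image_measure P (mjoint i)) 0.
pose m2 := image_measure (Lam \x P) madd_point.
transitivity (\int[m1]_z f z).
  rewrite ge0_integral_measure_series//.
  by apply: eq_eseriesr => i _; rewrite ge0_integral_image.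
transitivity (\int[m2]_z f z); last first.
  rewrite ge0_integral_image// fubini_tonelli1//.
  exact: measurableT_comp mf madd_point.
pose G := [set B `*` D | B in @measurable _ E & D in void_events (E := E)].
apply: eq_measure_integral => D mD _.
apply: (@measure_unique _ R (E * configuration E)%type G (fun m => K m `*` setT)) => //.
- by apply: measurable_prod_generator; exists set0 => //; rewrite missing0.
- move=> _ _ [B1 mB1 [_ [A1 mA1 <-] <-]] [B2 mB2 [_ [A2 mA2 <-] <-]].
  exists (B1 `&` B2); first exact: measurableI.
  exists (missing (A1 `|` A2)); first by exists (A1 `|` A2) => //; exact: measurableU.
  by rewrite missing_setU setXI.
- by move=> m; exists (K m) => //; exists setT => //; exists set0 => //; rewrite missing0.
- by rewrite -setX_bigcupl K_cover setXTT.
- move=> _ [B mB [_ [A mA <-] <-]].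
  transitivity (Lam (B `\` A) * P (xi @^-1` missing A)).
    rewrite -campbell_missing//; [|exact: measurableD|by rewrite setDE setICA setICr setI0].
    rewrite /m1 /mseries ereal_series; apply: eq_eseriesr => i _; congr (P _).
    apply/seteqP; split=> w /= [Bi wA]; last by case: Bi.
    by split => //; split => //; move/missing_supportE : wA.
  rewrite -product_measure1E; [|exact: measurableD|exact: mxi].
  congr ((Lam \x P) _); apply/seteqP; split=> z /=.
    by move=> [[Bz nAz] xiA]; split => //; exact/missing_add_point.
  by move=> [Bz /missing_add_point[nA xiA]]; split.
- move=> m; suff m1E : m1 (K m `*` setT) = Lam (K m) by move: (Lam_K m); rewrite -m1E.
  rewrite /m1 /mseries ereal_series -[RHS]mule1.
  rewrite -(probability_setT P) -(preimage_setT xi) -(missing0 E).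
  by rewrite -campbell_missing//; rewrite set0I.
Qed.

Let Lam_cover : \bigcup_m (K m `*` K m) = [set: E * E].
Proof.
apply/seteqP; split=> // -[p q] _.
have [m _ Kp] : (\bigcup_m K m) p by rewrite K_cover.
have [n _ Kq] : (\bigcup_m K m) q by rewrite K_cover.
exists (maxn m n) => //; split.
  by move: p Kp; exact/subsetPset/K_nd/leq_maxl.
by move: q Kq; exact/subsetPset/K_nd/leq_maxr.
Qed.

Lemma campbell_count (B : set E) : measurable B -> \sum_(i <oo) P (pt i @^-1` B) = Lam B.
Proof.
move=> mB; have := campbell_missing measurable0 mB (set0I _).
rewrite missing0 preimage_setT probability_setT mule1 => <-.
by apply: eq_eseriesr => i _; rewrite setIT.
Qed.

Let mpt_preimage i (B : set E) : measurable B -> measurable (pt i @^-1` B).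
Proof. by move=> mB; rewrite -[X in measurable X]setTI; exact: mpt. Qed.

Let pairs (A B : set E) i j : set Omega := pt i @^-1` A `&` pt j @^-1` B.

Let measurable_pairs (A B : set E) i j : measurable A -> measurable B ->
  measurable (pairs A B i j).
Proof. by move=> mA mB; apply: measurableI; exact: mpt_preimage. Qed.

(** The number of points in [B] is a functional of the configuration that does
    not see an additional point in [A]. *)
Let campbell_pairs_box (A B : set E) m : measurable A -> measurable B ->
  A `&` B = set0 ->
  \sum_(i <oo) \sum_(j <oo) P (pairs A (B `&` K m) i j) = Lam A * Lam (B `&` K m).
Proof.
move=> mA mB AB.
have mBm : measurable (B `&` K m) by exact: measurableI.
pose occ n (Z : configuration E) : \bar R :=
  \sum_(k < slices m n) (\1_(~` missing (cell tau m B (K m) n k)) Z : R)%:E.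
have mcell n k : measurable (cell tau m B (K m) n k) by exact: measurable_cell.
have mocc n : measurable_fun setT (occ n).
  apply: emeasurable_sum => k; apply/measurable_EFinP; apply: measurable_indic.
  by apply: measurableC; exact: measurable_missing.
have occ0 n Z : 0 <= occ n Z by apply: sume_ge0 => k _; rewrite lee_fin.
pose N (Z : configuration E) := limn_einf (occ ^~ Z).
have mN : measurable_fun setT N.
  apply: measurableT_comp => //; apply: measurable_fun_limn_esup => n.
  exact: measurableT_comp.
have N0 Z : 0 <= N Z by apply: le_limn_einf; apply: nearW => n; exact: occ0.
have NE : {ae P, forall w, N (xi w) = \sum_(j <oo) (\1_(B `&` K m) (pt j w) : R)%:E}.
  by apply: filterS tau_inj => w inj; rewrite (count_points_lim mtau mB (mK m) (@K_tau m) inj).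
have NxiE : {ae P, forall w, setT w -> N (xi w) = \sum_(j <oo) (\1_(B `&` K m) (pt j w) : R)%:E}.
  by apply: filterS NE => w ->.
have mind j (D : set E) : measurable D ->
    measurable_fun setT (fun w => (\1_D (pt j w) : R)%:E).
  move=> mD; apply/measurable_EFinP; apply: measurableT_comp => //.
have mcount : measurable_fun setT
    (fun w => \sum_(j <oo) (\1_(B `&` K m) (pt j w) : R)%:E).
  by apply: ge0_emeasurable_sum => *; [rewrite lee_fin|exact: mind].
have count0 w : 0 <= \sum_(j <oo) (\1_(B `&` K m) (pt j w) : R)%:E.
  by apply: nneseries_ge0 => *; rewrite lee_fin.
pose f (z : E * configuration E) : \bar R := (\1_A z.1 : R)%:E * N z.2.
have mf : measurable_fun setT f.
  apply: emeasurable_funM; last exact: measurableT_comp mN measurable_snd.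
  by apply/measurable_EFinP; apply: measurableT_comp measurable_fst; exact: measurable_indic.
have f0 z : 0 <= f z by rewrite mule_ge0// lee_fin.
have int_count : \int[P]_w N (xi w) = Lam (B `&` K m).
  transitivity (\int[P]_w \sum_(j <oo) (\1_(B `&` K m) (pt j w) : R)%:E).
    apply: ge0_ae_eq_integral => //.
    - exact: measurableT_comp mN measurable_support.
  rewrite integral_nneseries//; last by move=> j; exact: mind.
  rewrite -campbell_count//; apply: eq_eseriesr => j _.
  rewrite -[in RHS](setIT (pt j @^-1` _)) -integral_indic//.
  exact: mpt_preimage.
transitivity (\sum_(i <oo) \int[P]_w f (pt i w, xi w)).
  apply: eq_eseriesr => i _.
  transitivity (\int[P]_w ((\1_A (pt i w) : R)%:E *
      \sum_(j <oo) (\1_(B `&` K m) (pt j w) : R)%:E)).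
    under eq_integral do rewrite -nneseriesZl//.
    rewrite integral_nneseries//; last by move=> j; apply: emeasurable_funM; exact: mind.
    apply: eq_eseriesr => j _.
    rewrite -[pairs _ _ _ _]setIT -integral_indic//; last exact: measurable_pairs.
    apply: eq_integral => w _; rewrite -EFinM /pairs; congr EFin.
    by rewrite !indicE in_setI -natrM mulnb.
  apply: ge0_ae_eq_integral => //.
  - by apply: emeasurable_funM => //; exact: mind.
  - exact: measurableT_comp mf (mjoint i).
  - by move=> w _; rewrite mule_ge0// lee_fin.
  - by apply: filterS NE => w Nw _; rewrite /f /= Nw.
rewrite mecke//.
transitivity (\int[Lam]_p ((\1_A p : R)%:E * Lam (B `&` K m))).
  apply: eq_integral => p _; rewrite /f /=.
  have [Ap|nAp] := boolP (p \in A); last first.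
    by rewrite integral0_eq => [|w _] /=; rewrite indicE (negbTE nAp) mul0e.
  rewrite indicE Ap mul1e -int_count; apply: eq_integral => w _; rewrite mul1e.
  congr limn_einf; apply/funext => n; rewrite /occ; apply: eq_bigr => k _.
  rewrite !indicE; congr (_%:R%:E); congr nat_of_bool.
  apply: asbool_equiv_eq; rewrite /setC /missing /= setIUl.
  rewrite [X in _ `|` X](_ : _ = set0) ?setU0//.
  apply/seteqP; split=> // q [-> [Bp _]].
  by rewrite -[X in X p]AB; split => //; exact/set_mem.
rewrite ge0_integralZr//; last by apply/measurable_EFinP; exact: measurable_indic.
by rewrite integral_indic// setIT.
Qed.

Lemma campbell_pairs (A B : set E) : measurable A -> measurable B ->
  A `&` B = set0 -> Lam A < +oo ->
  \sum_(i <oo) \sum_(j <oo) P (pairs A B i j) = Lam A * Lam B.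
Proof.
move=> mA mB AB LamA.
pose nu := mseries (fun i => mseries (fun j => 
  image_measure (mrestr P (mpt_preimage i mA)) (mpt j)) 0) 0.
have nuE D : nu D = \sum_(i <oo) \sum_(j <oo) P (pairs A D i j).
  rewrite /nu /mseries ereal_series; apply: eq_eseriesr => i _.
  by rewrite ereal_series; apply: eq_eseriesr => j _; rewrite /pairs setIC.
have nd : nondecreasing_seq (fun m => B `&` K m).
  move=> m n mn; apply/subsetPset => p [Bp Kp]; split => //.
  by move: p Kp {Bp}; exact/subsetPset/K_nd.
have cup : \bigcup_m (B `&` K m) = B by rewrite -setI_bigcupr K_cover setIT.
have mBK m : measurable (B `&` K m) by exact: measurableI.
have mcup : measurable (\bigcup_m (B `&` K m)) by rewrite cup.
have nu_cvg : nu \o (fun m => B `&` K m) @ \oo --> nu B.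
  by rewrite -[X in nu X]cup; exact: nondecreasing_cvg_mu.
have Lam_cvg : Lam \o (fun m => B `&` K m) @ \oo --> Lam B.
  by rewrite -[X in Lam X]cup; exact: nondecreasing_cvg_mu.
have Afin : Lam A \is a fin_num by rewrite ge0_fin_numE.
have := cvgeZl Afin Lam_cvg.
have -> : (fun m => Lam A * (Lam \o (fun m => B `&` K m)) m) =
    nu \o (fun m => B `&` K m).
  by apply/funext => m /=; rewrite nuE campbell_pairs_box.
rewrite nuE in nu_cvg.
by move=> /(cvg_unique _ nu_cvg) ->.
Qed.

(** Pairs of points at distinct times are separated by a rational time, on both
    sides of which the process is independent. *)
Theorem null_pairs (D : set (E * E)) : measurable D -> (Lam \x Lam) D = 0 ->
  {ae P, forall w i j, (tau (pt j w) < tau (pt i w))%R -> ~ D (pt i w, pt j w)}.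
Proof.
move=> mD D0.
have mtau_ge r : measurable [set p | (r <= tau p)%R].
  have := @mtau measurableT _ (measurable_itv `[r, +oo[).
  by rewrite setTI; congr measurable; apply/seteqP; split=> p /=; rewrite in_itv/= andbT.
have mtau_lt r : measurable [set p | (tau p < r)%R].
  have := @mtau measurableT _ (measurable_itv `]-oo, r[).
  by rewrite setTI; congr measurable; apply/seteqP; split=> p /=; rewrite in_itv.
have mpair i j : measurable_fun setT (fun w => (pt i w, pt j w)).
  by apply: measurable_fun_pair; exact: mpt.
pose V r m := (K m `&` [set p | (r <= tau p)%R]) `*` (K m `&` [set q | (tau q < r)%R]).
have null r m i j : P ((fun w => (pt i w, pt j w)) @^-1` (D `&` V r m)) = 0.
  have mKge : measurable (K m `&` [set p | (r <= tau p)%R]) by exact: measurableI.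
  have mKlt : measurable (K m `&` [set p | (tau p < r)%R]) by exact: measurableI.
  have mV : measurable (V r m) by exact: measurableX.
  pose nu := mseries (fun i => mseries (fun j => image_measure P (mpair i j)) 0) 0.
  have nuE X : nu X = \sum_(i <oo) \sum_(j <oo) P ((fun w => (pt i w, pt j w)) @^-1` X).
    rewrite /nu /mseries ereal_series; apply: eq_eseriesr => k _.
    by rewrite ?ereal_series.
  have nuX A B : measurable A -> measurable B -> mrestr nu mV (A `*` B) =
      Lam (A `&` (K m `&` [set p | (r <= tau p)%R])) *
      Lam (B `&` (K m `&` [set p | (tau p < r)%R])).
    move=> mA mB; rewrite /mrestr -setXI nuE -campbell_pairs//.
    - exact: measurableI.
    - exact: measurableI.
    - apply/seteqP; split=> // p [[_ [_ /= rp]] [_ [_ /=]]].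
      by rewrite ltNge rp.
    - apply: le_lt_trans (Lam_K m); apply: le_measure; rewrite ?inE//.
        by apply: measurableI.
      by move=> p [_ []].
  have nuD : mrestr nu mV D = mrestr (Lam \x Lam) mV D.
    pose G := [set A `*` B | A in @measurable _ E & B in @measurable _ E].
    apply: (@measure_unique _ R (E * E)%type G (fun=> setT)) => //.
    - exact: measurable_prod_measurableType.
    - move=> _ _ [A1 mA1 [B1 mB1 <-]] [A2 mA2 [B2 mB2 <-]].
      exists (A1 `&` A2); first exact: measurableI.
      by exists (B1 `&` B2); [exact: measurableI|rewrite setXI].
    - by move=> _; exists setT => //; exists setT => //; rewrite setXTT.
    - by apply/seteqP; split=> // z _; exists 0%N.
    - move=> _ [A mA [B mB <-]]; apply: (etrans (nuX _ _ mA mB)).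
      by rewrite /= /mrestr -setXI product_measure1E//; exact: measurableI.
    - move=> _; have := nuX setT setT measurableT measurableT.
      rewrite setXTT !setTI => nuT; rewrite [ltLHS]nuT.
      have fin S : measurable (K m `&` S) -> Lam (K m `&` S) < +oo.
        move=> mS; apply: le_lt_trans (Lam_K m).
        by apply: le_measure; rewrite ?inE//; by move=> z [].
      by rewrite lte_mul_pinfty// ?fin// ge0_fin_numE// fin.
  have nu0 : nu (D `&` V r m) = 0.
    have -> : nu (D `&` V r m) = (Lam \x Lam) (D `&` V r m) by exact: nuD.
    apply/eqP; rewrite -measure_le0 -D0; apply: le_measure; rewrite ?inE//.
    exact: measurableI.
  apply/eqP; rewrite -measure_le0 -nu0 nuE.
  have term_ge0 k l : 0 <= P ((fun w => (pt k w, pt l w)) @^-1` (D `&` V r m)) by [].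
  apply: le_trans (le_nneseries_term j (term_ge0 i)) _.
  apply: (@le_nneseries_term R (fun k => \sum_(l <oo) P ((fun w => (pt k w, pt l w)) @^-1` (D `&` V r m))) i).
  by move=> k; exact: nneseries_ge0.
pose rational n : R := ratr (odflt (0%R : rat) (choice.unpickle n)).
have aenull (n m i j : nat) : {ae P, forall w,
    ~ (D `&` V (rational n) m) (pt i w, pt j w)}.
  exists ((fun w => (pt i w, pt j w)) @^-1` (D `&` V (rational n) m)).
  split; [|exact: null|by move=> w /= /contrapT].
  rewrite -[X in measurable X]setTI; apply: mpair => //.
  by apply: measurableI => //; apply: measurableX; exact: measurableI.
have {}aenull : {ae P, forall w (n m i j : nat),
    ~ (D `&` V (rational n) m) (pt i w, pt j w)}.
  by do 4![apply/ae_foralln => ?]; exact: aenull.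
apply: filterS aenull => w aenull i j tji Dij.
have [q] := rat_in_itvoo tji; rewrite in_itv/= => /andP[jq qi].
have [m _ [Ki Kj]] : (\bigcup_m (K m `*` K m)) (pt i w, pt j w) by rewrite Lam_cover.
apply: (aenull (choice.pickle q) m i j); split => //.
by rewrite /rational choice.pickleK; split; split => //=; exact: ltW.
Qed.

End enumerated_process.

(** * The law of a simple point process *)

Section point_sequences.
Context dE (E : measurableType dE) (R : realType).
Variables (tau : E -> R) (K : nat -> set E).
Hypotheses (mtau : measurable_fun setT tau) (mK : forall m, measurable (K m))
  (K_nd : nondecreasing_seq K) (K_cover : \bigcup_m K m = setT)
  (K_tau : forall m p, K m p -> (- m%:R <= tau p < m%:R)%R).

Definition simple_sequence : set (nat -> E) :=
  [set s : nat -> E | injective (tau \o s) /\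
    forall m, \sum_(i <oo) (\1_(K m) (s i) : R)%:E < +oo].

(** Sequences with the sigma-algebra that sees the set of points only, and
    whether points are simple and locally finite, but not their numbering. *)
Definition sequence_events : set (set (nat -> E)) :=
  [set (support @^-1` missing A) `&` H |
    A in @measurable _ E & H in [set setT; simple_sequence]].

Definition point_sequence : Type := g_sigma_algebraType sequence_events.
HB.instance Definition _ := Measurable.on point_sequence.

Lemma sequence_events_missing (A : set E) : measurable A ->
  sequence_events (support @^-1` missing A).
Proof. by move=> mA; exists A => //; exists setT; [left|rewrite setIT]. Qed.

Lemma measurable_support_sequence :
  measurable_fun setT (support : point_sequence -> configuration E).
Proof.
apply: (@measurability _ _ point_sequence (configuration E) setT _
  (void_events (E := E)) (erefl _)).
move=> _ [_ [A mA <-] <-]; rewrite setTI; apply: sub_sigma_algebra.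
exact: sequence_events_missing.
Qed.

Lemma measurable_simple_sequence : measurable (simple_sequence : set point_sequence).
Proof.
apply: sub_sigma_algebra; exists set0 => //; exists simple_sequence; first by right.
by rewrite missing0 preimage_setT setTI.
Qed.

(** Zero off the simple sequences, so that all values are locally finite. *)
Definition count_measure (s : point_sequence) : {measure set E -> \bar R} :=
  if `[< simple_sequence s >]
  then (mseries (fun i => \d_(s i)) 0 : {measure set E -> \bar R})
  else (mzero : {measure set E -> \bar R}).

Lemma count_measureE s B : simple_sequence s ->
  count_measure s B = \sum_(i <oo) (\1_B (s i) : R)%:E.
Proof.
by move=> simp; rewrite /count_measure asboolT//= /mseries ereal_series.
Qed.

Lemma count_measure0 s B : ~ simple_sequence s -> count_measure s B = 0.
Proof. by move=> nsimp; rewrite /count_measure asboolF. Qed.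

Lemma count_measure_fin s m : count_measure s (K m) < +oo.
Proof.
have [simp|nsimp] := pselect (simple_sequence s); last by rewrite count_measure0.
by rewrite count_measureE//; case: simp => _; apply.
Qed.

(** On simple sequences the count in a box is a limit of numbers of occupied
    cells, hence does not depend on the numbering. *)
Lemma measurable_count_measure (B : set E) : measurable B ->
  measurable_fun setT (count_measure ^~ B).
Proof.
move=> mB.
apply: (emeasurable_fun_cvg (fun m s => count_measure s (B `&` K m))); last first.
  move=> s _; have := @nondecreasing_cvg_mu _ _ _ (count_measure s) (fun m => B `&` K m).
  rewrite -setI_bigcupr K_cover setIT; apply => //.
    by move=> m; exact: measurableI.
  move=> m n mn; apply/subsetPset => p [Bp Kp]; split => //.
  by move: p Kp {Bp}; exact/subsetPset/K_nd.
move=> m; rewrite (_ : (fun s => _) = (fun s => limn_einf (fun n =>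
    (\1_simple_sequence s : R)%:E * occupied_cells tau m B (K m) n s))).
  apply: measurableT_comp => //; apply: measurable_fun_limn_esup => n.
  apply: measurableT_comp => //; apply: emeasurable_funM.
    by apply/measurable_EFinP; apply: measurable_indic; exact: measurable_simple_sequence.
  apply: emeasurable_sum => k; apply/measurable_EFinP.
  apply: measurableT_comp measurable_support_sequence.
  apply: measurable_indic; apply: measurableC; apply: measurable_missing.
  exact: measurable_cell.
apply/funext => s; have [simp|nsimp] := pselect (simple_sequence s).
  rewrite count_measureE// (count_points_lim mtau mB (mK m) (@K_tau m)); last by case: simp.
  by congr limn_einf; apply/funext => n; rewrite indicE mem_set// mul1e.
rewrite count_measure0//; under eq_fun do rewrite indicE memNset// mul0e.
by have [-> _] := cvg_limn_einf_sup (cvg_cst (0 : \bar R) : _ @ \oo --> _).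
Qed.

HB.instance Definition _ := isKernel.Build _ _ point_sequence E R count_measure
  measurable_count_measure.

Lemma measurable_count_integral (f : E * configuration E -> \bar R) :
  measurable_fun setT f -> (forall z, 0 <= f z) ->
  measurable_fun setT (fun s : point_sequence =>
    \int[count_measure s]_p f (p, support s)).
Proof.
move=> mf f0.
apply: (@measurable_kernel_integral _ _ point_sequence E R count_measure _ mK K_nd
  K_cover count_measure_fin (fun z => f (z.2, support z.1))) => //.
apply: measurableT_comp mf _; apply: measurable_fun_pair; first exact: measurable_snd.
exact: measurableT_comp measurable_support_sequence measurable_fst.
Qed.

Lemma count_integralE s (f : E -> \bar R) : simple_sequence s ->
  measurable_fun setT f -> (forall p, 0 <= f p) ->
  \int[count_measure s]_p f p = \sum_(i <oo) f (s i).
Proof.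
move=> simp mf f0; rewrite /count_measure asboolT//.
rewrite ge0_integral_measure_series//; apply: eq_eseriesr => i _.
by rewrite integral_dirac// diracT mul1e.
Qed.

Section law.
Context d (Omega : measurableType d) (P : probability Omega R).

Section measurable_sequence.
Variables (pt : nat -> Omega -> E) (mpt : forall i, measurable_fun setT (pt i)).
Hypothesis simp : forall w, simple_sequence (pt ^~ w).

Let sequence_of w : point_sequence := pt ^~ w.

Lemma sequence_of_preimage (A : set E) H : [set setT; simple_sequence] H ->
  sequence_of @^-1` ((support @^-1` missing A) `&` H) =
  (fun w => support (pt ^~ w)) @^-1` missing A.
Proof.
move=> [->|->]; first by rewrite setIT.
by rewrite preimage_setI; apply: setIidl => w _; exact: simp.
Qed.

Lemma measurable_sequence : measurable_fun setT sequence_of.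
Proof.
apply: (@measurability _ _ Omega point_sequence setT _ sequence_events (erefl _)).
move=> _ [_ [A mA [H GH <-]] <-]; rewrite sequence_of_preimage//.
by apply: (measurable_support mpt) => //; exact: measurable_missing.
Qed.

End measurable_sequence.

(** The law of a simple point process is determined by its void
    probabilities, since these are the probabilities of events that are stable
    under intersection. *)
Lemma eq_void_eq_law (pt pt' : nat -> Omega -> E) :
  (forall i, measurable_fun setT (pt i)) -> (forall i, measurable_fun setT (pt' i)) ->
  (forall w, simple_sequence (pt ^~ w)) -> (forall w, simple_sequence (pt' ^~ w)) ->
  (forall A, measurable A ->
    P ((fun w => support (pt ^~ w)) @^-1` missing A) =
    P ((fun w => support (pt' ^~ w)) @^-1` missing A)) ->
  forall D : set point_sequence, measurable D ->
    P ((fun w => pt ^~ w) @^-1` D) = P ((fun w => pt' ^~ w) @^-1` D).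
Proof.
move=> mpt mpt' simp simp' void_eq D mD.
pose m1 := image_measure P (measurable_sequence mpt simp).
pose m2 := image_measure P (measurable_sequence mpt' simp').
apply: (@measure_unique _ R point_sequence sequence_events (fun=> setT) _ _ _ _ m1 m2) => //.
- move=> _ _ [A1 mA1 [H1 GH1 <-]] [A2 mA2 [H2 GH2 <-]].
  exists (A1 `|` A2); first exact: measurableU.
  exists (H1 `&` H2); last by rewrite missing_setU preimage_setI setIACA.
  by move: GH1 GH2 => [->|->] [->|->]; rewrite ?setIT ?setTI ?setIid; [left|right..].
- move=> _; have := sequence_events_missing measurable0.
  by rewrite missing0 preimage_setT.
- by apply/seteqP; split=> // z _; exists 0%N.
- move=> _ [A mA [H GH <-]]; rewrite /m1 /m2 /= /pushforward.
  by rewrite !sequence_of_preimage// void_eq.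
- by move=> _; rewrite /m1 /= /pushforward preimage_setT probability_setT ltry.
Qed.

End law.
End point_sequences.

(** * Generating functions of independent counts *)

Section poisson_generating_function.
Context {R : realType}.

Lemma nneseries_exp_coeff (x : R) : (0 <= x)%R ->
  \sum_(n <oo) (exp_coeff x n)%:E = (expR x)%:E.
Proof.
move=> x0; rewrite /expR -EFin_lim; last exact: is_cvg_series_exp_coeff.
by apply/congr_lim/funext => n /=; rewrite /series/= -sumEFin.
Qed.

Lemma poisson_generating_function (m r : R) : (0 <= m)%R -> (0 <= r)%R ->
  \sum_(n <oo) (r ^+ n)%:E * poisson_prob m 0%N [set n] =
  (expR (- ((1 - r) * m)))%:E.
Proof.
move=> m0 r0; have [->|mN0] := eqVneq m 0%R.
  rewrite mulr0 oppr0 expR0 nneseries_recl//; last first.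
    by move=> n _; apply: mule_ge0; [rewrite lee_fin exprn_ge0|exact: measure_ge0].
  rewrite /poisson_prob ltxx diracE mem_set// expr0 mul1e.
  rewrite eseries_cond/= eseries0 ?adde0// => -[|n]//= _ _.
  by rewrite diracE memNset ?mule0.
have {}m0 : (0 < m)%R by rewrite lt_def mN0.
have -> : (- ((1 - r) * m) = - m + r * m)%R by ring.
have rm0 : (0 <= r * m)%R by rewrite mulr_ge0// ltW.
rewrite expRD EFinM -(nneseries_exp_coeff rm0).
rewrite -nneseriesZl; last first.
  by move=> n _; rewrite lee_fin exp_coeff_ge0.
apply: eq_eseriesr => n _; rewrite /poisson_prob m0 esum_set1; last by rewrite lee_fin poisson_pmf_ge0.
by rewrite -!EFinM /poisson_pmf m0 /exp_coeff /= exprMn; congr EFin; ring.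
Qed.

End poisson_generating_function.

Section products.
Context {R : realType}.

Lemma prod_fset_iota (F : nat -> \bar R) n :
  \prod_(i <- [fset i in iota 0 n]%fset) F i = \prod_(i < n) F i.
Proof.
rewrite -(big_mkord xpredT) /index_iota subn0; apply: perm_big.
by apply: uniq_perm; rewrite ?fset_uniq ?iota_uniq// => i; rewrite !inE.
Qed.

Lemma prod_fset_ord n (F : 'I_n -> \bar R) :
  \prod_(i <- [fset i in enum 'I_n]%fset) F i = \prod_(i < n) F i.
Proof.
apply: perm_big; apply: uniq_perm; rewrite ?fset_uniq ?index_enum_uniq// => i.
by rewrite !inE mem_enum mem_index_enum.
Qed.

Lemma prode_ge0 (I : Type) (s : seq I) (Q : pred I) (F : I -> \bar R) :
  (forall i, 0 <= F i) -> 0 <= \prod_(i <- s | Q i) F i.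
Proof. by move=> F0; elim/big_ind : _ => // x y; exact: mule_ge0. Qed.

Lemma ge0_nneseriesZl (f : nat -> \bar R) (y : \bar R) : 0 <= y ->
  (forall i, 0 <= f i) -> \sum_(i <oo) y * f i = y * \sum_(i <oo) f i.
Proof.
move=> y0 f0; case: y y0 => [y|_|//]; first by rewrite nneseriesZl.
have [f_eq0|] := pselect (forall i, f i = 0).
  by rewrite !eseries0 ?mule0// => i _ _; rewrite f_eq0 ?mule0.
move=> /existsNP[i /eqP fi]; have {}fi : 0 < f i by rewrite lt_def fi f0.
rewrite gt0_mulye; last exact: lt_le_trans fi (le_nneseries_term _ f0).
have : +oo * f i <= \sum_(i <oo) +oo * f i.
  by apply: (@le_nneseries_term _ (fun i => +oo * f i) i) => j; rewrite mule_ge0.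
by rewrite gt0_mulye// leye_eq => /eqP.
Qed.

Lemma emeasurable_prod d (T : measurableType d) (I : Type) (s : seq I)
    (F : I -> T -> \bar R) : (forall i, measurable_fun setT (F i)) ->
  measurable_fun setT (fun x => \prod_(i <- s) F i x).
Proof.
move=> mF; elim: s => [|i s IH].
  by under eq_fun do rewrite big_nil; exact: measurable_cst.
by under eq_fun do rewrite big_cons; exact: emeasurable_funM.
Qed.

Lemma prodEFin (I : Type) (s : seq I) (F : I -> R) :
  \prod_(i <- s) (F i)%:E = (\prod_(i <- s) F i)%:E.
Proof. by elim/big_rec2 : _ => // i x y _ ->; rewrite EFinM. Qed.

End products.

Section independent_counts.
Context d (Omega : measurableType d) (R : realType) (P : probability Omega R).
Variables (n : nat) (N : 'I_n -> Omega -> \bar R) (r : 'I_n -> R).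
Hypotheses (mN : forall i, measurable_fun setT (N i)) (r0 : forall i, (0 <= r i)%R)
  (indep : mutually_independent P (fun i => sigma_generated (N i))).

(** [a] to the power of a count, and 0 when the count is infinite. *)
Definition power_count (a : R) (v : \bar R) : \bar R :=
  \sum_(k <oo) (a ^+ k)%:E * (\1_[set k%:R%:E] v)%:E.

Let indicN i (k : nat) w : \bar R := (\1_[set k%:R%:E] (N i w))%:E.
Let levelN i (k : nat) : set Omega := [set w | N i w = k%:R%:E].
Let mlevelN i k : measurable (levelN i k).
Proof.
have := @mN i measurableT [set k%:R%:E] (emeasurable_set1 _).
by rewrite setTI.
Qed.
Let indicNE i k w : indicN i k w = (\1_(levelN i k) w)%:E.
Proof. by rewrite /indicN !indicE; congr (_%:R%:E); congr nat_of_bool; apply: asbool_equiv_eq. Qed.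

Let mindicN i k : measurable_fun setT (indicN i k).
Proof.
rewrite (_ : indicN i k = fun w => (\1_(levelN i k) w)%:E); last exact/funext.
by apply/measurable_EFinP; exact: measurable_indic.
Qed.

Let mpower i : measurable_fun setT (fun w => power_count (r i) (N i w)).
Proof.
apply: ge0_emeasurable_sum => k *; first by rewrite mule_ge0// lee_fin ?exprn_ge0.
by apply: emeasurable_funM => //; exact: mindicN.
Qed.

Let power_ge0 i w : 0 <= power_count (r i) (N i w).
Proof. by apply: nneseries_ge0 => k _ _; rewrite mule_ge0// lee_fin ?exprn_ge0. Qed.

Let C i : \bar R := \sum_(k <oo) (r i ^+ k)%:E * P (levelN i k).

(** The generating functions are expanded into series one after the other; once
    all are expanded, the independence of the events [N i = e i] applies. *)
Let factor (j : nat) (e : 'I_n -> nat) (i : 'I_n) w : \bar R :=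
  if (i < j)%N then indicN i (e i) w else power_count (r i) (N i w).
Let mean (j : nat) (e : 'I_n -> nat) (i : 'I_n) : \bar R :=
  if (i < j)%N then P (levelN i (e i)) else C i.

Let mfactor j e i : measurable_fun setT (factor j e i).
Proof.
rewrite /factor; case: (i < j)%N; first exact: mindicN.
exact: mpower.
Qed.

Let factor_ge0 j e i w : 0 <= factor j e i w.
Proof. by rewrite /factor; case: ifP => _ //; rewrite /indicN lee_fin. Qed.

Let C_ge0 i : 0 <= C i.
Proof. by apply: nneseries_ge0 => k _ _; rewrite mule_ge0// lee_fin exprn_ge0. Qed.

Let mean_ge0 j e i : 0 <= mean j e i.
Proof. by rewrite /mean; case: ifP. Qed.

Let expand k : (k <= n)%N -> forall e,
  \int[P]_w \prod_(i < n) factor (n - k) e i w = \prod_(i < n) mean (n - k) e i.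
Proof.
elim: k => [_|k IH kn] e.
  rewrite subn0.
  transitivity (P (\bigcap_(i in [set` [fset i in enum 'I_n]%fset]) levelN i (e i))).
    rewrite -[X in P X]setIT -integral_indic//; last first.
      by apply: fin_bigcap_measurable => // i _; exact: mlevelN.
    apply: eq_integral => w _.
    rewrite (eq_bigr (fun i => (\1_(levelN i (e i)) w)%:E)); last first.
      by move=> i _; rewrite /factor ltn_ord indicNE.
    rewrite prodEFin; congr EFin.
    have [all_in|] := pselect (forall i, levelN i (e i) w).
      rewrite big1 => [|i _]; first by rewrite indicE mem_set// => i _; exact: all_in.
      by rewrite indicE mem_set//; exact: all_in.
    move=> /existsNP[i ni]; rewrite (bigD1 i)//= indicE memNset// mul0r.
    rewrite indicE memNset// => /(_ i); apply: contra_not ni; apply.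
    by rewrite /= !inE mem_enum.
  rewrite indep => [|i _]; last first.
    by exists [set (e i)%:R%:E]; [exact: emeasurable_set1|rewrite setTI].
  by rewrite prod_fset_ord; apply: eq_bigr => i _; rewrite /mean ltn_ord.
pose j := (n - k.+1)%N.
have jn : (j < n)%N by rewrite /j ltn_subrL (leq_trans _ kn).
have jS : (n - k = j.+1)%N by rewrite /j -subSn.
pose o := Ordinal jn.
(* The value of the newly expanded factor is the summation index. *)
pose upd l : 'I_n -> nat := fun i => if i == o then l else e i.
have fE i l w : i != o -> factor j.+1 (upd l) i w = factor j e i w.
  move=> io; rewrite /factor ltnS leq_eqVlt /upd (negbTE io).
  by rewrite (_ : (_ == j) = false)//; apply/negbTE; rewrite -val_eqE in io.
have mE i l : i != o -> mean j.+1 (upd l) i = mean j e i.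
  move=> io; rewrite /mean ltnS leq_eqVlt /upd (negbTE io).
  by rewrite (_ : (_ == j) = false)//; apply/negbTE; rewrite -val_eqE in io.
rewrite -/j.
transitivity (\sum_(l <oo) (r o ^+ l)%:E * \int[P]_w \prod_(i < n) factor j.+1 (upd l) i w).
  transitivity (\int[P]_w \sum_(l <oo) (r o ^+ l)%:E * \prod_(i < n) factor j.+1 (upd l) i w).
    apply: eq_integral => w _; rewrite (bigD1 o)//= {1}/factor /= ltnn /power_count.
    rewrite muleC -ge0_nneseriesZl; last 2 first.
    - exact: prode_ge0.
    - by move=> l; rewrite mule_ge0// lee_fin ?exprn_ge0.
    apply: eq_eseriesr => l _; rewrite [in RHS](bigD1 o)//= [factor j.+1 _ o w]/factor /= ltnSn /upd eqxx.
    rewrite muleCA; congr (_ * _); rewrite muleC; congr (_ * _).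
    by apply: eq_bigr => i io; rewrite -(fE i l).
  rewrite integral_nneseries//.
  - apply: eq_eseriesr => l _; rewrite ge0_integralZl_EFin ?exprn_ge0//.
    + by move=> w _; exact: prode_ge0.
    + by apply: emeasurable_prod => i; exact: mfactor.
  - move=> l; apply: emeasurable_funM => //; apply: emeasurable_prod => i.
    exact: mfactor.
  - by move=> l w _; rewrite mule_ge0 ?lee_fin ?exprn_ge0//; exact: prode_ge0.
rewrite [RHS](bigD1 o)//= [mean j e o]/mean /= ltnn /C muleC -ge0_nneseriesZl; last 2 first.
- exact: prode_ge0.
- by move=> l; rewrite mule_ge0// lee_fin exprn_ge0.
apply: eq_eseriesr => l _; rewrite -jS IH ?(ltnW kn)// jS (bigD1 o)//= [mean j.+1 _ o]/mean /= ltnSn /upd eqxx.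
rewrite muleA [in RHS]muleC; congr (_ * _).
by apply: eq_bigr => i io; rewrite (mE i l).
Qed.

Lemma integral_prod_power_count :
  \int[P]_w \prod_(i < n) power_count (r i) (N i w) =
  \prod_(i < n) \sum_(k <oo) (r i ^+ k)%:E * P [set w | N i w = k%:R%:E].
Proof.
have := expand (leqnn n) (fun=> 0%N); rewrite subnn => e.
transitivity (\int[P]_w \prod_(i < n) factor 0 (fun=> 0%N) i w).
  by apply: eq_integral => w _; apply: eq_bigr => i _; rewrite /factor ltn0.
by rewrite e; apply: eq_bigr => i _; rewrite /mean ltn0.
Qed.

End independent_counts.

(** * The generating functional of a Poisson process *)

Section simple_levels.
Context d (T : measurableType d) (R : realType).
Import HBNNSimple.
Variable h : {nnsfun T >-> R}.

Definition levels : seq R := [seq y <- fset_set (range h) | y != 0%R].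

Lemma levels_uniq : uniq levels.
Proof. by rewrite filter_uniq// fset_uniq. Qed.

Lemma mem_levels x : h x != 0%R -> h x \in levels.
Proof.
move=> hx; rewrite mem_filter hx in_fset_set; last exact: fimfunP.
by apply/mem_set; exists x.
Qed.

Lemma levels_ge0 y : y \in levels -> (0 <= y)%R.
Proof.
by rewrite mem_filter in_fset_set; [move=> /andP[_ /set_mem[x _ <-]]|exact: fimfunP].
Qed.

Lemma levels_neq0 y : y \in levels -> y != 0%R.
Proof. by rewrite mem_filter => /andP[]. Qed.

Lemma sum_levels x : h x = (\sum_(k < size levels) levels`_k * (h x == levels`_k)%:R)%R.
Proof.
rewrite -(big_mkord xpredT (fun k => levels`_k * (h x == levels`_k)%:R)%R).
rewrite -(big_nth 0%R xpredT (fun y => y * (h x == y)%:R)%R).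
have [hx|hx] := eqVneq (h x) 0%R.
  rewrite big_seq big1 => [|y /levels_neq0 y0]; first by rewrite hx.
  by rewrite hx eq_sym (negbTE y0) mulr0.
rewrite (bigD1_seq (h x)) ?levels_uniq ?mem_levels//= eqxx mulr1 big1 ?addr0// => y yh.
by rewrite eq_sym (negbTE yh) mulr0.
Qed.

Lemma prod_levels x :
  (1 - h x = \prod_(k < size levels) (1 - levels`_k) ^+ (h x == levels`_k))%R.
Proof.
rewrite -(big_mkord xpredT (fun k => (1 - levels`_k) ^+ (h x == levels`_k))%R).
rewrite -(big_nth 0%R xpredT (fun y => (1 - y) ^+ (h x == y))%R).
have [hx|hx] := eqVneq (h x) 0%R.
  rewrite big_seq big1 => [|y /levels_neq0 y0]; first by rewrite hx subr0.
  by rewrite hx eq_sym (negbTE y0) expr0.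
rewrite (bigD1_seq (h x)) ?levels_uniq ?mem_levels//= eqxx expr1 big1 ?mulr1// => y yh.
by rewrite eq_sym (negbTE yh) expr0.
Qed.

End simple_levels.

Section poisson_functional.
Context d (Omega : measurableType d) (R : realType) (P : probability Omega R).
Context dT (T : measurableType dT) (mu : {sigma_finite_measure set T -> \bar R}).
Variable p : nat -> Omega -> T.
Hypotheses (mp : forall i, measurable_fun setT (p i))
  (poisson : poisson_process P mu p).

Local Notation count := (@point_count _ Omega R _ T p).

Lemma power_countE (a : R) (k : nat) : (0 <= a)%R ->
  power_count a k%:R%:E = (a ^+ k)%:E.
Proof.
move=> a0; rewrite /power_count (@nneseriesD1 _ _ k)//; last first.
  by move=> i _; rewrite mule_ge0// lee_fin ?exprn_ge0.
rewrite indicE mem_set// mule1 eseries0 ?adde0// => i _ ik.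
by rewrite indicE memNset ?mule0//= => -[/eqP]; rewrite eqr_nat eq_sym (negbTE ik).
Qed.

Lemma measurable_power_count (a : R) : (0 <= a)%R ->
  measurable_fun setT (power_count a : \bar R -> \bar R).
Proof.
move=> a0; apply: ge0_emeasurable_sum => k *; first by rewrite mule_ge0// lee_fin ?exprn_ge0.
apply: emeasurable_funM => //; apply/measurable_EFinP; apply: measurable_indic.
exact: emeasurable_set1.
Qed.

Lemma measurable_point_count (A : set T) : measurable A ->
  measurable_fun setT (count A).
Proof.
move=> mA; apply: ge0_emeasurable_sum => i *; first by [].
rewrite (_ : (fun w => _) = (fun w => (\1_A (p i w) : R)%:E)).
  by apply/measurable_EFinP; apply: measurableT_comp (mp i).
by apply/funext => w; rewrite diracE indicE.
Qed.

Let count_fin (A : set T) : measurable A -> mu A < +oo ->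
  {ae P, forall w, exists k : nat, count A w = k%:R%:E}.
Proof.
move=> mA Afin; have [pmf _ _] := poisson.
pose U := \bigcup_(k : nat) [set w | count A w = k%:R%:E ].
have mlevel k : measurable [set w | count A w = k%:R%:E ].
  have := measurable_point_count mA measurableT (emeasurable_set1 k%:R%:E).
  by rewrite setTI.
have mU : measurable U by exact: bigcupT_measurable.
have PU : P U = 1.
  rewrite measure_bigcup//; last first.
    move=> i j _ _ [w [/= ->]] /eqP; rewrite eqe eqr_nat => /eqP//.
  have := @poisson_generating_function R (fine (mu A)) 1%R (fine_ge0 (measure_ge0 _ _)) ler01.
  rewrite subrr mul0r oppr0 expR0 => <-.
  under [RHS]eq_eseriesr do rewrite expr1n mul1e -pmf//.
  by apply: eq_eseriesl => k; rewrite in_setT.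
exists (~` U); split; [exact: measurableC|by rewrite probability_setC// PU subee|].
by move=> w /= nw [k _ kw]; apply: nw; exists k.
Qed.

Let partial_count (A : set T) w (M : nat) : nat := \sum_(i < M) (p i w \in A).

Let partial_count_eventually (A : set T) w (k : nat) :
  count A w = k%:R%:E ->
  \forall M \near \oo, partial_count A w M = k.
Proof.
move=> Nk.
have partialE M : \sum_(0 <= i < M) (\d_(p i w) A : \bar R) = (partial_count A w M)%:R%:E.
  rewrite /partial_count big_mkord natr_sum -sumEFin; apply: eq_bigr => i _.
  by rewrite diracE.
have le_k M : (partial_count A w M <= k)%N.
  rewrite -(ler_nat R) -lee_fin -partialE -Nk /point_count.
  by apply: nneseries_lim_ge => i _ _.
have nd M M' : (M <= M')%N -> (partial_count A w M <= partial_count A w M')%N.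
  move=> MM'; rewrite -(ler_nat R) -lee_fin -!partialE.
  by apply: lee_sum_nneg_natr => // i _ _.
have [M0 M0k] : exists M0, (k <= partial_count A w M0)%N.
  apply: contrapT => /forallNP small.
  have small' M : (partial_count A w M < k)%N by rewrite ltnNge; apply/negP; exact: small.
  have k0 : (0 < k)%N by exact: leq_ltn_trans (small' 0%N).
  have : (k%:R%:E : \bar R) <= k.-1%:R%:E.
    rewrite -Nk /point_count; apply: lime_le; first by apply: is_cvg_nneseries.
    apply: nearW => M; rewrite partialE lee_fin ler_nat.
    by rewrite -ltnS prednK.
  by rewrite lee_fin ler_nat -ltnS prednK// ltnn.
exists M0 => // M /= M0M; apply/eqP; rewrite eqn_leq le_k/=.
exact: leq_trans M0k (nd _ _ M0M).
Qed.

(** The probability that all of the first [M] points are deleted, when a point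
    at [z] is deleted with probability [1 - g z]. *)
Definition thinned (g : T -> R) (M : nat) : \bar R :=
  \int[P]_w (\prod_(i < M) (1 - g (p i w)))%:E.

Let mprod (g : T -> R) M : measurable_fun setT g ->
  measurable_fun setT (fun w => \prod_(i < M) (1 - g (p i w)))%R.
Proof.
move=> mg; apply: measurable_prod => i _; apply: measurable_funB => //.
exact: measurableT_comp mg (mp i).
Qed.

Let prod01 (g : T -> R) M w : (forall x, 0 <= g x <= 1)%R ->
  (0 <= \prod_(i < M) (1 - g (p i w)) <= 1)%R.
Proof.
move=> g01; have h i : (0 <= 1 - g (p i w) <= 1)%R by have := g01 (p i w); lra.
by rewrite prodr_ge0 ?prodr_ile1// => i _; case/andP: (h i).
Qed.

Section simple.
Import HBNNSimple.

(** On a level set of a simple function the points are counted by independent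
    Poisson variables. *)
Lemma thinned_simple (h : {nnsfun T >-> R}) (K : set T) :
  (forall x, 0 <= h x <= 1)%R -> measurable K -> mu K < +oo ->
  (forall x, h x != 0%R -> K x) ->
  thinned h M @[M --> \oo] --> expeR (- \int[mu]_x (h x)%:E).
Proof.
move=> h01 mK Kfin hK.
pose s := levels h; pose n := size s.
pose A (k : 'I_n) := h @^-1` [set s`_k].
have mA k : measurable (A k).
  by rewrite -[X in measurable X]setTI; exact: (measurable_funP h).
have sk (k : 'I_n) : s`_k \in s by rewrite mem_nth.
have tA : trivIset setT A.
  move=> i j _ _ [x [/= hi hj]]; apply/val_inj/eqP.
  by rewrite -(nth_uniq 0%R (ltn_ord i) (ltn_ord j) (levels_uniq h)) -hi -hj.
have Afin k : mu (A k) < +oo.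
  apply: le_lt_trans Kfin; apply: le_measure; rewrite ?inE// => x /= hx.
  by apply: hK; rewrite hx (levels_neq0 (sk k)).
pose r (k : 'I_n) : R := (1 - s`_k)%R.
have s1 (k : 'I_n) : (0 <= s`_k <= 1)%R.
  rewrite (levels_ge0 (sk k))/=; have := sk k; rewrite mem_filter => /andP[_].
  by rewrite in_fset_set; [move=> /set_mem[x _ <-]; case/andP: (h01 x)|exact: fimfunP].
have r0 k : (0 <= r k)%R by rewrite subr_ge0; case/andP: (s1 k).
have [pmf _ indep] := poisson.
have means : \prod_(k < n) \sum_(l <oo) (r k ^+ l)%:E *
    P [set w | count (A k) w = l%:R%:E] = expeR (- \int[mu]_x (h x)%:E).
  transitivity (\prod_(k < n) (expR (- (s`_k * fine (mu (A k)))))%:E).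
    apply: eq_bigr => k _.
    have <- : (1 - r k = s`_k)%R by rewrite /r; ring.
    rewrite -poisson_generating_function ?fine_ge0//.
    by apply: eq_eseriesr => l _; rewrite pmf.
  rewrite prodEFin -expR_sum.
  have -> : \int[mu]_x (h x)%:E = (\sum_(k < n) s`_k * fine (mu (A k)))%:E.
    transitivity (\int[mu]_x \sum_(k < n) (s`_k * \1_(A k) x)%:E).
      apply: eq_integral => x _; rewrite sumEFin; congr EFin; rewrite {1}(sum_levels h x).
      apply: eq_bigr => k _; rewrite indicE; congr (_ * _%:R)%R; congr nat_of_bool.
      by apply/eqP/idP => [/mem_set|/set_mem].
    rewrite ge0_integral_sum//.
    - rewrite -sumEFin; apply: eq_bigr => k _.
      under eq_integral do rewrite EFinM.
      rewrite ge0_integralZl_EFin ?integral_indic ?setIT//.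
      + by rewrite EFinM fineK// ge0_fin_numE.
      + by apply/measurable_EFinP; exact: measurable_indic.
      + by case/andP: (s1 k).
    - by move=> k; apply/measurable_EFinP; apply: measurable_funM => //; exact: measurable_indic.
    - by move=> k x _; rewrite lee_fin mulr_ge0//; case/andP: (s1 k).
  by rewrite -EFinN /= sumrN.
have mcount k : measurable_fun setT (count (A k)).
  exact: measurable_point_count.
have indepA := indep n A mA tA.
rewrite -means -(integral_prod_power_count mcount r0 indepA).
pose f w := \prod_(k < n) power_count (r k) (count (A k) w).
have inA k x : (x \in A k) = (h x == s`_k).
  by apply/idP/eqP => [/set_mem|/mem_set].
have [] // := @dominated_convergence _ _ _ P setT measurableT
  (fun M w => (\prod_(i < M) (1 - h (p i w)))%:E) f (cst 1).
- by move=> M; apply/measurable_EFinP; exact: mprod.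
- apply: emeasurable_prod => k; apply: measurableT_comp (mcount k).
  exact: measurable_power_count.
- have /filter_forall : forall k, {ae P, forall w, exists e : nat, count (A k) w = e%:R%:E}.
    by move=> k; exact: count_fin.
  apply: filterS => w /(_ _)/cid-/all_sig[e Ne] _.
  have -> : f w = (\prod_(k < n) r k ^+ e k)%:E.
    by rewrite -prodEFin; apply: eq_bigr => k _; rewrite Ne power_countE.
  apply: cvg_near_cst.
  have /filter_forall : forall k, \forall M \near \oo, partial_count (A k) w M = e k.
    by move=> k; exact: partial_count_eventually.
  apply: filterS => M Me; congr EFin.
  under eq_bigr do rewrite prod_levels.
  rewrite exchange_big/=; apply: eq_bigr => k _.
  by rewrite prodrXr -Me; congr (_ ^+ _)%R; apply: eq_bigr => i _; rewrite inA.
- exact: finite_measure_integrable_cst.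
- apply: aeW => w M _ /=; have /andP[a b] := prod01 M w h01.
  by rewrite lee_fin ger0_norm.
Qed.


(** The generating functional of a Poisson process. Simple functions [h k] that
    increase to [g] and vanish off sets of finite measure bound it from above by
    antitonicity; it is bounded from below by dominated convergence for a fixed
    number [M] of points. *)
Lemma thinned_cvg (g : T -> R) : measurable_fun setT g ->
  (forall x, 0 <= g x <= 1)%R ->
  thinned g M @[M --> \oo] --> expeR (- \int[mu]_x (g x)%:E).
Proof.
move=> mg g01.
have mgE : measurable_fun setT (EFin \o g) by exact/measurable_EFinP.
have /sigma_finiteP[K [TK ndK Kfin]] := sigma_finiteT mu.
pose h k : {nnsfun T >-> R} :=
  proj_nnsfun (nnsfun_approx measurableT mgE k) (Kfin k).1.
have hE k x : h k x = (nnsfun_approx measurableT mgE k x * \1_(K k) x)%R.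
  by rewrite /h /=.
have g0 x : setT x -> 0 <= (EFin \o g) x by move=> _; rewrite lee_fin; case/andP: (g01 x).
have approx_le k x : (nnsfun_approx measurableT mgE k x <= g x)%R.
  by rewrite -lee_fin nnsfun_approxE; exact: le_approx.
have h_nd x : nondecreasing_seq (h ^~ x).
  move=> k l kl; rewrite !hE ler_pM//; first exact/lefP/nd_nnsfun_approx.
  rewrite !indicE ler_nat; case: (boolP (x \in K k)) => // /set_mem Kx.
  by rewrite mem_set//; move: x Kx; exact/subsetPset/ndK.
have h_le k x : (h k x <= g x)%R.
  by rewrite hE (le_trans _ (approx_le k x))// ler_piMr.
have h_cvg x : h k x @[k --> \oo] --> g x.
  have := @cvg_nnsfun_approx _ _ _ _ measurableT _ mgE g0 x Logic.I.
  move=> /fine_cvg /=; apply: cvg_trans; apply: near_eq_cvg.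
  have [m _ Kx] : (\bigcup_k K k) x by rewrite -TK.
  exists m => // k /= mk; rewrite -[RHS]/(h k x) hE indicE mem_set ?mulr1//.
  by move: x Kx; exact/subsetPset/ndK.
have h01 k x : (0 <= h k x <= 1)%R.
  by rewrite fun_ge0 (le_trans (h_le k x))//; case/andP: (g01 x).
have simple_cvg k := thinned_simple (h01 k) (Kfin k).1 (Kfin k).2.
have hK k x : h k x != 0%R -> K k x.
  rewrite hE indicE; case: (boolP (x \in K k)) => [/set_mem//|_].
  by rewrite mulr0 eqxx.
have thinned_anti (g1 g2 : T -> R) M : measurable_fun setT g1 -> measurable_fun setT g2 ->
    (forall x, 0 <= g1 x)%R -> (forall x, g1 x <= g2 x <= 1)%R ->
    thinned g2 M <= thinned g1 M.
  move=> mg1 mg2 g10 g12; apply: ge0_le_integral_any => w; rewrite lee_fin.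
    by apply: prodr_ge0 => i _; have := g12 (p i w); lra.
  by apply: ler_prod => i _; have := g12 (p i w); lra.
have thinned_nincr (g1 : T -> R) M N : measurable_fun setT g1 -> (forall x, 0 <= g1 x <= 1)%R ->
    (M <= N)%N -> thinned g1 N <= thinned g1 M.
  move=> mg1 g101 MN; apply: ge0_le_integral_any => w; rewrite lee_fin.
    by case/andP: (prod01 N w g101).
  rewrite -(subnKC MN) big_split_ord/= ler_piMr//; first by case/andP: (prod01 M w g101).
  rewrite prodr_ile1// => i _; have := g101 (p (M + i)%N w); lra.
have int_cvg : \int[mu]_x (h k x)%:E @[k --> \oo] --> \int[mu]_x (g x)%:E.
  have -> : \int[mu]_x (g x)%:E = \int[mu]_x lim ((h k x)%:E @[k --> \oo]).
    apply: eq_integral => x _; apply/esym/cvg_lim => //; apply: cvg_EFin; first exact: nearW.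
    exact: h_cvg.
  apply: cvg_monotone_convergence => //.
  - by move=> k; apply/measurable_EFinP.
  - by move=> k x _; rewrite lee_fin.
  - by move=> x _ k l kl; rewrite lee_fin; exact: h_nd.
have lower M : expeR (- \int[mu]_x (g x)%:E) <= thinned g M.
  have cvgM : thinned (h k) M @[k --> \oo] --> thinned g M.
    have [] // := @dominated_convergence _ _ _ P setT measurableT
      (fun k w => (\prod_(i < M) (1 - h k (p i w)))%:E)
      (fun w => (\prod_(i < M) (1 - g (p i w)))%:E) (cst 1).
    - by move=> k; apply/measurable_EFinP; exact: mprod.
    - by apply/measurable_EFinP; exact: mprod.
    - apply: aeW => w _; apply: cvg_EFin; first exact: nearW.
      elim: M => [|M IH].
        by under eq_fun do rewrite big_ord0; rewrite big_ord0; exact: cvg_cst.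
      under eq_fun do rewrite big_ord_recr; rewrite big_ord_recr/=.
      by apply: cvgM => //; apply: cvgB; [exact: cvg_cst|exact: h_cvg].
    - exact: finite_measure_integrable_cst.
    - apply: aeW => w k _ /=; have /andP[a b] := prod01 M w (h01 k).
      by rewrite lee_fin ger0_norm.
  rewrite -(cvg_lim _ cvgM)//; apply: lime_ge; first exact: cvgP cvgM.
  apply: nearW => k; apply: (@le_trans _ _ (expeR (- \int[mu]_x (h k x)%:E))).
    rewrite lee_expeR leeN2; apply: ge0_le_integral_any => x; first by rewrite lee_fin.
    by rewrite lee_fin.
  have := simple_cvg k (hK k) => cvgk.
  rewrite -(cvg_lim _ cvgk)//; apply: lime_le; first exact: cvgP cvgk.
  by exists M => // N /= MN; apply: thinned_nincr => // x; exact: h01.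
have nd_thinned : nonincreasing_seq (thinned g).
  by move=> M N MN; apply: thinned_nincr.
have := ereal_nonincreasing_cvgn nd_thinned; set l := ereal_inf _ => cvgl.
suff <- : l = expeR (- \int[mu]_x (g x)%:E) by [].
apply/eqP; rewrite eq_le; apply/andP; split; last first.
  by apply: le_ereal_inf_tmp => _ [M _ <-]; exact: lower.
have l_le k : l <= expeR (- \int[mu]_x (h k x)%:E).
  have := simple_cvg k (hK k) => cvgk.
  rewrite -(cvg_lim _ cvgk)//; apply: lime_ge; first exact: cvgP cvgk.
  apply: nearW => M; apply: (@le_trans _ _ (thinned g M)).
    by apply: ereal_inf_lbound; exists M.
  apply: thinned_anti => // x.
  by rewrite h_le; case/andP: (g01 x).
have [y ly] : exists y, expeR y = l.
  apply: expeR_total; apply: le_ereal_inf_tmp => _ [M _ <-].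
  by apply: integral_ge0 => w _; rewrite lee_fin; case/andP: (prod01 M w g01).
rewrite -ly lee_expeR leeNr -(cvg_lim _ int_cvg)//.
apply: lime_le; first exact: cvgP int_cvg.
by apply: nearW => k; rewrite leeNr -lee_expeR ly.
Qed.


End simple.
End poisson_functional.

(** * Void probabilities of a marked Poisson process *)

Section independent_sigma_algebras.
Context d (Omega : measurableType d) (R : realType) (P : probability Omega R).
Variables (G1 G2 : set (set Omega)).
Hypotheses (G1m : <<s G1 >> `<=` measurable) (G2m : <<s G2 >> `<=` measurable)
  (indep : independent P <<s G1 >> <<s G2 >>).

(** Events that involve two independent sigma-algebras may be computed with two
    independent copies of the sample point. *)
Lemma independent_copies
    (D : set (g_sigma_algebraType G1 * g_sigma_algebraType G2)) :
  measurable D -> P [set w | D (w, w)] = (P \x P) (D : set (Omega * Omega)).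
Proof.
move=> mD.
have mid1 : measurable_fun setT (id : Omega -> g_sigma_algebraType G1).
  by move=> _ B mB; rewrite setTI; exact: G1m.
have mid2 : measurable_fun setT (id : Omega -> g_sigma_algebraType G2).
  by move=> _ B mB; rewrite setTI; exact: G2m.
have mdiag : measurable_fun setT (fun w : Omega =>
    ((w, w) : g_sigma_algebraType G1 * g_sigma_algebraType G2)).
  by apply: measurable_fun_pair.
have mprod : measurable_fun setT (fun z : Omega * Omega =>
    ((z.1, z.2) : g_sigma_algebraType G1 * g_sigma_algebraType G2)).
  apply: measurable_fun_pair.
    exact: measurableT_comp mid1 measurable_fst.
  exact: measurableT_comp mid2 measurable_snd.
pose m1 := image_measure P mdiag.
pose m2 := image_measure (P \x P) mprod.
have -> : (P \x P) (D : set (Omega * Omega)) = m2 D.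
  by rewrite /m2 /= /pushforward; congr ((P \x P) _); apply/seteqP; split=> -[].
pose G := [set A `*` B | A in @measurable _ (g_sigma_algebraType G1) &
  B in @measurable _ (g_sigma_algebraType G2)].
apply: (@measure_unique _ R (g_sigma_algebraType G1 * g_sigma_algebraType G2)%type
  G (fun=> setT) _ _ _ _ m1 m2) => //.
- exact: measurable_prod_measurableType.
- move=> _ _ [A1 mA1 [B1 mB1 <-]] [A2 mA2 [B2 mB2 <-]].
  exists (A1 `&` A2); first exact: measurableI.
  by exists (B1 `&` B2); [exact: measurableI|rewrite setXI].
- by move=> _; exists setT => //; exists setT => //; rewrite setXTT.
- by apply/seteqP; split=> // z _; exists 0%N.
- move=> _ [A mA [B mB <-]].
  transitivity (P A * P B); first exact: indep.
  rewrite -product_measure1E; [|exact: G1m|exact: G2m].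
  by rewrite /m2 /= /pushforward; congr ((P \x P) _); apply/seteqP; split=> -[].
- by move=> _; rewrite /m1 /= /pushforward preimage_setT probability_setT ltry.
Qed.

End independent_sigma_algebras.

Section marked_poisson_process.
Context d (Omega : measurableType d) (R : realType) (P : probability Omega R).
Context dT (T : measurableType dT) (mu : {sigma_finite_measure set T -> \bar R}).
Context dM (M : measurableType dM) (Q : probability M R).
Variables (p : nat -> Omega -> T) (S : nat -> Omega -> M).
Hypotheses (mp : forall i, measurable_fun setT (p i))
  (mS : forall i, measurable_fun setT (S i))
  (poisson : poisson_process P mu p)
  (S_law : forall i B, measurable B -> P (S i @^-1` B) = Q B)
  (S_indep : mutually_independent P (fun i => sigma_generated (S i)))
  (pS_indep : independent P (sigma_generated_seq p) (sigma_generated_seq S)).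

Let sub_measurable dX (X : measurableType dX) (Y : nat -> Omega -> X) :
  (forall i, measurable_fun setT (Y i)) -> sigma_generated_seq Y `<=` measurable.
Proof.
move=> mY; apply: smallest_sub; first exact: sigma_algebra_measurable.
by move=> _ [i _ [B mB <-]]; exact: mY.
Qed.

Let measurable_coordinate dX (X : measurableType dX) (Y : nat -> Omega -> X) i :
  measurable_fun setT
    (Y i : g_sigma_algebraType (\bigcup_i sigma_generated (Y i)) -> X).
Proof.
move=> _ B mB; apply: sub_sigma_algebra; exists i => //.
by exists B.
Qed.

Variable A : set (T * M).
Hypothesis mA : measurable A.

Let g (t : T) : R := fine (Q (xsection A t)).

Let gE t : Q (xsection A t) = (g t)%:E.
Proof. by rewrite /g fineK// fin_num_measure//; exact: measurable_xsection. Qed.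

Let g01 t : (0 <= g t <= 1)%R.
Proof.
rewrite fine_ge0//= -lee_fin -gE probability_le1//.
exact: measurable_xsection.
Qed.

Let mg : measurable_fun setT g.
Proof.
apply: measurableT_comp => //.
exact: measurable_fun_xsection.
Qed.

(** The points and their marks are taken from two independent copies of the
    sample point, the first of which is then held fixed. *)
Let marked_void_finite n :
  P (\bigcap_(i in `I_n) [set w | ~ A (p i w, S i w)]) = thinned P p g n.
Proof.
pose D := [set z : Omega * Omega | forall i, (i < n)%N -> ~ A (p i z.1, S i z.2)].
pose O1 := g_sigma_algebraType (\bigcup_i sigma_generated (p i)).
pose O2 := g_sigma_algebraType (\bigcup_i sigma_generated (S i)).
have mD : measurable (D : set (O1 * O2)).
  have -> : D = \bigcap_(i in `I_n) ((fun z : O1 * O2 => (p i z.1, S i z.2)) @^-1` (~` A)).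
    by apply/seteqP; split=> z zD i /= iN; exact: zD.
  apply: bigcap_measurableType => i _; rewrite -[X in measurable X]setTI.
  have mz : measurable_fun setT (fun z : O1 * O2 => (p i z.1, S i z.2)).
    have mpi : measurable_fun setT (p i : O1 -> T) by exact: measurable_coordinate.
    have mSi : measurable_fun setT (S i : O2 -> M) by exact: measurable_coordinate.
    apply: measurable_fun_pair.
      exact: measurableT_comp mpi measurable_fst.
    exact: measurableT_comp mSi measurable_snd.
  by apply: mz => //; exact: measurableC.
have -> : \bigcap_(i in `I_n) [set w | ~ A (p i w, S i w)] = [set w | D (w, w)].
  by apply/seteqP; split=> w /= wD i iN; exact: wD.
rewrite (independent_copies (sub_measurable mp) (sub_measurable mS) pS_indep mD).
rewrite /product_measure1 /thinned; apply: eq_integral => w _ /=.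
have -> : xsection (D : set (Omega * Omega)) w =
    \bigcap_(i in [set` [fset i in iota 0 n]%fset]) (S i @^-1` (~` xsection A (p i w))).
  apply/seteqP; split=> w2.
    move=> /xsectionP wD i; rewrite /= !inE mem_iota add0n => /= iN.
    by move=> /xsectionP; exact: wD.
  move=> wD; apply/xsectionP => i iN /= Ai; apply: (wD i).
    by rewrite /= !inE mem_iota add0n.
  exact/xsectionP.
rewrite S_indep => [|i _]; last first.
  by exists (~` xsection A (p i w)); [apply: measurableC; exact: measurable_xsection|rewrite setTI].
rewrite prod_fset_iota -prodEFin; apply: eq_bigr => i _.
have mAi : measurable (xsection A (p i w)) by exact: measurable_xsection.
by rewrite S_law ?probability_setC ?gE//; exact: measurableC.
Qed.

(** Given the points, the marks are independent with law [Q], so a point at [t]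
    avoids [A] with probability [1 - Q (xsection A t)]; the void probability is a
    value of the generating functional of the points. *)
Theorem marked_void :
  P [set w | forall i, ~ A (p i w, S i w)] = expeR (- (mu \x Q) A).
Proof.
pose F n := \bigcap_(i in `I_n) [set w | ~ A (p i w, S i w)].
have mF n : measurable (F n).
  apply: bigcap_measurableType => i _; rewrite -[X in measurable X]setTI.
  have mz : measurable_fun setT (fun w => (p i w, S i w)) by exact: measurable_fun_pair.
  by apply: (mz measurableT (~` A)); exact: measurableC.
have FE : \bigcap_n F n = [set w | forall i, ~ A (p i w, S i w)].
  apply/seteqP; split=> w wF; last by move=> n _ i _; exact: wF.
  by move=> i; apply: (wF i.+1 Logic.I i) => /=.
have ndF : nonincreasing_seq F.
  by move=> m n mn; apply/subsetPset => w wF i /= im; apply: wF; exact: leq_trans im mn.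
have F0fin : P (F 0%N) < +oo by apply: (le_lt_trans (probability_le1 P (mF 0%N))); rewrite ltry.
have := nonincreasing_cvg_mu F0fin mF (bigcap_measurableType (fun n _ => mF n)) ndF.
rewrite FE => cvgF.
have := thinned_cvg mp poisson mg g01.
have <- : P \o F = thinned P p g by apply/funext => n; exact: marked_void_finite.
move=> /(cvg_unique _ cvgF) ->//; congr (expeR (- _)).
by apply: eq_integral => t _; rewrite /= gE.
Qed.

End marked_poisson_process.

(** * Measurability in the space of compact sets *)

Section rational_balls.
Context {R : realType}.
Implicit Types (U : set (R * R)) (z : R * R).

Let code (n : nat) : rat * rat * rat := odflt (0, 0, 0)%R (choice.unpickle n).

Definition ball_center (n : nat) : R * R := (ratr (code n).1.1, ratr (code n).1.2).
Definition ball_radius (n : nat) : R := ratr (code n).2.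
Definition rational_ball (n : nat) : set (R * R) := ball (ball_center n) (ball_radius n).

Lemma open_rational_ball n : open (rational_ball n).
Proof.
have [r0|r0] := leP (ball_radius n) 0%R; last exact: (@ball_open R (R * R)%type).
rewrite (_ : rational_ball n = set0); first exact: open0.
apply/seteqP; split=> // z [/=]; rewrite /ball/= => /(le_lt_trans (normr_ge0 _)).
by rewrite ltNge r0.
Qed.

Lemma measurable_rational_ball n : measurable (rational_ball n).
Proof.
rewrite (_ : rational_ball n =
  ball (ball_center n).1 (ball_radius n) `*` ball (ball_center n).2 (ball_radius n)).
  by apply: measurableX; exact: measurable_ball.
by apply/seteqP; split=> -[].
Qed.

Lemma rational_ball_nbhs z U : nbhs z U ->
  exists2 n, rational_ball n z & rational_ball n `<=` U.
Proof.
move=> /nbhs_ballP[e /= e0 zU].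
have e4 : (0 < e / 4)%R by rewrite divr_gt0.
have near_rat (x : R) : exists q : rat, (`|ratr q - x| < e / 4)%R.
  have [q] : exists q, ratr q \in `](x - e / 4)%R, (x + e / 4)%R[.
    by apply: rat_in_itvoo; lra.
  rewrite in_itv/= => /andP[xq qx]; exists q.
  by rewrite ltr_norml; apply/andP; split; lra.
have [a az] := near_rat z.1; have [b bz] := near_rat z.2.
have [r] : exists q, (ratr q : R) \in `](e / 4)%R, (e / 2)%R[.
  by apply: rat_in_itvoo; lra.
rewrite in_itv/= => /andP[er re].
have codeE : code (choice.pickle (a, b, r)) = (a, b, r) by rewrite /code choice.pickleK.
exists (choice.pickle (a, b, r)).
  by rewrite /rational_ball /ball_center /ball_radius codeE; split => /=;
    rewrite /ball/=; [exact: lt_trans az er|exact: lt_trans bz er].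
move=> y; rewrite /rational_ball /ball_center /ball_radius codeE => -[/= ay byy].
move: ay byy; rewrite /ball/= => ay byy.
apply: zU; split; rewrite /ball/=.
  by rewrite -(subrKA (ratr a)) (le_lt_trans (ler_normD _ _))// distrC; lra.
by rewrite -(subrKA (ratr b)) (le_lt_trans (ler_normD _ _))// distrC; lra.
Qed.

Lemma open_bigcup_rational_ball U : open U ->
  U = \bigcup_(n in [set n | rational_ball n `<=` U]) rational_ball n.
Proof.
move=> oU; apply/seteqP; split=> [z Uz|z [n nU nz]]; last exact: nU.
have [n nz nU] := rational_ball_nbhs (open_nbhs_nbhs (conj oU Uz)).
by exists n.
Qed.

Lemma open_measurable_plane U : open U -> measurable U.
Proof.
move=> oU; rewrite (open_bigcup_rational_ball oU).
by apply: bigcup_measurable => n _; exact: measurable_rational_ball.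
Qed.

Lemma closed_measurable_plane U : closed U -> measurable U.
Proof.
move=> cU; rewrite -[U]setCK; apply: measurableC; apply: open_measurable_plane.
exact: closed_openC.
Qed.

Lemma rational_ball_center_mem n z : rational_ball n z -> rational_ball n (ball_center n).
Proof.
move=> [nz _]; apply: (@ballxx R (R * R)%type); move: nz; rewrite /ball/=.
exact: le_lt_trans.
Qed.

(** Addition is continuous, as witnessed by rational balls. *)
Lemma rational_ball_add z y (G : set (R * R)) : open G -> G (z + y)%R ->
  exists n m, [/\ rational_ball n z, rational_ball m y &
    forall a b, rational_ball n a -> rational_ball m b -> G (a + b)%R].
Proof.
move=> oG Gzy; have [e /= e0 eG] := (nbhs_ballP _ _).1 (open_nbhs_nbhs (conj oG Gzy)).
have e2 : (0 < e / 2)%R by rewrite divr_gt0.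
have [n nz nU] := rational_ball_nbhs (nbhsx_ballx z (e / 2)%R e2).
have [m my mU] := rational_ball_nbhs (nbhsx_ballx y (e / 2)%R e2).
exists n, m; split => // a b /nU[/= a1 a2] /mU[/= b1 b2]; apply: eG.
move: a1 a2 b1 b2; rewrite /ball/= => a1 a2 b1 b2; split; rewrite /ball/=.
  by rewrite opprD addrACA [e]splitr (le_lt_trans (ler_normD _ _))// ltrD.
by rewrite opprD addrACA [e]splitr (le_lt_trans (ler_normD _ _))// ltrD.
Qed.

End rational_balls.

Section grain_measurability.
Context {R : realType}.
Implicit Types (F : grain R) (G : set (R * R)).

Lemma closed_grain F : closed (F : set (R * R)).
Proof.
apply: compact_closed; last exact: grain_compact.
exact: (@norm_hausdorff R (R * R)%type).
Qed.

Lemma fell_subbase_measurable (A : set (grain R)) : fell_subbase A -> measurable A.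
Proof.
move=> fA; apply: sub_sigma_algebra.
exists [set A] => [_ ->|]; first exact: finI_from1.
by rewrite bigcup_set1.
Qed.

Lemma measurable_hit G : open G ->
  measurable [set F : grain R | (F : set (R * R)) `&` G !=set0].
Proof. by move=> oG; apply: fell_subbase_measurable; left; exists G. Qed.

Lemma measurable_mem_grain : measurable [set z : grain R * (R * R) | (z.1 : set (R * R)) z.2].
Proof.
rewrite -[X in measurable X]setCK; apply: measurableC.
rewrite (_ : ~` _ = \bigcup_n (~` [set F : grain R | (F : set (R * R)) `&` rational_ball n !=set0]
    `*` rational_ball n)).
  apply: bigcupT_measurable => n; apply: measurableX; last exact: measurable_rational_ball.
  by apply: measurableC; apply: measurable_hit; exact: open_rational_ball.
apply/seteqP; split=> -[F y] /=.
  move=> nFy.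
  have [n ny nF] := rational_ball_nbhs (open_nbhs_nbhs (conj (closed_openC (@closed_grain F)) nFy)).
  by exists n => //; split => //= -[x [Fx /nF]].
by move=> [n _ [/= nF ny]] Fy; apply: nF; exists y.
Qed.

Lemma measurable_mem_grain_point (y : R * R) : measurable [set F : grain R | (F : set (R * R)) y].
Proof.
have := measurable_ysection y measurable_mem_grain; congr measurable.
by apply/seteqP; split=> F; [move=> /ysectionP|move=> Fy; apply/ysectionP].
Qed.

(** Since grains are closed, a ball lies in a grain as soon as its rational
    points do. *)
Lemma measurable_ball_subset n : measurable [set F : grain R | rational_ball n `<=` F].
Proof.
rewrite (_ : [set F : grain R | _] = \bigcap_(k in [set k | @rational_ball R n (ball_center k)])
    [set F : grain R | (F : set (R * R)) (ball_center k)]).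
  by apply: bigcap_measurableType => k _; exact: measurable_mem_grain_point.
apply/seteqP; split=> F /= nF; first by move=> k /= nk; exact: nF.
move=> y ny; apply: contrapT => nFy.
have oD : open (rational_ball n `&` ~` (F : set (R * R))).
  by apply: openI; [exact: open_rational_ball|exact: closed_openC (@closed_grain F)].
have [k ky kD] := rational_ball_nbhs (open_nbhs_nbhs (conj oD (conj ny nFy))).
have [nk nFk] := kD _ (rational_ball_center_mem ky).
by apply: nFk; exact: nF.
Qed.

Lemma mem_interiorP F y : (F : set (R * R))° y <->
  exists2 n, rational_ball n `<=` F & rational_ball n y.
Proof.
split=> [/rational_ball_nbhs[n ny nF]|[n nF ny]]; first by exists n.
by apply: filterS nF _; apply: open_nbhs_nbhs; split => //; exact: open_rational_ball.
Qed.

Lemma measurable_mem_interior :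
  measurable [set z : grain R * (R * R) | (z.1 : set (R * R))° z.2].
Proof.
rewrite (_ : [set z | _] = \bigcup_n ([set F : grain R | rational_ball n `<=` F]
    `*` rational_ball n)).
  apply: bigcupT_measurable => n; apply: measurableX; last exact: measurable_rational_ball.
  exact: measurable_ball_subset.
apply/seteqP; split=> -[F y] /=; first by move=> /mem_interiorP[n nF ny]; exists n.
by move=> [n _ [/= nF ny]]; apply/mem_interiorP; exists n.
Qed.

Lemma boundary_grainE F : boundary (F : set (R * R)) = F `\` (F : set (R * R))°.
Proof. by rewrite /boundary -(closure_id _).1//; exact: closed_grain. Qed.

Lemma measurable_mem_boundary :
  measurable [set z : grain R * (R * R) | boundary (z.1 : set (R * R)) z.2].
Proof.
rewrite (_ : [set z | _] = [set z : grain R * (R * R) | (z.1 : set (R * R)) z.2] `\`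
  [set z : grain R * (R * R) | (z.1 : set (R * R))° z.2]).
  by apply: measurableD; [exact: measurable_mem_grain|exact: measurable_mem_interior].
by apply/seteqP; split=> -[F y] /=; rewrite boundary_grainE.
Qed.

Lemma measurable_grain F : measurable (F : set (R * R)).
Proof. by apply: closed_measurable_plane; exact: closed_grain. Qed.

Lemma measurable_interior (A : set (R * R)) : measurable A°.
Proof. by apply: open_measurable_plane; exact: open_interior. Qed.

Lemma measurable_boundary F : measurable (boundary (F : set (R * R))).
Proof.
rewrite boundary_grainE; apply: measurableD; first exact: measurable_grain.
exact: measurable_interior.
Qed.

Lemma measurable_translated_hit G : open G ->
  measurable [set z : (R * R) * grain R | translate z.2 z.1 `&` G !=set0].
Proof.
move=> oG; pose good n m := forall a b, rational_ball n a -> rational_ball m b -> G (a + b)%R.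
rewrite (_ : [set z | _] = \bigcup_n \bigcup_(m in [set m | good n m])
   ((rational_ball m : set (R * R)) `*`
    [set F : grain R | (F : set (R * R)) `&` rational_ball n !=set0])).
  apply: bigcupT_measurable => n; apply: bigcup_measurable => m _.
  apply: measurableX; first exact: measurable_rational_ball.
  by apply: measurable_hit; exact: open_rational_ball.
apply/seteqP; split=> -[x F] /=.
  move=> [_ [[a Fa <-] Gax]].
  have [n [m [na mx nmG]]] := rational_ball_add oG Gax.
  by exists n => //; exists m => //; split => //; exists a.
move=> [n _ [m /= nmG [/= mx [a [Fa na]]]]].
by exists (a + x)%R; split; [exists a|exact: nmG].
Qed.

Lemma grain_nonempty_interior (Q : probability (grain R) R) :
  0 < Q [set F : grain R | (F : set (R * R))° !=set0] ->
  exists n, (0 < @ball_radius R n)%R /\ 0 < Q [set F : grain R | rational_ball n `<=` F].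
Proof.
move=> Qpos; apply: contrapT => /forallNP none.
have : Q [set F : grain R | (F : set (R * R))° !=set0] <= 0.
  pose V n := if (0 < @ball_radius R n)%R then [set F : grain R | rational_ball n `<=` F] else set0.
  have mV n : measurable (V n).
    by rewrite /V; case: ifP => // _; exact: measurable_ball_subset.
  rewrite (_ : [set F : grain R | _] = \bigcup_n V n).
    apply: le_trans (measure_sigma_subadditive Q mV (bigcupT_measurable _ mV) (@subset_refl _ _)) _.
    rewrite eseries0// => n _ _; rewrite /V; case: ifPn => n0; last by rewrite measure0.
    apply/eqP; rewrite eq_le measure_ge0 andbT leNgt; apply/negP => Qn.
    by apply: (none n).
  apply/seteqP; split=> F.
    move=> [y /mem_interiorP[n nF ny]]; exists n => //; rewrite /V ifT//.
    by have [+ _] := ny; rewrite /ball/=; exact: le_lt_trans.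
  move=> [n _]; rewrite /V; case: ifPn => // n0 nF.
  exists (ball_center n); apply/mem_interiorP; exists n => //.
  exact: (@ballxx R (R * R)%type).
by rewrite leNgt Qpos.
Qed.

End grain_measurability.

(** * The points of a Poisson process have distinct times *)

Section distinct_times.
Context d (Omega : measurableType d) (R : realType) (P : probability Omega R).
Context dT (T : measurableType dT) (mu : {sigma_finite_measure set T -> \bar R}).
Variables (p : nat -> Omega -> T) (tau : T -> R) (K : nat -> set T) (C : nat -> R).
Hypotheses (mp : forall i, measurable_fun setT (p i))
  (poisson : poisson_process P mu p)
  (mtau : measurable_fun setT tau) (mK : forall m, measurable (K m))
  (K_nd : nondecreasing_seq K) (K_cover : \bigcup_m K m = setT)
  (K_tau : forall m z, K m z -> (- m%:R <= tau z < m%:R)%R)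
  (K_fin : forall m a h, (0 < h)%R ->
     mu (K m `&` [set z | (a <= tau z < a + h)%R]) <= (C m * h)%:E).

Local Notation count := (@point_count _ Omega R _ T p).

Let poisson_prob_set1 (a : R) k : (0 <= a)%R ->
  poisson_prob a 0%N [set k] = (expR (- a) * exp_coeff a k)%:E.
Proof.
rewrite le_eqVlt => /predU1P[<-|a0]; last first.
  rewrite /poisson_prob a0 esum_set1; last by rewrite lee_fin poisson_pmf_ge0.
  by congr EFin; rewrite /poisson_pmf a0 /exp_coeff /=; ring.
rewrite /poisson_prob ltxx diracE oppr0 expR0 mul1r /exp_coeff /=.
case: k => [|k]; first by rewrite mem_set// expr0 fact0 divr1.
by rewrite memNset// expr0n mul0r.
Qed.

Let measurable_level (A : set T) k : measurable A ->
  measurable [set w | count A w = k%:R%:E].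
Proof.
move=> mA; have mc : measurable_fun setT (count A) by exact: measurable_point_count.
by have := mc measurableT _ (emeasurable_set1 k%:R%:E); rewrite setTI.
Qed.

(** A Poisson variable of mean [a] exceeds 1 with probability at most
    [1 - (1 - a) (1 + a) = a ^ 2]. *)
Let crowded_le (A : set T) : measurable A -> mu A < +oo ->
  P (~` ([set w | count A w = 0%:R%:E] `|` [set w | count A w = 1%:R%:E])) <=
  mu A * mu A.
Proof.
move=> mA Afin; have [pmf _ _] := poisson.
have afin : mu A \is a fin_num by rewrite ge0_fin_numE.
have a0 : (0 <= fine (mu A))%R by rewrite fine_ge0.
have mlevel k := measurable_level k mA.
rewrite probability_setC; last by apply: measurableU; exact: mlevel.
rewrite measureU; [|exact: mlevel|exact: mlevel|]; last first.
  by apply/seteqP; split=> // w [/= ->] /eqP; rewrite eqe eqr_nat.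
rewrite /= !pmf// !poisson_prob_set1//.
rewrite -[mu A]fineK//; set a := fine (mu A) in a0 *.
rewrite -[X in 1 - X]/(expR (- a) * exp_coeff a 0 + expR (- a) * exp_coeff a 1)%:E.
rewrite -EFinB -EFinM lee_fin.
rewrite /exp_coeff /= expr0 expr1 fact0 !divr1 mulr1.
have := expR_ge1Dx (- a) => /(ler_wpM2r (addr_ge0 ler01 a0)).
have -> : ((1 + - a) * (1 + a) = 1 - a * a)%R by ring.
by rewrite mulrDr mulr1; lra.
Qed.

Let Kslab (m n k : nat) : set T := cell tau m setT (K m) n k.

Let Kslab_le m n k : mu (Kslab m n k) <= (C m * (2 ^+ n)^-1)%:E.
Proof. exact: (cell_le m mtau measurableT (mK m) (@K_fin m) n k). Qed.

Let crowded m n k : set Omega :=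
  ~` ([set w | count (Kslab m n k) w = 0%:R%:E] `|` [set w | count (Kslab m n k) w = 1%:R%:E]).

Let mKslab m n k : measurable (Kslab m n k).
Proof. exact: measurable_cell. Qed.

Let measurable_crowded m n k : measurable (crowded m n k).
Proof. by apply: measurableC; apply: measurableU; exact: measurable_level. Qed.

Let tied i j m : set Omega :=
  [set w | [/\ K m (p i w), K m (p j w) & tau (p i w) = tau (p j w)]].

Let measurable_tied i j m : measurable (tied i j m).
Proof.
have mKp l : measurable [set w | K m (p l w)].
  by rewrite -[X in measurable X]setTI; exact: mp.
rewrite (_ : tied i j m = [set w | K m (p i w)] `&` ([set w | K m (p j w)] `&`
    [set w | (tau (p i w) - tau (p j w) = 0)%R])).
  apply: measurableI => //; apply: measurableI => //.
  have md : measurable_fun setT (fun w => (tau (p i w) - tau (p j w))%R).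
    by apply: measurable_funB; apply: measurableT_comp mtau (mp _).
  by have := md measurableT [set 0%R] (measurable_set1 _); rewrite setTI.
apply/seteqP; split=> w /=; first by move=> [? ? ->]; rewrite subrr.
by move=> [? [? /eqP]]; rewrite subr_eq0 => /eqP.
Qed.

(** Tied points share every cell that contains one of them. *)
Let tied_crowded i j m n : i != j ->
  tied i j m `<=` \big[setU/set0]_(k < slices m n) crowded m n k.
Proof.
move=> ij w [Ki Kj tij].
have : (setT `&` K m) (p i w) by split.
rewrite -(cell_cover setT (@K_tau m) n) -!bigcup_mkord => -[k /= kn cik].
exists k => // ck.
have cjk : Kslab m n k (p j w).
  by move: cik => [_ [_ /= tk]]; split => //; split => //=; rewrite -tij.
have : (2%:R%:E : \bar R) <= count (Kslab m n k) w.
  pose M := (maxn i j).+1.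
  apply: le_trans (nneseries_lim_ge M _) => [|l _]; last by [].
  rewrite big_mkord (bigD1 (Ordinal (leq_maxl i j : (i < M)%N)))//=.
  rewrite (bigD1 (Ordinal (leq_maxr i j : (j < M)%N)))/=; last by rewrite -val_eqE/= eq_sym.
  rewrite !diracE !mem_set// addeA leeDl//.
  exact: sume_ge0.
by case: ck => /= ->; rewrite lee_fin ler_nat.
Qed.

(** The measures of the cells of a box add up to a constant while the largest of
    them tends to 0, hence so does the sum of their squares, which bounds the
    probability that some cell contains two points. *)
Lemma distinct_times : {ae P, forall w, injective (fun i => tau (p i w))}.
Proof.
have null i j m : i != j -> P (tied i j m) = 0.
  move=> ij; apply/eqP; rewrite eq_le measure_ge0 andbT.
  have [M0 M0E] : exists M0 : R, M0%:E = mu (K m).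
    exists (fine (mu (K m))); rewrite fineK// ge0_fin_numE//.
    exact: (box_fin (@K_tau m) (@K_fin m)).
  have bound n : P (tied i j m) <= (C m * (2 ^+ n)^-1 * M0)%:E.
    apply: (@le_trans _ _ (\sum_(k < slices m n) mu (Kslab m n k) * mu (Kslab m n k))).
      apply: (@le_trans _ _ (P (\big[setU/set0]_(k < slices m n) crowded m n k))).
        apply: le_measure; rewrite ?inE//; last exact: tied_crowded.
        exact: bigsetU_measurable.
      apply: (@le_trans _ _ (\sum_(k < slices m n) P (crowded m n k))).
        apply: (@Boole_inequality _ _ _ P (crowded m n)) => k _.
        exact: measurable_crowded.
      apply: lee_sum => k _; apply: crowded_le => //.
      by rewrite (le_lt_trans (Kslab_le _ _ _))// ltry.
    apply: (@le_trans _ _ (\sum_(k < slices m n) (C m * (2 ^+ n)^-1)%:E * mu (Kslab m n k))).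
      by apply: lee_sum => k _; rewrite lee_wpmul2r.
    rewrite -ge0_sume_distrr; last by move=> k _.
    rewrite -measure_semi_additive_ord//.
    - rewrite (cell_cover setT (@K_tau m) n) setTI.
      by rewrite [X in _ * X <= _](_ : _ = M0%:E) -?EFinM.
    - by move=> k l _ _ kl; apply/val_inj; exact: (@cell_disjoint _ _ R tau m setT (K m) n).
    - exact: bigsetU_measurable.
  have cvg0 : (C m * (2 ^+ n)^-1 * M0)%:E @[n --> \oo] --> 0%:E.
    apply: cvg_EFin; first exact: nearW.
    rewrite -[X in _ --> X](mul0r M0); apply: cvgMl.
    rewrite -[X in _ --> X](mulr0 (C m)); apply: cvgMr.
    under eq_fun do rewrite -exprVn.
    apply: cvg_expr; rewrite ger0_norm ?invr_ge0// invf_lt1//.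
    by rewrite ltr1n.
  rewrite -[leRHS]/(0%:E) -(cvg_lim _ cvg0)//; apply: lime_ge; first exact: cvgP cvg0.
  exact: nearW.
have : {ae P, forall w (i j m : nat), i != j -> ~ tied i j m w}.
  apply/ae_foralln => i; apply/ae_foralln => j; apply/ae_foralln => m.
  have [->|ij] := eqVneq i j; first exact: aeW.
  exists (tied i j m); split; [exact: measurable_tied|exact: null|].
  by move=> w /= /not_implyP[_ /contrapT].
apply: filterS => w none i j tij; apply/eqP; apply: contrapT => /negP ij.
have [m _ Ki] : (\bigcup_m K m) (p i w) by rewrite K_cover.
have [n _ Kj] : (\bigcup_m K m) (p j w) by rewrite K_cover.
apply: (none i j (maxn m n) ij); split => //.
  by move: (p i w) Ki; exact/subsetPset/K_nd/leq_maxl.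
by move: (p j w) Kj; exact/subsetPset/K_nd/leq_maxr.
Qed.

End distinct_times.

(** * Leaves *)

(** A leaf is stored as ((place, time), grain), the order in which the points of
    the Poisson process carry their marks. *)
Notation leaf R := ((R * R * R) * grain R)%type.

Section leaves.
Context {R : realType}.
Implicit Types (p q : leaf R) (Z : set (leaf R)) (s : nat -> leaf R) (A : set (R * R)).

Definition leaf_place p : R * R := p.1.1.
Definition leaf_time p : R := p.1.2.
Definition leaf_interior p : set (R * R) := translate ((p.2 : set (R * R))°) (leaf_place p).
Definition leaf_boundary p : set (R * R) :=
  translate (boundary (p.2 : set (R * R))) (leaf_place p).

Definition visible_boundary s : set (R * R) :=
  \bigcup_(i in [set i | (0 <= leaf_time (s i))%R])
    (leaf_boundary (s i) `\`
     \bigcup_(j in [set j | (0 <= leaf_time (s j) < leaf_time (s i))%R])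
       leaf_interior (s j)).

Definition exposed Z (y : R * R) (a : R) :=
  forall q, Z q -> (0 <= leaf_time q < a)%R -> ~ leaf_interior q y.

Lemma leaf_interiorE p y : leaf_interior p y <-> (p.2 : set (R * R))° (y - leaf_place p)%R.
Proof. by rewrite /leaf_interior translateE. Qed.

Lemma leaf_boundaryE p y : leaf_boundary p y <-> boundary (p.2 : set (R * R)) (y - leaf_place p)%R.
Proof. by rewrite /leaf_boundary translateE. Qed.

Lemma measurable_leaf_place : measurable_fun setT leaf_place.
Proof. exact: measurableT_comp measurable_fst measurable_fst. Qed.

Lemma measurable_leaf_time : measurable_fun setT leaf_time.
Proof. exact: measurableT_comp measurable_snd measurable_fst. Qed.

Let rational (n : nat) : R := ratr (odflt (0%R : rat) (choice.unpickle n)).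

Let early_covering (r m l : nat) : set (leaf R) :=
  ([set x | rational_ball m (- x)%R] `*` `[0%R, rational r[%classic) `*`
  [set F : grain R | rational_ball l `<=` F].

Let measurable_early_covering r m l : measurable (early_covering r m l).
Proof.
apply: measurableX; last exact: measurable_ball_subset.
apply: measurableX; last exact: measurable_itv.
have mN : measurable_fun setT (fun x : R * R => (- x)%R : (R * R)%type).
  apply/measurable_fun_pairP; split.
    exact: (@measurableT_comp _ _ _ _ _ _ (-%R : R -> R) _ (fst : R * R -> R)).
  exact: (@measurableT_comp _ _ _ _ _ _ (-%R : R -> R) _ (snd : R * R -> R)).
have := mN measurableT _ (measurable_rational_ball m).
by rewrite setTI.
Qed.

Let separated (n m l : nat) := forall a b : R * R,
  rational_ball n a -> rational_ball m b -> rational_ball l (a + b)%R.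

(** That a leaf covers a point before time [a] is witnessed by rational data: a
    time between the arrival of the leaf and [a], and balls around the point,
    around the opposite of the place, and inside the grain. *)
Lemma not_exposedE Z y a : ~ exposed Z y a <->
  exists r n m l, [/\ (rational r <= a)%R, rational_ball n y, separated n m l &
    ~ missing (early_covering r m l) Z].
Proof.
split=> [/existsNP[q /not_implyP[Zq /not_implyP[/andP[q0 qa] /contrapT]]]|].
  move=> /leaf_interiorE /mem_interiorP[l lq yl].
  have [n [m [ny mq nml]]] := rational_ball_add (@open_rational_ball R l) yl.
  have [r] := rat_in_itvoo qa; rewrite in_itv/= => /andP[qr ra].
  exists (choice.pickle r), n, m, l; rewrite /rational choice.pickleK/= (ltW ra); split => //.
  move=> miss; have : (Z `&` early_covering (choice.pickle r) m l) q.
    by split => //; split => //; split => //=; rewrite in_itv/= q0 /rational choice.pickleK.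
  by rewrite miss.
move=> [r [n [m [l [ra ny nml hit]]]]] exp; apply: hit.
apply/seteqP; split=> // q [Zq [[/= mq qr] lq]].
move: qr; rewrite /= in_itv/= => /andP[q0 qr].
apply: (exp q Zq); first by rewrite q0 (lt_le_trans qr).
by apply/leaf_interiorE/mem_interiorP; exists l => //; exact: nml.
Qed.

Lemma measurable_exposed : measurable
  [set z : configuration (leaf R) * (R * R * R) | exposed z.1 z.2.1 z.2.2].
Proof.
rewrite -[X in measurable X]setCK; apply: measurableC.
rewrite (_ : ~` _ = \bigcup_r \bigcup_n \bigcup_m \bigcup_(l in [set l | separated n m l])
  ((~` missing (early_covering r m l) : set (configuration (leaf R))) `*`
   (rational_ball n `*` `[rational r, +oo[%classic))).
  do 3!apply: bigcupT_measurable => ?; apply: bigcup_measurable => l _.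
  apply: measurableX.
    by apply: measurableC; apply: measurable_missing; exact: measurable_early_covering.
  by apply: measurableX; [exact: measurable_rational_ball|exact: measurable_itv].
apply/seteqP; split=> -[Z [y a]] /=.
  move=> /not_exposedE[r [n [m [l [ra ny nml hit]]]]].
  by exists r => //; exists n => //; exists m => //; exists l => //; split => //; split => //=;
    rewrite in_itv/= ra.
move=> [r _ [n _ [m _ [l /= nml [/= hit [/= ny]]]]]]; rewrite in_itv/= andbT => ra.
by apply/not_exposedE; exists r, n, m, l.
Qed.

Definition box (m : nat) : set (R * R * R) :=
  (`[(- m%:R)%R, m%:R[%classic `*` `[(- m%:R)%R, m%:R[%classic) `*` `[(- m%:R)%R, m%:R[%classic.

Definition leaf_box (m : nat) : set (leaf R) := box m `*` setT.

Lemma measurable_box m : measurable (box m).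
Proof. by apply: measurableX; [apply: measurableX|]; exact: measurable_itv. Qed.

Lemma measurable_leaf_box m : measurable (leaf_box m).
Proof. by apply: measurableX => //; exact: measurable_box. Qed.

Let natr_truncn (a : R) : exists m : nat, (- m%:R <= a < m%:R)%R.
Proof.
exists (Num.truncn `|a|).+1; have := truncnS_gt `|a|%R; rewrite ltr_norml.
by move=> /andP[/ltW -> ->].
Qed.

Let box_itv (a : R) m n : (m <= n)%N -> `[(- m%:R)%R, m%:R[%classic a -> `[(- n%:R)%R, n%:R[%classic a.
Proof.
rewrite -(ler_nat R) /= !in_itv/= => mn /andP[ma am]; apply/andP; split; lra.
Qed.

Lemma box_nd : nondecreasing_seq box.
Proof.
move=> m n mn; apply/subsetPset => z [[z1 z2] z3].
by split; [split|]; apply: (box_itv mn).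
Qed.

Lemma box_cover : \bigcup_m box m = setT.
Proof.
apply/seteqP; split=> // -[[a b] c] _.
have [i ia] := natr_truncn a; have [j jb] := natr_truncn b; have [k kc] := natr_truncn c.
have itvP (u : R) l n : (l <= n)%N -> (- l%:R <= u < l%:R)%R -> `[(- n%:R)%R, n%:R[%classic u.
  by move=> ln lu; apply: (box_itv ln); rewrite /= in_itv.
exists (maxn i (maxn j k)) => //; split; [split|] => /=.
- by apply: itvP ia; exact: leq_maxl.
- by apply: itvP jb; rewrite leq_max leq_max leqnn orbT.
- by apply: itvP kc; rewrite leq_max leq_max leqnn !orbT.
Qed.

Lemma box_time m z : box m z -> (- m%:R <= z.2 < m%:R)%R.
Proof. by move=> [_ /=]; rewrite in_itv. Qed.

Lemma leaf_box_nd : nondecreasing_seq leaf_box.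
Proof.
move=> m n mn; apply/subsetPset => p [/= mp _]; split => //=.
by move: p.1 mp; exact/subsetPset/box_nd.
Qed.

Lemma leaf_box_cover : \bigcup_m leaf_box m = setT.
Proof. by rewrite -setX_bigcupl box_cover setXTT. Qed.

Lemma leaf_box_time m p : leaf_box m p -> (- m%:R <= leaf_time p < m%:R)%R.
Proof. by move=> [/box_time]. Qed.

Lemma volume_box_slab m (a h : R) : (0 < h)%R ->
  volume (box m `&` [set z | (a <= z.2 < a + h)%R]) <= ((m%:R + m%:R) ^+ 2 * h)%:E.
Proof.
move=> h0.
have ms : measurable ((`[(- m%:R)%R, m%:R[%classic `*` `[(- m%:R)%R, m%:R[%classic) `*`
    `[a, (a + h)%R[%classic : set (R * R * R)).
  by apply: measurableX; [apply: measurableX|]; exact: measurable_itv.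
apply: (@le_trans _ _ (volume ((`[(- m%:R)%R, m%:R[%classic `*` `[(- m%:R)%R, m%:R[%classic) `*`
    `[a, (a + h)%R[%classic : set (R * R * R)))).
  apply: le_measure; rewrite ?inE//; last first.
    by move=> z [[z1 z3]] /= z2; split => //=; rewrite in_itv.
  apply: measurableI; first exact: measurable_box.
  by apply: measurable_slab; exact: measurable_snd.
rewrite volumeX; [|by apply: measurableX; exact: measurable_itv|exact: measurable_itv].
rewrite areaX; [|exact: measurable_itv|exact: measurable_itv].
have len (b c : R) : (b <= c)%R -> length `[b, c[%classic = (c - b)%:E.
  rewrite /length lebesgue_measure_itv/= lte_fin le_eqVlt => /predU1P[->|bc].
    by rewrite ltxx subrr.
  by rewrite bc.
rewrite !len; [|lra|]; last by have := ler0n R m; lra.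
by rewrite opprK -!EFinM lee_fin addrAC subrr add0r expr2.
Qed.

End leaves.

Section leaf_intensity.
Context {R : realType} (Q : probability (grain R) R).

Definition leaf_intensity : set (leaf R) -> \bar R := @volume R \x Q.

HB.instance Definition _ := isMeasure.Build _ (leaf R) R leaf_intensity
  (measure0 (@volume R \x Q)) (measure_ge0 (@volume R \x Q))
  (@measure_semi_sigma_additive _ _ _ (@volume R \x Q)).
HB.instance Definition _ := Measure_isSigmaFinite.Build _ (leaf R) R leaf_intensity
  (sigma_finite_product (@volume R) Q).

Lemma leaf_intensityX (A : set (R * R * R)) (B : set (grain R)) :
  measurable A -> measurable B -> leaf_intensity (A `*` B) = volume A * Q B.
Proof. exact: product_measure1E. Qed.

Lemma leaf_box_slab m (a h : R) : (0 < h)%R ->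
  leaf_intensity (leaf_box m `&` [set p | (a <= leaf_time p < a + h)%R]) <=
  ((m%:R + m%:R) ^+ 2 * h)%:E.
Proof.
move=> h0; apply: le_trans (volume_box_slab m a h0).
rewrite (_ : _ `&` _ = (box m `&` [set z | (a <= z.2 < a + h)%R]) `*` setT).
  rewrite leaf_intensityX//; last first.
    apply: measurableI; first exact: measurable_box.
    by apply: measurable_slab; exact: measurable_snd.
  by rewrite probability_setT mule1.
by apply/seteqP; split=> p /=; [move=> [[]]|move=> [[]]].
Qed.

End leaf_intensity.

(** * The visible boundary as a union over the leaves *)

Section plane_boxes.
Context {R : realType}.

Definition plane_box (m : nat) : set (R * R) :=
  `[(- m%:R)%R, m%:R[%classic `*` `[(- m%:R)%R, m%:R[%classic.

Lemma measurable_plane_box m : measurable (plane_box m).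
Proof. by apply: measurableX; exact: measurable_itv. Qed.

Lemma plane_box_nd : nondecreasing_seq plane_box.
Proof.
move=> m n; rewrite -(ler_nat R) => mn; apply/subsetPset => z.
by rewrite /plane_box /= !in_itv/= => -[/andP[a b] /andP[c e]]; split; apply/andP; split; lra.
Qed.

Lemma plane_box_cover : \bigcup_m plane_box m = setT.
Proof.
apply/seteqP; split=> // z _.
have : (\bigcup_m @box R m) (z, 0%R) by rewrite box_cover.
by move=> [m _ [zm _]]; exists m.
Qed.

Lemma plane_box_bounded m : bounded_set (plane_box m).
Proof.
exists m%:R; split; first exact: num_real.
move=> r mr z [/=]; rewrite !in_itv/= => /andP[a b] /andP[c e].
by rewrite prod_normE/= ge_max !ler_norml; apply/andP; split; apply/andP; split; lra.
Qed.

Lemma measurable_evaluation (X : grain R -> lfmeasure R) (A : set (R * R)) :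
  measurable_fun setT X -> measurable A -> measurable_fun setT (fun F => X F A).
Proof.
move=> mX mA _ B mB; rewrite setTI.
have mE : measurable [set mu : lfmeasure R | B (mu A)].
  by apply: sub_sigma_algebra; exists A => //; exists B => //; rewrite setTI.
by have := @mX measurableT _ mE; rewrite setTI.
Qed.

End plane_boxes.

Section visible_part.
Context {R : realType} (X : grain R -> lfmeasure R).
Hypothesis mX : measurable_fun setT X.
Implicit Types (p q : leaf R) (s : nat -> leaf R) (A B : set (R * R)).
Local Notation H := (@hausdorff1 R).

(** Translated back by the place of the leaf, in order to be measured by the
    boundary length of the grain itself. *)
Definition exposed_part A (z : leaf R * configuration (leaf R)) : set (R * R) :=
  [set y | [/\ (0 <= leaf_time z.1)%R, A (y + leaf_place z.1)%R &
    exposed z.2 (y + leaf_place z.1)%R (leaf_time z.1)]].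

(** When [X] is the boundary length of grains: the length of boundary that a
    leaf contributes to [A]. *)
Definition exposed_length A (z : leaf R * configuration (leaf R)) : \bar R :=
  X z.1.2 (exposed_part A z).

Let mark (z : leaf R * configuration (leaf R)) : {measure set (R * R) -> \bar R} := X z.1.2.

Let measurable_mark A : measurable A -> measurable_fun setT (mark ^~ A).
Proof.
move=> mA; apply: (measurableT_comp (measurable_evaluation mX mA)).
exact: measurableT_comp measurable_snd measurable_fst.
Qed.

HB.instance Definition _ := isKernel.Build _ _ (leaf R * configuration (leaf R))%type
  (R * R)%type R mark measurable_mark.

Lemma measurable_exposed_length A : measurable A ->
  measurable_fun setT (exposed_length A).
Proof.
move=> mA.
pose Y := (leaf R * configuration (leaf R))%type.
pose D : set (Y * (R * R)) := [set u | exposed_part A u.1 u.2].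
have mloc : measurable_fun setT (fun u : Y * (R * R) => (u.2 + leaf_place u.1.1)%R : (R * R)%type).
  have mpl : measurable_fun setT (fun u : Y * (R * R) => leaf_place u.1.1).
    apply: (measurableT_comp measurable_leaf_place).
    exact: measurableT_comp measurable_fst measurable_fst.
  apply/measurable_fun_pairP; split; apply: measurable_funD.
  - exact: measurableT_comp measurable_fst measurable_snd.
  - exact: measurableT_comp measurable_fst mpl.
  - exact: measurableT_comp measurable_snd measurable_snd.
  - exact: measurableT_comp measurable_snd mpl.
have mtime : measurable_fun setT (fun u : Y * (R * R) => leaf_time u.1.1).
  apply: (measurableT_comp measurable_leaf_time).
  exact: measurableT_comp measurable_fst measurable_fst.
have mD : measurable D.
  rewrite (_ : D = (fun u : Y * (R * R) => leaf_time u.1.1) @^-1` `[0%R, +oo[%classic `&`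
    ((fun u : Y * (R * R) => (u.2 + leaf_place u.1.1)%R : (R * R)%type) @^-1` A `&`
     (fun u : Y * (R * R) => (u.1.2, ((u.2 + leaf_place u.1.1)%R : (R * R)%type, leaf_time u.1.1)))
       @^-1` [set z : configuration (leaf R) * (R * R * R) | exposed z.1 z.2.1 z.2.2])).
    apply: measurableI.
      by rewrite -[X in measurable X]setTI; apply: mtime => //; exact: measurable_itv.
    apply: measurableI.
      by rewrite -[X in measurable X]setTI; apply: mloc.
    rewrite -[X in measurable X]setTI.
    have mz : measurable_fun setT (fun u : Y * (R * R) =>
        (u.1.2, ((u.2 + leaf_place u.1.1)%R : (R * R)%type, leaf_time u.1.1))).
      apply: measurable_fun_pair; last exact: measurable_fun_pair.
      exact: measurableT_comp measurable_snd measurable_fst.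
    by apply: mz => //; exact: measurable_exposed.
  apply/seteqP; split=> -[z y] /=; rewrite in_itv/= andbT.
    by move=> [].
  by move=> [? []].
have := @measurable_kernel_xsection _ _ Y (R * R)%type R mark _
  (@measurable_plane_box R) (@plane_box_nd R) (@plane_box_cover R) _ D mD.
rewrite (_ : (fun z => mark z (xsection D z)) = exposed_length A).
  by apply => z m; apply: lfmeasure_finite; [exact: measurable_plane_box|exact: plane_box_bounded].
apply/funext => z; rewrite /mark /exposed_length; congr (X _ _).
by apply/seteqP; split=> y; [move=> /xsectionP|move=> Dy; apply/xsectionP].
Qed.

Section one_sequence.
Variable s : nat -> leaf R.

Let visible_leaf i : set (R * R) := [set y | [/\ (0 <= leaf_time (s i))%R,
  leaf_boundary (s i) y & exposed (support s : set (leaf R)) y (leaf_time (s i))]].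

Lemma visible_boundaryE : visible_boundary s = \bigcup_i visible_leaf i.
Proof.
apply/seteqP; split=> y [i].
  move=> /= i0 [yi nj]; exists i => //; split => // _ [j _ <-] ji yj.
  by apply: nj; exists j.
by move=> _ [i0 yi ex]; exists i => //; split => // -[j /= ji]; apply: ex => //; exists j.
Qed.

Lemma measurable_leaf_boundary p : measurable (leaf_boundary p).
Proof.
rewrite (_ : leaf_boundary p = [set y | boundary (p.2 : set (R * R)) (y + - leaf_place p)%R]).
  have := @measurable_translation R (- leaf_place p)%R measurableT _ (measurable_boundary p.2).
  by rewrite setTI.
by apply/seteqP; split=> y /leaf_boundaryE.
Qed.

Let measurable_exposed_leaf (Z : configuration (leaf R)) (a : R) :
  measurable [set y | exposed (Z : set (leaf R)) y a].
Proof.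
have mi : measurable_fun setT (fun y : R * R => (Z, (y, a))).
  by apply: measurable_fun_pair => //; apply: measurable_fun_pair.
by have := mi measurableT _ measurable_exposed; rewrite setTI.
Qed.

Let measurable_visible_leaf i : measurable (visible_leaf i).
Proof.
have [i0|i0] := boolP (0 <= leaf_time (s i))%R; last first.
  rewrite (_ : visible_leaf i = set0)//; apply/seteqP; split=> // y [].
  by rewrite (negbTE i0).
rewrite (_ : visible_leaf i = leaf_boundary (s i) `&`
  [set y | exposed (support s : set (leaf R)) y (leaf_time (s i))]).
  by apply: measurableI; [exact: measurable_leaf_boundary|exact: measurable_exposed_leaf].
by apply/seteqP; split=> y; [move=> []|move=> []; split].
Qed.

Hypotheses (inj : injective (leaf_time \o s))
  (XE : forall i A, measurable A -> H (A `&` boundary ((s i).2 : set (R * R))) = X (s i).2 A)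
  (overlap : forall i j, (leaf_time (s j) < leaf_time (s i))%R ->
    X (s i).2 [set y | leaf_boundary (s j) (y + leaf_place (s i))%R] = 0).

Let measurable_translated A (v : R * R) : measurable A -> measurable [set y | A (y + v)%R].
Proof.
by move=> mA; have := @measurable_translation R v measurableT _ mA; rewrite setTI.
Qed.

Let leaf_length i A : measurable A ->
  H (leaf_boundary (s i) `&` A) = X (s i).2 [set y | A (y + leaf_place (s i))%R].
Proof.
move=> mA; rewrite -XE; last exact: measurable_translated.
rewrite -[RHS](hausdorff1_translate _ (leaf_place (s i))); congr H.
rewrite translateE; apply/seteqP; split=> y /=.
  by move=> [/leaf_boundaryE yi Ay]; rewrite subrK.
by rewrite subrK => -[Ay yi]; split => //; exact/leaf_boundaryE.
Qed.

Let overlap0 i j : i != j -> H (leaf_boundary (s i) `&` leaf_boundary (s j)) = 0.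
Proof.
wlog tij : i j / (leaf_time (s j) < leaf_time (s i))%R => [wl ij|ij].
  have : leaf_time (s i) != leaf_time (s j) by apply: contra ij => /eqP /inj ->.
  rewrite neq_lt => /orP[h|h]; last exact: wl.
  by rewrite setIC; apply: wl => //; rewrite eq_sym.
rewrite leaf_length; last exact: measurable_leaf_boundary.
exact: overlap.
Qed.

(** Distinct leaves share a negligible part of their boundaries, so the lengths
    of the visible parts add up. *)
Lemma hausdorff1_visible_boundary A : measurable A ->
  H (visible_boundary s `&` A) = \sum_(i <oo) exposed_length A (s i, support s).
Proof.
move=> mA; rewrite visible_boundaryE seqDU_bigcup_eq setIC.
rewrite hausdorff1_bigcup; last 2 first.
- by move=> n; apply: measurableD => //; exact: bigsetU_measurable.
- exact: trivIset_seqDU.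
apply: eq_eseriesr => i _; transitivity (H (A `&` visible_leaf i)).
  apply/eqP; rewrite eq_le; apply/andP; split.
    by apply: le_outer_measure => y [Ay [vy _]]; split.
  apply: (@le_trans _ _ (H (A `&` seqDU visible_leaf i) +
      H (\big[setU/set0]_(j < i) (leaf_boundary (s i) `&` leaf_boundary (s j))))).
    apply: le_trans (outer_measureU2 _ _ _); apply: le_outer_measure => y [Ay vy].
    have [older|none] := pselect ((\big[setU/set0]_(j < i) visible_leaf j) y); last by left.
    right; move: older; rewrite -bigcup_mkord => -[j ji [_ yj _]].
    rewrite -(bigcup_mkord _ (fun j => leaf_boundary (s i) `&` leaf_boundary (s j))).
    by exists j => //; split => //; case: vy.
  rewrite [X in _ + X](_ : _ = 0) ?adde0//.
  apply/eqP; rewrite eq_le outer_measure_ge0 andbT.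
  elim/big_ind : _ => [|U V HU HV|j _]; first by rewrite outer_measure0.
    by apply: le_trans (outer_measureU2 _ _ _) _; rewrite -[leRHS]adde0 leeD.
  by rewrite overlap0// gtn_eqF.
have mexp : measurable (A `&` [set y | (0 <= leaf_time (s i))%R /\
    exposed (support s : set (leaf R)) y (leaf_time (s i))]).
  apply: measurableI => //.
  have [i0|i0] := boolP (0 <= leaf_time (s i))%R; last first.
    by rewrite (_ : [set y | _] = set0)//; apply/seteqP; split=> // y [].
  rewrite (_ : [set y | _] = [set y | exposed (support s : set (leaf R)) y (leaf_time (s i))]).
    exact: measurable_exposed_leaf.
  by apply/seteqP; split=> y; [move=> []|].
transitivity (X (s i).2 [set y | (A `&` [set y | (0 <= leaf_time (s i))%R /\
    exposed (support s : set (leaf R)) y (leaf_time (s i))]) (y + leaf_place (s i))%R]).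
  rewrite -leaf_length//; congr H; apply/seteqP; split=> y.
    by move=> [Ay [i0 yi ex]]; split.
  by move=> [yi [Ay [i0 ex]]]; split.
by congr (X _ _); apply/seteqP; split=> y; [move=> [Ay [i0 ex]]|move=> [i0 Ay ex]; split].
Qed.

End one_sequence.
End visible_part.

(** * Local finiteness and shifts *)

Section local_finiteness.
Context {R : realType}.
Implicit Types (s : nat -> leaf R) (A : set (R * R)).
Local Notation H := (@hausdorff1 R).

Definition small_ball (r : R) (k : nat) :=
  rational_ball k (@ball_center R k) /\ rational_ball k `<=` ball (@ball_center R k) r.

Lemma small_ball_mem (r : R) (y : R * R) : (0 < r)%R ->
  exists2 k, small_ball r k & rational_ball k y.
Proof.
move=> r0; have r2 : (0 < r / 2)%R by rewrite divr_gt0.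
have [k ky kr] := rational_ball_nbhs (nbhsx_ballx y (r / 2)%R r2).
exists k => //; split; first exact: rational_ball_center_mem ky.
move=> z /kr yz; have /kr yc := rational_ball_center_mem ky.
by rewrite [r]splitr; apply: ball_triangle yz; exact: ball_sym.
Qed.

(** Near any place there is a leaf whose interior hides all later leaves, and
    only finitely many leaves arrive before it, so small balls meet finitely many
    visible pieces; a bounded set is covered by finitely many small balls. *)
Lemma visible_boundary_locally_finite s (r : R) A : (0 < r)%R ->
  (forall i, H (leaf_boundary (s i)) < +oo) ->
  (forall k (n : nat), small_ball r k -> exists M, forall i, (M <= i)%N ->
     ~ ((0 <= leaf_time (s i) < n%:R)%R /\
        translate ((s i).2 : set (R * R)) (leaf_place (s i)) `&` rational_ball k !=set0)) ->
  (forall k, small_ball r k -> exists i, (0 <= leaf_time (s i))%R /\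
     rational_ball k `<=` leaf_interior (s i)) ->
  bounded_set A -> H (visible_boundary s `&` A) < +oo.
Proof.
move=> r0 lenfin few covered [b [_ bA]].
have fin_small k : small_ball r k -> H (visible_boundary s `&` rational_ball k) < +oo.
  move=> ks; have [i [i0 ki]] := covered k ks.
  (* An integer beyond the arrival of the covering leaf. *)
  pose n := (Num.truncn (leaf_time (s i))).+1.
  have [M late] := few k n ks.
  apply: (@le_lt_trans _ _ (H (\big[setU/set0]_(j < M) leaf_boundary (s j)))); last first.
    elim/big_ind : _ => [|U V HU HV|j _]; last exact: lenfin.
      by rewrite outer_measure0.
    by apply: le_lt_trans (outer_measureU2 _ _ _) _; exact: lte_add_pinfty.
  apply: le_outer_measure => y [[j /= j0 [yj nj]] ky].
  rewrite -(bigcup_mkord M (fun j => leaf_boundary (s j))); exists j => //=.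
  rewrite ltnNge; apply/negP => /late; apply; split.
    rewrite j0 /= (le_lt_trans _ (truncnS_gt (leaf_time (s i))))//.
    rewrite leNgt; apply/negP => ij; apply: nj; exists i; first by rewrite /= i0.
    exact: ki.
  exists y; split => //; move/leaf_boundaryE : yj; rewrite boundary_grainE => -[yj _].
  by rewrite translateE.
pose C : set (R * R) := `[(- (b + 1))%R, (b + 1)%R]%classic `*` `[(- (b + 1))%R, (b + 1)%R]%classic.
have AC : A `<=` C.
  have b1 : (b < b + 1)%R by rewrite ltrDl.
  move=> y /(@bA _ b1) /=; rewrite prod_normE /= ge_max !ler_norml.
  by rewrite /C /= !in_itv/= => /andP[-> ->].
have cC : compact C by apply: compact_setX; exact: segment_compact.
have [N _ CN] : \forall n \near \oo, forall y, C y ->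
    exists k, [/\ (k < n)%N, small_ball r k & rational_ball k y].
  move/compact_near_coveringP : cC => near_C.
  apply: (near_C nat \oo (fun n y => exists k, [/\ (k < n)%N, small_ball r k & rational_ball k y])).
  move=> y _; have [k ks ky] := small_ball_mem y r0.
  exists (rational_ball k, [set n | (k < n)%N]) => [|[z n] /= [kz kn]]; last by exists k.
  split => /=; first by apply: open_nbhs_nbhs; split => //; exact: open_rational_ball.
  by exists k.+1.
pose V k := if `[< small_ball r k >] then visible_boundary s `&` rational_ball k else set0.
apply: (@le_lt_trans _ _ (H (\big[setU/set0]_(k < N) V k))).
  apply: le_outer_measure => y [vy /AC /(CN N (leqnn N))[k [kN ks ky]]].
  by rewrite -bigcup_mkord; exists k => //; rewrite /V asboolT.
elim/big_ind : _ => [|U W HU HW|k _]; first by rewrite outer_measure0.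
  by apply: le_lt_trans (outer_measureU2 _ _ _) _; exact: lte_add_pinfty.
rewrite /V; case: asboolP => [ks|_]; first exact: fin_small.
by rewrite outer_measure0.
Qed.

End local_finiteness.

Section shifted_leaves.
Context {R : realType}.
Implicit Types (p q : leaf R) (s : nat -> leaf R) (A : set (R * R)) (v : R * R).

Definition shift_leaf v p : leaf R := (((leaf_place p + v)%R, leaf_time p), p.2).

Lemma leaf_boundary_shift v p y :
  leaf_boundary (shift_leaf v p) y <-> leaf_boundary p (y - v)%R.
Proof. by rewrite !leaf_boundaryE /leaf_place /= opprD addrCA addrC -addrA. Qed.

Lemma leaf_interior_shift v p y :
  leaf_interior (shift_leaf v p) y <-> leaf_interior p (y - v)%R.
Proof. by rewrite !leaf_interiorE /leaf_place /= opprD addrCA addrC -addrA. Qed.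

Lemma visible_boundary_shift v s :
  visible_boundary (shift_leaf v \o s) = translate (visible_boundary s) v.
Proof.
rewrite translateE; apply/seteqP; split=> y [i /= i0 []].
  move=> /leaf_boundary_shift yi nj; exists i => //; split => // -[j ji yj].
  by apply: nj; exists j => //; exact/leaf_interior_shift.
move=> yi nj; exists i => //; split; first exact/leaf_boundary_shift.
by move=> -[j ji /leaf_interior_shift yj]; apply: nj; exists j.
Qed.

Lemma exposed_shift v s y a : exposed (support (shift_leaf v \o s) : set (leaf R)) y a <->
  exposed (support s : set (leaf R)) (y - v)%R a.
Proof.
split=> ex _ [i _ <-] ia yi.
  apply: (ex (shift_leaf v (s i))) => //; first by exists i.
  exact/leaf_interior_shift.
by apply: (ex (s i)); [exists i| |apply/leaf_interior_shift].
Qed.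

Lemma exposed_length_shift (X : grain R -> lfmeasure R) v p s A :
  exposed_length X A (shift_leaf v p, support (shift_leaf v \o s)) =
  exposed_length X [set y | A (y + v)%R] (p, support s).
Proof.
rewrite /exposed_length; congr (X _ _).
have placeE y : (y + leaf_place (shift_leaf v p) = y + leaf_place p + v)%R by rewrite addrA.
apply/seteqP; split=> y; rewrite /exposed_part /= placeE => -[p0 Ay ex]; split => //.
  by move/exposed_shift : ex; rewrite addrK.
by apply/exposed_shift; rewrite addrK.
Qed.

Section good_sequences.
Variable X : grain R -> lfmeasure R.
Hypothesis mX : measurable_fun setT X.
Local Notation H := (@hausdorff1 R).
Local Notation simple := (simple_sequence (@leaf_time R) (@leaf_box R)).
Local Notation points := (point_sequence (@leaf_time R) (@leaf_box R)).

(** The sequences of leaves along which the length of the visible boundary is a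
    locally finite measure and a measurable functional of the set of leaves. *)
Definition good_sequence s :=
  [/\ simple s,
      forall A, measurable A ->
        H (visible_boundary s `&` A) = \sum_(i <oo) exposed_length X A (s i, support s) &
      forall A, measurable A -> bounded_set A -> H (visible_boundary s `&` A) < +oo].

Definition visible_length s (good : good_sequence s) : lfmeasure R :=
  @LFMeasure R (hausdorff_restr (visible_boundary s)) (let: And3 _ _ fin := good in fin).

Lemma hausdorff1_visible_boundary_shift v s A :
  H (visible_boundary (shift_leaf v \o s) `&` A) =
  H (visible_boundary s `&` [set y | A (y + v)%R]).
Proof.
rewrite visible_boundary_shift -[RHS](hausdorff1_translate _ v); congr H.
by rewrite !translateE; apply/seteqP; split=> y /=; rewrite subrK.
Qed.

Let leaf_box_shift v m : exists n, leaf_box m `<=` shift_leaf v @^-1` leaf_box n.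
Proof.
have [n1 v1] : exists n : nat, (`|v.1| < n%:R)%R by exists (Num.truncn `|v.1|).+1; exact: truncnS_gt.
have [n2 v2] : exists n : nat, (`|v.2| < n%:R)%R by exists (Num.truncn `|v.2|).+1; exact: truncnS_gt.
exists (m + (n1 + n2))%N => -[[[a b] c] F] [[[]]] /=; rewrite !in_itv/=.
move: v1 v2; rewrite !ltr_norml => /andP[v1 v1'] /andP[v2 v2'].
move=> /andP[a1 a2] /andP[b1 b2] /andP[c1 c2] _.
have n10 := ler0n R n1; have n20 := ler0n R n2.
rewrite /shift_leaf /leaf_place /leaf_time /=.
by split => //; split; [split|]; rewrite /= !in_itv/= !natrD; apply/andP; split; lra.
Qed.

(** The property must be stable under shifts for the two laws to be compared. *)
Lemma good_sequence_shift v s : good_sequence s -> good_sequence (shift_leaf v \o s).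
Proof.
move=> [[inj fin] lenE lenfin].
have mv A : measurable A -> measurable [set y | A (y + v)%R].
  by move=> mA; have := @measurable_translation R v measurableT _ mA; rewrite setTI.
split.
- split => [|m]; first exact: inj.
  have [n mn] := leaf_box_shift (- v)%R m.
  apply: le_lt_trans (fin n); apply: lee_nneseries => [i _ _|i _]; first by rewrite lee_fin.
  rewrite lee_fin !indicE ler_nat; case: (boolP (_ \in leaf_box m)) => // /set_mem mi.
  rewrite mem_set//; have := mn _ mi; rewrite /= /shift_leaf /leaf_place /leaf_time /= addrK.
  by case: (s i) => [[[a b] c] F].
- move=> A mA; rewrite hausdorff1_visible_boundary_shift lenE; last exact: mv.
  by apply: eq_eseriesr => i _; rewrite /= -exposed_length_shift.
- move=> A mA bA; rewrite hausdorff1_visible_boundary_shift lenfin//; first exact: mv.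
  exact: bounded_translation.
Qed.

Lemma visible_length_shift v s (good : good_sequence s) A :
  shift_lfmeasure v (visible_length good) A =
  visible_length (good_sequence_shift v good) A.
Proof. by rewrite /= /hausdorff_restr hausdorff1_visible_boundary_shift. Qed.

(** Every event of the visible length is an event of the set of leaves: this
    holds for evaluations, which are sums over the leaves of a measurable
    functional, and is preserved by complements and countable unions. *)
Lemma visible_length_event (B : set (lfmeasure R)) : measurable B ->
  exists2 Gam : set points, measurable Gam &
    forall s (mu : lfmeasure R), good_sequence s ->
      (forall A, measurable A -> mu A = H (visible_boundary s `&` A)) -> B mu <-> Gam s.
Proof.
pose rep B := exists2 Gam : set points, measurable Gam &
    forall s (mu : lfmeasure R), good_sequence s ->
      (forall A, measurable A -> mu A = H (visible_boundary s `&` A)) -> B mu <-> Gam s.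
suff : <<s @lfmeasure_evaluations R >> `<=` rep by exact.
apply: smallest_sub => [|_ [A mA [C mC <-]]]; last first.
  pose count s : \bar R :=
    \int[@count_measure _ (leaf R) R (@leaf_time R) (@leaf_box R) s]_p exposed_length X A (p, support s).
  have mcount : measurable_fun setT (count : points -> \bar R).
    apply: (@measurable_count_integral _ _ R (@leaf_time R) (@leaf_box R)).
    - exact: measurable_leaf_time.
    - exact: measurable_leaf_box.
    - exact: leaf_box_nd.
    - exact: leaf_box_cover.
    - exact: leaf_box_time.
    - exact: measurable_exposed_length.
    - by [].
  exists (count @^-1` C); first by rewrite -[X in measurable X]setTI; exact: mcount.
  move=> s mu [simp lenE _] muE; rewrite setTI /= muE// lenE//.
  rewrite /count count_integralE//.
  have mp : measurable_fun setT (fun p : leaf R => (p, support s)) by exact: measurable_fun_pair.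
  exact: measurableT_comp (measurable_exposed_length mX mA) mp.
split.
- by exists set0 => // s mu _ _; split.
- move=> B' [Gam mG BG]; exists (~` Gam); first exact: measurableC.
  move=> s mu good muE; have := BG s mu good muE => BGs.
  by split=> [[_ nB] /BGs|nG]; [|split => // /BGs].
- move=> B' BG; have [G GP] : {G : nat -> set points & forall n, measurable (G n) /\
      forall s (mu : lfmeasure R), good_sequence s ->
      (forall A, measurable A -> mu A = H (visible_boundary s `&` A)) -> B' n mu <-> G n s}.
    apply: (choice (P := fun n (G : set points) => measurable G /\ forall s (mu : lfmeasure R), good_sequence s ->
      (forall A, measurable A -> mu A = H (visible_boundary s `&` A)) -> B' n mu <-> G s)) => n.
    by have [G mG GP] := BG n; exists G.
  exists (\bigcup_n G n); first by apply: bigcupT_measurable => n; have [] := GP n.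
  move=> s mu good muE; split=> -[n _ h]; exists n => //; have [_ P] := GP n.
    exact/(P s mu good muE).
  exact/(P s mu good muE).
Qed.

End good_sequences.
End shifted_leaves.

(** * The area of a typical grain *)

Lemma product_measure_ysection d1 d2 (T1 : measurableType d1) (T2 : measurableType d2)
    (R : realType) (m1 : {sigma_finite_measure set T1 -> \bar R})
    (m2 : {sigma_finite_measure set T2 -> \bar R}) (A : set (T1 * T2)) :
  measurable A -> (m1 \x m2) A = \int[m2]_y m1 (ysection A y).
Proof.
move=> mA; apply: (@product_measure_unique _ _ _ _ _ m1 m2 (m1 \x^ m2)) => //.
by move=> B C mB mC; exact: product_measure2E.
Qed.

(** The slices are measured by an outer measure and the integral is a supremum
    over smaller simple functions, so the area of arbitrary sets is monotone; it
    is applied to parallel sets of grains. *)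
Lemma le_area (R : realType) (A B : set (R * R)) : A `<=` B -> area A <= area B.
Proof.
move=> AB; rewrite /area /product_measure1; apply: ge0_le_integral_any => x /=.
  exact: outer_measure_ge0.
by apply: le_outer_measure => y /xsectionP Ay; apply/xsectionP; exact: AB.
Qed.

Section locally_finite_measures.
Context {R : realType} (mu : lfmeasure R).

(** Locally finite measures are sigma-finite, as Fubini's theorem requires. *)
Definition lfmeasure_fun : set (R * R) -> \bar R := mu.

HB.instance Definition _ := isMeasure.Build _ (R * R)%type R lfmeasure_fun
  (measure0 mu) (measure_ge0 mu) (@measure_semi_sigma_additive _ _ _ mu).

Let sigma_finite_lfmeasure : sigma_finite setT lfmeasure_fun.
Proof.
exists plane_box => [|m]; first by rewrite plane_box_cover.
by split; [|apply: lfmeasure_finite; last exact: plane_box_bounded]; exact: measurable_plane_box.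
Qed.

HB.instance Definition _ := Measure_isSigmaFinite.Build _ (R * R)%type R lfmeasure_fun
  sigma_finite_lfmeasure.

End locally_finite_measures.

Section typical_grain.
Context {R : realType} (Q : probability (grain R) R).
Implicit Types (F : grain R) (p q : leaf R).
Local Notation H := (@hausdorff1 R).
Local Notation Lam := (leaf_intensity Q).

Lemma measurable_area_grain : measurable_fun setT (fun F : grain R => area F).
Proof.
have := @measurable_fun_xsection _ _ (grain R) (R * R)%type R (@area R) _ measurable_mem_grain.
by congr measurable_fun; apply/funext => F; congr area; apply/seteqP; split=> y;
  [move=> /xsectionP|move=> Fy; apply/xsectionP].
Qed.

Lemma measurable_area_interior : measurable_fun setT (fun F : grain R => area ((F : set (R * R))°)).
Proof.
have := @measurable_fun_xsection _ _ (grain R) (R * R)%type R (@area R) _ measurable_mem_interior.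
by congr measurable_fun; apply/funext => F; congr area; apply/seteqP; split=> y;
  [move=> /xsectionP|move=> Fy; apply/xsectionP].
Qed.

Lemma grain_bounded F : bounded_set (F : set (R * R)).
Proof. exact: (@compact_bounded R (R * R)%type _ (@grain_compact R F)). Qed.

Lemma measurable_leaf_at (y : R * R) (J : set R) (B : set (grain R * (R * R))) :
  measurable J -> measurable B ->
  measurable [set q : leaf R | J (leaf_time q) /\ B (q.2, (y - leaf_place q)%R)].
Proof.
move=> mJ mB; apply: measurableI.
  by have := @measurable_leaf_time R measurableT _ mJ; rewrite setTI.
have mpair : measurable_fun setT (fun q : leaf R => (q.2, (y - leaf_place q)%R : (R * R)%type)).
  apply: measurable_fun_pair => //; apply/measurable_fun_pairP; split; apply: measurable_funB.
  - exact: measurable_cst.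
  - exact: measurableT_comp measurable_fst measurable_leaf_place.
  - exact: measurable_cst.
  - exact: measurableT_comp measurable_snd measurable_leaf_place.
by have := @mpair measurableT _ mB; rewrite setTI.
Qed.

(** The places of the leaves with a given grain that relate to [y] as required by
    [B] form a reflected translate of the section of [B] at the grain. *)
Lemma leaf_intensity_at (y : R * R) (J : set R) (B : set (grain R * (R * R))) :
  measurable J -> measurable B ->
  Lam [set q | J (leaf_time q) /\ B (q.2, (y - leaf_place q)%R)] =
  \int[Q]_F (area (xsection B F) * length J).
Proof.
move=> mJ mB; rewrite /leaf_intensity product_measure_ysection; last exact: measurable_leaf_at.
apply: eq_integral => F _.
have mBF : measurable (xsection B F) by exact: measurable_xsection.
rewrite -(area_reflect y mBF) -volumeX//; last first.
  have mdiff : measurable_fun setT (fun x : R * R => (y - x)%R : (R * R)%type).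
    apply/measurable_fun_pairP; split; apply: measurable_funB.
    - exact: measurable_cst.
    - exact: measurable_fst.
    - exact: measurable_cst.
    - exact: measurable_snd.
  by have := @mdiff measurableT _ mBF; rewrite setTI.
congr volume; apply/seteqP; split=> -[x t].
  by move=> /ysectionP[Jt Bx]; split => //=; exact/xsectionP.
by move=> [/= /xsectionP Bx Jt]; apply/ysectionP.
Qed.

Section thick_grains.
Hypotheses (Q_interior : 0 < Q [set F : grain R | (F : set (R * R))° !=set0])
  (Q_parallel : \int[Q]_F area (minkowski_sum F (eball 1%R)) < +oo).

Let area_rational_ball n : (0 < @ball_radius R n)%R -> 0 < area (@rational_ball R n).
Proof.
move=> r0.
rewrite (_ : @rational_ball R n =
  ball (ball_center n).1 (ball_radius n) `*` ball (ball_center n).2 (ball_radius n)).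
  rewrite areaX; [|exact: measurable_ball|exact: measurable_ball].
  have len (c : R) : 0 < length (ball c (ball_radius n)).
    rewrite /length ball_itv lebesgue_measure_itv/= lte_fin.
    have -> : (c - ball_radius n < c + ball_radius n)%R by lra.
    by rewrite -EFinB lte_fin; lra.
  exact: mule_gt0.
by apply/seteqP; split=> -[].
Qed.

Lemma mean_area_gt0 : 0 < \int[Q]_F area F.
Proof.
have [n [n0 Qn]] := grain_nonempty_interior Q_interior.
apply: (@lt_le_trans _ _ (\int[Q]_F (area (@rational_ball R n) *
    (\1_[set F : grain R | rational_ball n `<=` F] F : R)%:E))).
  rewrite ge0_integralZl//.
  - rewrite integral_indic ?setIT//; first by apply: mule_gt0 => //; exact: area_rational_ball.
    exact: measurable_ball_subset.
  - by apply/measurable_EFinP; apply: measurable_indic; exact: measurable_ball_subset.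
apply: ge0_le_integral_any => F; first by rewrite mule_ge0// lee_fin.
rewrite indicE; case: (boolP (_ \in _)) => [/set_mem nF|_]; last by rewrite mule0.
by rewrite mule1; exact: le_area.
Qed.

Lemma mean_area_fin : \int[Q]_F area F < +oo.
Proof.
apply: le_lt_trans Q_parallel; apply: ge0_le_integral_any => F //.
apply: le_area => y Fy; exists y => //; exists 0%R; last by rewrite addr0.
by rewrite /eball /= /enorm /= expr0n /= addr0 sqrtr0.
Qed.

(** If a ball is contained in the grain with positive probability, then the
    leaves that cover a given smaller ball arrive at a positive rate for an
    infinite time. *)
Lemma covering_leaves_infinite : exists2 r : R, (0 < r)%R &
  forall k, small_ball r k -> exists B : set (leaf R), [/\ measurable B, Lam B = +oo &
    forall p, B p -> (0 <= leaf_time p)%R /\ rational_ball k `<=` leaf_interior p].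
Proof.
have [n [n0 Qn]] := grain_nonempty_interior Q_interior.
have r20 : (0 < @ball_radius R n / 2)%R by rewrite divr_gt0.
exists (ball_radius n / 2)%R => // k [_ kr].
(* For places in [U] the shifted ball [k] is within half the radius of the centre of
   ball [n], and its own radius is at most the other half. *)
pose U : set (R * R) := ball (@ball_center R k - ball_center n)%R (ball_radius n / 2)%R.
have UE : U = ball (@ball_center R k - ball_center n)%R.1 (ball_radius n / 2)%R `*`
    ball (@ball_center R k - ball_center n)%R.2 (ball_radius n / 2)%R.
  by apply/seteqP; split=> -[].
have mU : measurable U by rewrite UE; apply: measurableX; exact: measurable_ball.
have U0 : 0 < area U.
  rewrite UE areaX; [|exact: measurable_ball|exact: measurable_ball].
  have len (c : R) : 0 < length (ball c (ball_radius n / 2)%R).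
    rewrite /length ball_itv lebesgue_measure_itv/= lte_fin.
    have -> : (c - @ball_radius R n / 2 < c + ball_radius n / 2)%R by lra.
    by rewrite -EFinB lte_fin; lra.
  exact: mule_gt0.
have mitv : measurable (`[0%R, +oo[%classic : set R) by exact: measurable_itv.
exists ((U `*` `[0%R, +oo[%classic) `*` [set F : grain R | rational_ball n `<=` F]); split.
- by apply: measurableX; [exact: measurableX|exact: measurable_ball_subset].
- rewrite leaf_intensityX; [|exact: measurableX|exact: measurable_ball_subset].
  rewrite volumeX// /length lebesgue_measure_itv/= ltry oppr0 adde0.
  by rewrite gt0_muley// gt0_mulye.
- move=> [[x t] F] [[/= Ux]]; rewrite in_itv/= andbT => t0 nF; split=> // y /kr yk.
  apply/leaf_interiorE/mem_interiorP; exists n => //; rewrite /leaf_place /=.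
  move: Ux yk; rewrite /U /rational_ball -!ball_normE /ball_ /= => xU yk.
  have -> : (ball_center n - (y - x) =
    - ((@ball_center R k - ball_center n - x) - (ball_center k - y)))%R.
    by rewrite !opprB addrACA; ring.
  rewrite normrN [ltRHS]splitr; apply: le_lt_trans (ler_normB _ _) _.
  exact: ltrD.
Qed.

(** The places of the leaves that hit a small ball lie in a reflected and
    translated parallel set of the grain, of finite mean area. *)
Lemma hitting_leaves_finite k (n : nat) : small_ball (1 / 2 : R)%R k ->
  exists B : set (leaf R), [/\ measurable B, Lam B < +oo &
    forall p, (0 <= leaf_time p < n%:R)%R ->
      translate (p.2 : set (R * R)) (leaf_place p) `&` rational_ball k !=set0 -> B p].
Proof.
move=> [_ kr]; pose hit := [set z : (R * R) * grain R | translate z.2 z.1 `&` rational_ball k !=set0].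
have mhit : measurable hit by apply: measurable_translated_hit; exact: open_rational_ball.
pose B : set (leaf R) := [set p | `[0%R, n%:R[%classic (leaf_time p) /\ hit (leaf_place p, p.2)].
have mB : measurable B.
  apply: measurableI.
    have := @measurable_leaf_time R measurableT _ (measurable_itv `[0%R, n%:R[).
    by rewrite setTI.
  have mpair : measurable_fun setT (fun p : leaf R => (leaf_place p, p.2)).
    by apply: measurable_fun_pair => //; exact: measurable_leaf_place.
  by have := @mpair measurableT _ mhit; rewrite setTI.
exists B; split=> [//||p pn ph]; last by split => //=; rewrite in_itv.
have BE F : volume (ysection B F) = area (ysection hit F) * n%:R%:E.
  rewrite (_ : ysection B F = ysection hit F `*` `[0%R, n%:R[%classic); last first.
    apply/seteqP; split=> z; first by move=> /ysectionP[zt zh]; split => //; exact/ysectionP.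
    by move=> [/ysectionP zh zt]; apply/ysectionP; split.
  rewrite volumeX; [|exact: measurable_ysection|exact: measurable_itv].
  rewrite /length lebesgue_measure_itv/= lte_fin; case: ifPn => [_|]; first by rewrite oppr0 adde0.
  by rewrite -leNgt => n0; have -> : (n%:R = 0 :> R)%R by apply/eqP; rewrite eq_le n0 ler0n.
have hit_area F : area (ysection hit F) <= area (minkowski_sum F (eball 1%R)).
  rewrite -(area_reflect (ball_center k) (measurable_ysection F mhit)).
  apply: le_area => z /= /ysectionP[_ [[a Fa <-]]] /kr; rewrite -ball_normE /ball_ /=.
  set b := (X in `|X|%R) => b_small; exists a => //; exists (z - a)%R; last by rewrite addrC subrK.
  have bE : b = (z - a)%R by rewrite /b opprD opprB; ring.
  rewrite -bE /eball /= /enorm; move: b_small; rewrite prod_normE gt_max => /andP[b1 b2].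
  rewrite -[leRHS]sqrtr1 ler_wsqrtr//.
  (* Both coordinates are less than 1/2, so the Euclidean norm is at most 1. *)
  have sq (u : R) : (`|u| < 1 / 2 -> u ^+ 2 <= 1 / 4)%R.
    by rewrite ltr_norml => /andP[? ?]; nra.
  by have := sq _ b1; have := sq _ b2; lra.
rewrite /leaf_intensity product_measure_ysection//.
apply: (@le_lt_trans _ _ (\int[Q]_F (area (ysection hit F) * n%:R%:E))).
  by rewrite le_eqVlt; apply/orP; left; apply/eqP; apply: eq_integral => F _; exact: BE.
rewrite ge0_integralZr//; last first.
  exact: (@measurable_fun_ysection _ _ _ _ R (@area R)).
rewrite lte_mul_pinfty//; first by apply: integral_ge0.
  rewrite ge0_fin_numE; last by apply: integral_ge0.
  by apply: le_lt_trans Q_parallel; apply: ge0_le_integral_any.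
by rewrite ltry.
Qed.

End thick_grains.
End typical_grain.

(** * The boundary length of a typical grain *)

Section boundary_length.
Context {R : realType} (Q : probability (grain R) R) (X : grain R -> lfmeasure R).
Hypothesis mX : measurable_fun setT X.
Implicit Types (F : grain R) (p q : leaf R).
Local Notation H := (@hausdorff1 R).
Local Notation Lam := (leaf_intensity Q).

Definition regular_grain F := forall A, measurable A ->
  H (A `&` boundary (F : set (R * R))) = X F A.

Hypothesis XE : {ae Q, forall F, regular_grain F}.

Lemma hausdorff1_boundary_fin F : regular_grain F ->
  H (boundary (F : set (R * R))) < +oo.
Proof.
move=> FE; rewrite (_ : boundary _ = (F : set (R * R)) `&` boundary (F : set (R * R))).
  rewrite FE; last exact: measurable_grain.
  by apply: lfmeasure_finite; [exact: measurable_grain|exact: grain_bounded].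
by apply/esym/setIidr; rewrite boundary_grainE => y [].
Qed.

(** A boundary of finite length has no area. *)
Lemma area_boundary0 F : regular_grain F -> area (boundary (F : set (R * R))) = 0.
Proof.
move=> FE; apply: area_hausdorff1_finite; first exact: measurable_boundary.
exact: hausdorff1_boundary_fin.
Qed.

Lemma mean_area_interior :
  \int[Q]_F area ((F : set (R * R))°) = \int[Q]_F area (F : set (R * R)).
Proof.
apply: ge0_ae_eq_integral => //.
- exact: measurable_area_interior.
- exact: measurable_area_grain.
- apply: filterS XE => F FE _.
  rewrite -[LHS]adde0 -(area_boundary0 FE) -measureU.
  + congr area; rewrite boundary_grainE setDUK//; exact: interior_subset.
  + exact: measurable_interior.
  + exact: measurable_boundary.
  + by rewrite boundary_grainE setDIK.
Qed.

Let boundary_point_null (y : R * R) : Lam [set q | leaf_boundary q y] = 0.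
Proof.
rewrite (_ : [set q | _] = [set q : leaf R | setT (leaf_time q) /\
    [set z : grain R * (R * R) | boundary (z.1 : set (R * R)) z.2] (q.2, (y - leaf_place q)%R)]).
  rewrite leaf_intensity_at//; last exact: measurable_mem_boundary.
  transitivity (\int[Q]_F (cst (0 : \bar R) F)); last by rewrite integral0.
  apply: ae_eq_integral_any => [F|//|]; first exact: mule_ge0.
  apply: filterS XE => F FE.
  rewrite [X in area X](_ : _ = boundary (F : set (R * R))) ?area_boundary0 ?mul0e//.
  by apply/seteqP; split=> z; [move=> /xsectionP|move=> h; apply/xsectionP].
by apply/seteqP; split=> q; [move=> /leaf_boundaryE h; split|move=> [_ h]; apply/leaf_boundaryE].
Qed.

(** Pairs of leaves whose boundaries share a set of positive length, computed
    with the boundary length [X] of the first grain. *)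
Definition overlapping : set (leaf R * leaf R) :=
  [set z | X z.1.2 [set y | leaf_boundary z.2 (y + leaf_place z.1)%R] != 0].

Let mark (z : leaf R * leaf R) : {measure set (R * R) -> \bar R} := X z.1.2.

Let measurable_mark A : measurable A -> measurable_fun setT (mark ^~ A).
Proof.
move=> mA; apply: (measurableT_comp (measurable_evaluation mX mA)).
exact: measurableT_comp measurable_snd measurable_fst.
Qed.

HB.instance Definition _ := isKernel.Build _ _ (leaf R * leaf R)%type
  (R * R)%type R mark measurable_mark.

Let touching : set ((leaf R * leaf R) * (R * R)) :=
  [set u | leaf_boundary u.1.2 (u.2 + leaf_place u.1.1)%R].

Let measurable_touching : measurable touching.
Proof.
pose Y := ((leaf R * leaf R) * (R * R))%type.
have mp : measurable_fun setT (fun u : Y => leaf_place u.1.1).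
  apply: (measurableT_comp measurable_leaf_place).
  exact: measurableT_comp measurable_fst measurable_fst.
have mq : measurable_fun setT (fun u : Y => leaf_place u.1.2).
  apply: (measurableT_comp measurable_leaf_place).
  exact: measurableT_comp measurable_snd measurable_fst.
have mpair : measurable_fun setT (fun u : Y =>
    (u.1.2.2, (u.2 + leaf_place u.1.1 - leaf_place u.1.2)%R : (R * R)%type)).
  apply: measurable_fun_pair.
    apply: (measurableT_comp measurable_snd).
    exact: measurableT_comp measurable_snd measurable_fst.
  apply/measurable_fun_pairP; split.
    apply: measurable_funB; last exact: measurableT_comp measurable_fst mq.
    apply: measurable_funD; last exact: measurableT_comp measurable_fst mp.
    exact: measurableT_comp measurable_fst measurable_snd.
  apply: measurable_funB; last exact: measurableT_comp measurable_snd mq.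
  apply: measurable_funD; last exact: measurableT_comp measurable_snd mp.
  exact: measurableT_comp measurable_snd measurable_snd.
have := @mpair measurableT _ measurable_mem_boundary; rewrite setTI; congr measurable.
by apply/seteqP; split=> u; [move=> h; apply/leaf_boundaryE|move/leaf_boundaryE].
Qed.

Let overlap (z : leaf R * leaf R) := X z.1.2 [set y | leaf_boundary z.2 (y + leaf_place z.1)%R].

Let measurable_overlap : measurable_fun setT overlap.
Proof.
have := @measurable_kernel_xsection _ _ (leaf R * leaf R)%type (R * R)%type R mark _
  (@measurable_plane_box R) (@plane_box_nd R) (@plane_box_cover R) _ touching measurable_touching.
rewrite (_ : (fun z => mark z (xsection touching z)) = overlap).
  by apply => z m; apply: lfmeasure_finite; [exact: measurable_plane_box|exact: plane_box_bounded].
apply/funext => z; rewrite /mark /overlap; congr (X _ _).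
by apply/seteqP; split=> y; [move=> /xsectionP|move=> Dy; apply/xsectionP].
Qed.

Lemma measurable_overlapping : measurable overlapping.
Proof.
have := @measurable_overlap measurableT _ (measurableC (emeasurable_set1 0)).
by rewrite setTI; congr measurable; apply/seteqP; split=> z /= /eqP.
Qed.

(** For a fixed first leaf, Fubini's theorem exchanges its boundary length and
    the measure of the second leaf; a given point lies on the boundary of almost
    no leaf, because boundaries have area 0. *)
Lemma overlapping_null : (Lam \x Lam) overlapping = 0.
Proof.
rewrite /product_measure1; apply: integral0_eq => p _ /=.
pose mu := lfmeasure_fun (X p.2).
pose D : set (leaf R * (R * R)) := [set u | touching ((p, u.1), u.2)].
have mD : measurable D.
  have mpair : measurable_fun setT (fun u : leaf R * (R * R) => ((p, u.1), u.2)).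
    by apply: measurable_fun_pair => //; apply: measurable_fun_pair.
  by have := @mpair measurableT _ measurable_touching; rewrite setTI.
have D0 : (Lam \x mu) D = 0.
  rewrite product_measure_ysection//; apply: integral0_eq => y _.
  rewrite -[RHS](boundary_point_null (y + leaf_place p)%R); congr (Lam _).
  by apply/seteqP; split=> q; [move=> /ysectionP|move=> h; apply/ysectionP].
have mq : measurable_fun setT (fun q => overlap (p, q)).
  by apply: (measurableT_comp measurable_overlap); exact: measurable_fun_pair.
have : \int[Lam]_q `|overlap (p, q)| = 0.
  rewrite -D0 /product_measure1; apply: eq_integral => q _ /=.
  rewrite gee0_abs//; congr (X _ _).
  by apply/seteqP; split=> y; [move=> h; apply/xsectionP|move=> /xsectionP].
move=> /(ae_eq_integral_abs Lam measurableT mq)[N [mN N0 sub]].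
apply: (@subset_measure0 _ _ _ Lam _ N) => //.
  by apply: measurable_xsection; exact: measurable_overlapping.
by move=> q /xsectionP pq; apply: sub => /= h; move: pq; rewrite /overlapping /= -[X _ _]/(overlap (p, q)) h// eqxx.
Qed.

End boundary_length.

(** * The leaves of the model *)

Section dead_leaves.
Context d (Omega : measurableType d) (R : realType) (P : probability Omega R).
Context (Q : probability (grain R) R).
Variables (x : nat -> {RV P >-> (R * R)%type}) (t : nat -> {RV P >-> R})
  (S : nat -> {RV P >-> grain R}).
Hypotheses (Q_interior : 0 < Q [set F : grain R | (F : set (R * R))° !=set0])
  (model : dead_leaves_model x t S Q)
  (Q_parallel : \int[Q]_F area (minkowski_sum F (eball 1%R)) < +oo).
Variable X : grain R -> lfmeasure R.
Hypotheses (mX : measurable_fun setT X) (XE : {ae Q, forall F, regular_grain X F}).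
Local Notation Lam := (leaf_intensity Q).
Local Notation H := (@hausdorff1 R).

Definition leaves (i : nat) (w : Omega) : leaf R := ((x i w, t i w), S i w).

Definition leaf_set (w : Omega) : configuration (leaf R) := support (leaves ^~ w).

Lemma measurable_leaves i : measurable_fun setT (leaves i).
Proof.
apply: measurable_fun_pair; last exact: measurable_funPT.
by apply: measurable_fun_pair; exact: measurable_funPT.
Qed.

Let measurable_leaf_event i (B : set (leaf R)) : measurable B -> measurable (leaves i @^-1` B).
Proof. by move=> mB; rewrite -[X in measurable X]setTI; exact: measurable_leaves. Qed.

Let mplace i : measurable_fun setT (fun w => (x i w, t i w)).
Proof. by apply: measurable_fun_pair; exact: measurable_funPT. Qed.

Lemma leaves_void (A : set (leaf R)) : measurable A ->
  P (leaf_set @^-1` missing A) = expeR (- Lam A).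
Proof.
move=> mA; have [poisson S_law S_indep pS] := model.
rewrite -(marked_void mplace (fun i => measurable_funPT (S i)) poisson S_law S_indep pS mA).
by congr (P _); apply/seteqP; split=> w /missing_supportE.
Qed.

Lemma leaf_times_distinct : {ae P, forall w, injective (fun i => leaf_time (leaves i w))}.
Proof.
have [poisson _ _ _] := model.
apply: (distinct_times (tau := snd) (K := @box R) (C := fun m => ((m%:R + m%:R) ^+ 2)%R)
  mplace poisson).
- exact: measurable_snd.
- exact: measurable_box.
- exact: box_nd.
- exact: box_cover.
- exact: box_time.
- exact: volume_box_slab.
Qed.

Lemma mean_leaf_count (B : set (leaf R)) : measurable B ->
  \sum_(i <oo) P (leaves i @^-1` B) = Lam B.
Proof.
apply: (@campbell_count _ Omega R P _ (leaf R) leaves measurable_leaves Lam leaves_void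
  (@leaf_time R) (@leaf_box R) (fun m => ((m%:R + m%:R) ^+ 2)%R)).
- exact: measurable_leaf_time.
- exact: measurable_leaf_box.
- exact: leaf_box_nd.
- exact: leaf_box_cover.
- exact: leaf_box_time.
- exact: leaf_box_slab.
- exact: leaf_times_distinct.
Qed.

Lemma leaves_mecke (f : leaf R * configuration (leaf R) -> \bar R) :
  measurable_fun setT f -> (forall z, 0 <= f z) ->
  \sum_(i <oo) \int[P]_w f (leaves i w, leaf_set w) =
  \int[Lam]_p \int[P]_w f (p, leaf_set w `|` [set p]).
Proof.
apply: (@mecke _ Omega R P _ (leaf R) leaves measurable_leaves Lam leaves_void
  (@leaf_time R) (@leaf_box R) (fun m => ((m%:R + m%:R) ^+ 2)%R)).
- exact: measurable_leaf_time.
- exact: measurable_leaf_box.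
- exact: leaf_box_nd.
- exact: leaf_box_cover.
- exact: leaf_box_time.
- exact: leaf_box_slab.
- exact: leaf_times_distinct.
Qed.

Let leaves_null_pairs (D : set (leaf R * leaf R)) : measurable D -> (Lam \x Lam) D = 0 ->
  {ae P, forall w i j, (leaf_time (leaves j w) < leaf_time (leaves i w))%R ->
    ~ D (leaves i w, leaves j w)}.
Proof.
apply: (@null_pairs _ Omega R P _ (leaf R) leaves measurable_leaves Lam leaves_void
  (@leaf_time R) (@leaf_box R) (fun m => ((m%:R + m%:R) ^+ 2)%R)).
- exact: measurable_leaf_time.
- exact: measurable_leaf_box.
- exact: leaf_box_nd.
- exact: leaf_box_cover.
- exact: leaf_box_time.
- exact: leaf_box_slab.
- exact: leaf_times_distinct.
Qed.

Let finitely_many_leaves (B : set (leaf R)) : measurable B -> Lam B < +oo ->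
  {ae P, forall w, exists M, forall i, (M <= i)%N -> ~ B (leaves i w)}.
Proof.
move=> mB Bfin.
have mBi i : measurable (leaves i @^-1` B) by exact: measurable_leaf_event.
have Pfin : \sum_(i <oo) P (leaves i @^-1` B) < +oo by rewrite mean_leaf_count.
have null := lim_sup_set_cvg0 mBi Pfin.
exists (lim_sup_set (fun i => leaves i @^-1` B)); split => //.
  by apply: bigcapT_measurable => n; apply: bigcup_measurable => i _.
move=> w /= nex n _; apply: contrapT => nB; apply: nex; exists n => i ni Bi.
by apply: nB; exists i.
Qed.

Let some_leaf (B : set (leaf R)) : measurable B -> Lam B = +oo ->
  {ae P, forall w, exists i, B (leaves i w)}.
Proof.
move=> mB Boo; exists (leaf_set @^-1` missing B); split.
- rewrite -[X in measurable X]setTI.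
  by apply: (measurable_support measurable_leaves) => //; exact: measurable_missing.
- by rewrite leaves_void// Boo.
- by move=> w /= /forallNP none; exact/missing_supportE.
Qed.

Let leaves_regular : {ae P, forall w i, regular_grain X (S i w)}.
Proof.
apply/ae_foralln => i; have [N [mN N0 sub]] := XE.
have [_ S_law _ _] := model.
exists (S i @^-1` N); split.
- by rewrite -[X in measurable X]setTI; exact: measurable_funPT.
- by rewrite -N0; exact: S_law.
- by move=> w /= nreg; exact: sub.
Qed.

Let nneseries_finite (u : nat -> \bar R) (M : nat) : (forall i, 0 <= u i < +oo) ->
  (forall i, (M <= i)%N -> u i = 0) -> \sum_(i <oo) u i < +oo.
Proof.
move=> u0 uM; rewrite (nneseries_split 0 M) => [|i _]; last by case/andP: (u0 i).
rewrite add0n [X in _ + X]eseries0 ?adde0 => [|i Mi _]; last exact: uM.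
elim/big_ind : _ => [|a b|i _]; [by []|exact: lte_add_pinfty|by case/andP: (u0 i)].
Qed.

Let leaf_box_fin m : Lam (leaf_box m) < +oo.
Proof. exact: (box_fin (@leaf_box_time R m) (leaf_box_slab Q m)). Qed.

(** Local finiteness rests on two facts about balls of a small fixed size: the
    leaves that hit one before a given time are finitely many (Borel and
    Cantelli), and some leaf covers it (its void probability is [exp (- oo)]).
    Overlaps are excluded by Mecke's formula, for pairs of leaves at distinct
    times. *)
Lemma leaves_good : {ae P, forall w, good_sequence X (leaves ^~ w)}.
Proof.
have boxes : {ae P, forall w m, exists M, forall i, (M <= i)%N -> ~ leaf_box m (leaves i w)}.
  apply/ae_foralln => m; apply: finitely_many_leaves; first exact: measurable_leaf_box.
  exact: leaf_box_fin.
have [r0 r00 covering] := covering_leaves_infinite Q_interior.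
(* Below [r0] balls are covered; up to [1 / 2] they are hit by finitely many leaves. *)
pose r := Num.min r0 (1 / 2)%R.
have r_gt0 : (0 < r)%R by rewrite lt_min r00 divr_gt0.
have small_le (a b : R) k : (a <= b)%R -> small_ball a k -> small_ball b k.
  by move=> ab [kc ka]; split => // y /ka; exact: le_ball.
have few : {ae P, forall w k n, small_ball r k -> exists M, forall i, (M <= i)%N ->
   ~ ((0 <= leaf_time (leaves i w) < n%:R)%R /\
        translate ((leaves i w).2 : set (R * R)) (leaf_place (leaves i w)) `&`
          rational_ball k !=set0)}.
  apply/ae_foralln => k; apply/ae_foralln => n.
  have [ks|nks] := pselect (small_ball r k); last exact: aeW.
  have ks2 : small_ball (1 / 2 : R)%R k by apply: small_le ks; rewrite ge_min lexx orbT.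
  have [B [mB Bfin hitB]] := hitting_leaves_finite Q_parallel n ks2.
  apply: filterS (finitely_many_leaves mB Bfin) => w [M MB] _; exists M => i Mi [ti hi].
  exact/(MB i Mi)/hitB.
have covered : {ae P, forall w k, small_ball r k -> exists i,
    (0 <= leaf_time (leaves i w))%R /\ rational_ball k `<=` leaf_interior (leaves i w)}.
  apply/ae_foralln => k.
  have [ks|nks] := pselect (small_ball r k); last exact: aeW.
  have ks0 : small_ball r0 k by apply: small_le ks; rewrite ge_min lexx.
  have [B [mB Boo coverB]] := covering k ks0.
  by apply: filterS (some_leaf mB Boo) => w [i Bi] _; exists i; exact: coverB.
have apart := leaves_null_pairs (measurable_overlapping mX) (overlapping_null mX XE).
near=> w.
have inj : injective (fun i => leaf_time (leaves i w)) by near: w; exact: leaf_times_distinct.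
have reg : forall i, regular_grain X (S i w) by near: w; exact: leaves_regular.
have box_w : forall m, exists M, forall i, (M <= i)%N -> ~ leaf_box m (leaves i w).
  by near: w; exact: boxes.
have apart_w : forall i j, (leaf_time (leaves j w) < leaf_time (leaves i w))%R ->
    ~ overlapping X (leaves i w, leaves j w).
  by near: w; exact: apart.
split.
- split => // m; have [M Mm] := box_w m.
  apply: (@nneseries_finite _ M) => i; first by rewrite lee_fin ltry andbT.
  by move=> Mi; rewrite indicE memNset//; exact: Mm.
- move=> A mA; apply: hausdorff1_visible_boundary => //.
  by move=> i j ji; apply/eqP; apply: contrapT => /negP; exact: apart_w.
- move=> A mA bA; apply: (visible_boundary_locally_finite r_gt0) => //.
  + by move=> i; rewrite hausdorff1_translate; exact/hausdorff1_boundary_fin/reg.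
  + by near: w.
  + by near: w.
Unshelve. all: by end_near.
Qed.

End dead_leaves.

(** * Stationarity *)

Section shift_invariance.
Context {R : realType} (Q : probability (grain R) R).
Local Notation Lam := (leaf_intensity Q).

Let shift_place (v : R * R) (z : R * R * R) : R * R * R := ((z.1 + v)%R, z.2).

Let measurable_shift_place v : measurable_fun setT (shift_place v).
Proof.
apply: measurable_fun_pair; last exact: measurable_snd.
exact: measurableT_comp (@measurable_translation R v) measurable_fst.
Qed.

Lemma measurable_shift_leaf (v : R * R) : measurable_fun setT (@shift_leaf R v).
Proof.
apply: measurable_fun_pair; last exact: measurable_snd.
exact: measurableT_comp (measurable_shift_place v) measurable_fst.
Qed.

Let volume_shift v (A : set (R * R * R)) : measurable A ->
  volume (shift_place v @^-1` A) = volume A.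
Proof.
move=> mA; rewrite [RHS]volumeE//; apply/esym.
apply: (@product_measure_unique _ _ _ _ R (@area R) (@length R)
  (image_measure (@volume R) (measurable_shift_place v))) => // B C mB mC.
rewrite /= /pushforward -(area_translate v mB) -volumeX//.
by have := @measurable_translation R v measurableT _ mB; rewrite setTI.
Qed.

Lemma leaf_intensity_shift v (A : set (leaf R)) : measurable A ->
  Lam (shift_leaf v @^-1` A) = Lam A.
Proof.
move=> mA; apply/esym.
apply: (@product_measure_unique _ _ _ _ R (@volume R) Q
  (image_measure Lam (measurable_shift_leaf v))) => // B C mB mC.
rewrite /= /pushforward -(volume_shift v mB) -leaf_intensityX//.
by have := @measurable_shift_place v measurableT _ mB; rewrite setTI.
Qed.

End shift_invariance.

Section boundary_of_dead_leaves.
Context d (Omega : measurableType d) (R : realType) (P : probability Omega R).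
Context (Q : probability (grain R) R).
Variables (x : nat -> {RV P >-> (R * R)%type}) (t : nat -> {RV P >-> R})
  (S : nat -> {RV P >-> grain R}).
Hypotheses (Q_interior : 0 < Q [set F : grain R | (F : set (R * R))° !=set0])
  (model : dead_leaves_model x t S Q)
  (Q_parallel : \int[Q]_F area (minkowski_sum F (eball 1%R)) < +oo).
Variable X : grain R -> lfmeasure R.
Hypotheses (mX : measurable_fun setT X) (XE : {ae Q, forall F, regular_grain X F}).
Local Notation Lam := (leaf_intensity Q).
Local Notation H := (@hausdorff1 R).
Local Notation leaves := (leaves x t S).
Local Notation leaf_set := (leaf_set x t S).
Local Notation points := (point_sequence (@leaf_time R) (@leaf_box R)).

(** On a null event the sample point is replaced by a fixed one at which the
    leaves form a good sequence. *)
Let good_sample : exists rho : Omega -> Omega, exists N : set Omega,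
  [/\ measurable_fun setT rho, measurable N, P N = 0,
      forall w, ~ N w -> rho w = w &
      forall w, good_sequence X (leaves ^~ (rho w))].
Proof.
have [N [mN N0 sub]] := leaves_good Q_interior model Q_parallel mX XE.
have good w : ~ N w -> good_sequence X (leaves ^~ w).
  by move=> Nw; apply: contrapT => ngood; apply: Nw; exact: sub.
have [w0 Nw0] : exists w0, ~ N w0.
  apply: contrapT => /forallNP all_N.
  have : P setT = 0.
    by rewrite -N0; congr (P _); apply/seteqP; split=> // w _; apply: contrapT; exact: all_N.
  by rewrite probability_setT => /eqP; rewrite onee_eq0.
exists (fun w => if w \in N then w0 else w), N; split => //.
- move=> _ B mB; rewrite setTI.
  rewrite (_ : _ @^-1` B = (if w0 \in B then N else set0) `|` (~` N `&` B)).
    apply: measurableU; first by case: ifP.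
    by apply: measurableI => //; exact: measurableC.
  apply/seteqP; split=> w /=.
    case: (boolP (w \in N)) => [/set_mem Nw Bw0|nNw Bw]; first by left; rewrite mem_set.
    by right; split => //; move=> Nw; rewrite mem_set in nNw.
  case: (boolP (w \in N)) => [/set_mem Nw|nNw] [|[]//].
  - by case: ifPn => // /set_mem.
  - by case: ifPn => // _ Nw; rewrite mem_set in nNw.
- by move=> w Nw; rewrite memNset.
- by move=> w; case: (boolP (w \in N)) => [_|nNw]; apply: good => // Nw; rewrite mem_set in nNw.
Qed.

Section resampled.
Variables (rho : Omega -> Omega) (N : set Omega).
Hypotheses (mrho : measurable_fun setT rho) (mN : measurable N) (N0 : P N = 0)
  (rhoE : forall w, ~ N w -> rho w = w)
  (good : forall w, good_sequence X (leaves ^~ (rho w))).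

Let pt i w := leaves i (rho w).

Let mpt i : measurable_fun setT (pt i).
Proof. exact: measurableT_comp (measurable_leaves x t S i) mrho. Qed.

Let simple_pt w : simple_sequence (@leaf_time R) (@leaf_box R) (pt ^~ w).
Proof. by have [] := good w. Qed.

Let P_rho (B : set Omega) : measurable B -> P (rho @^-1` B) = P B.
Proof.
move=> mB; have mrB : measurable (rho @^-1` B).
  by rewrite -[X in measurable X]setTI; exact: mrho.
have le A B' : measurable A -> measurable B' -> A `<=` B' `|` N -> P A <= P B'.
  move=> mA mB' AB; rewrite -[leRHS]adde0 -N0.
  apply: le_trans (measureU2 P mB' mN); apply: le_measure; rewrite ?inE//.
  exact: measurableU.
apply/eqP; rewrite eq_le; apply/andP; split; apply: le => // w Bw.
  by have [Nw|Nw] := pselect (N w); [right|left; rewrite -(rhoE Nw)].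
by have [Nw|Nw] := pselect (N w); [right|left; rewrite /= rhoE].
Qed.

Let pt_void (A : set (leaf R)) : measurable A ->
  P ((fun w => support (pt ^~ w)) @^-1` missing A) = expeR (- Lam A).
Proof.
move=> mA; rewrite -(leaves_void model mA).
rewrite -[RHS]P_rho//; rewrite -[X in measurable X]setTI.
by apply: (measurable_support (measurable_leaves x t S)) => //; exact: measurable_missing.
Qed.

Definition boundary_measure w : lfmeasure R := visible_length (good w).

Let boundary_measure_event (B : set (lfmeasure R)) : measurable B ->
  exists2 Gam : set points, measurable Gam &
    boundary_measure @^-1` B = (fun w => pt ^~ w) @^-1` Gam /\
    forall v, (shift_lfmeasure v \o boundary_measure) @^-1` B =
      (fun w => (fun i => shift_leaf v (pt i w)) : points) @^-1` Gam.
Proof.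
move=> mB; have [Gam mG GB] := visible_length_event mX mB.
exists Gam => //; split=> [|v]; apply/seteqP.
  have BG w : B (boundary_measure w) <-> Gam (pt ^~ w) by apply: GB => //; exact: good.
  by split=> w /= /BG.
have BG w : B (shift_lfmeasure v (boundary_measure w)) <-> Gam (fun i => shift_leaf v (pt i w)).
  apply: GB; first exact: good_sequence_shift (good w).
  by move=> A mA; exact: visible_length_shift.
by split=> w /= /BG.
Qed.

Let measurable_boundary_measure : measurable_fun setT boundary_measure.
Proof.
move=> _ B mB; rewrite setTI; have [Gam mG [-> _]] := boundary_measure_event mB.
by rewrite -[X in measurable X]setTI; exact: (measurable_sequence mpt simple_pt).
Qed.

HB.instance Definition _ := isMeasurableFun.Build _ _ Omega (lfmeasure R)
  boundary_measure measurable_boundary_measure.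

Let boundary_rv : {RV P >-> lfmeasure R} := boundary_measure.

Let boundary_measure_version : version
  (fun w A => H (dlm_boundary x t S w `&` A)) boundary_rv.
Proof.
exists N; split => // w /= nE; apply: contrapT => Nw; apply: nE => A mA.
by rewrite /boundary_measure /= /hausdorff_restr rhoE.
Qed.

(** Shifted leaves have the same void probabilities, hence the same law, and the
    length of their visible boundary is the shifted length. *)
Let boundary_measure_shift_invariant :
  shift_invariant (distribution P boundary_rv).
Proof.
move=> v B mB; rewrite /distribution /= /pushforward.
have [Gam mG [BE BvE]] := boundary_measure_event mB.
rewrite [X in P X = _](BvE v) [X in _ = P X]BE.
have mspt i : measurable_fun setT (fun w => shift_leaf v (pt i w)).
  exact: measurableT_comp (measurable_shift_leaf v) (mpt i).
apply: (eq_void_eq_law mspt mpt _ simple_pt) => // [w|A mA].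
  by have [] := good_sequence_shift v (good w).
rewrite pt_void// -(leaf_intensity_shift Q v mA) -pt_void; last first.
  by rewrite -[X in measurable X]setTI; exact: measurable_shift_leaf.
by congr (P _); apply/seteqP; split=> w /missing_supportE h; apply/missing_supportE.
Qed.

Lemma resampled_stationary :
  stationary_random_measure P (fun w A => H (dlm_boundary x t S w `&` A)).
Proof.
exists boundary_rv; first exact: boundary_measure_version.
exact: boundary_measure_shift_invariant.
Qed.

End resampled.

Lemma dead_leaves_stationary :
  stationary_random_measure P (fun w A => H (dlm_boundary x t S w `&` A)).
Proof.
have [rho [N [mrho mN N0 rhoE good]]] := good_sample.
exact: (resampled_stationary mrho mN N0 rhoE good).
Qed.

End boundary_of_dead_leaves.

(** * Intensity *)

Section mean_boundary_length.
Context d (Omega : measurableType d) (R : realType) (P : probability Omega R).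
Context (Q : probability (grain R) R).
Variables (x : nat -> {RV P >-> (R * R)%type}) (t : nat -> {RV P >-> R})
  (S : nat -> {RV P >-> grain R}).
Hypotheses (Q_interior : 0 < Q [set F : grain R | (F : set (R * R))° !=set0])
  (model : dead_leaves_model x t S Q)
  (Q_parallel : \int[Q]_F area (minkowski_sum F (eball 1%R)) < +oo).
Variable X : grain R -> lfmeasure R.
Hypotheses (mX : measurable_fun setT X) (XE : {ae Q, forall F, regular_grain X F}).
Local Notation Lam := (leaf_intensity Q).
Local Notation H := (@hausdorff1 R).
Local Notation leaf_set := (leaf_set x t S).

Let lam : R := fine (\int[Q]_F area (F : set (R * R))).

Let lamE : \int[Q]_F area (F : set (R * R)) = lam%:E.
Proof.
rewrite /lam fineK// ge0_fin_numE; first exact: mean_area_fin Q_parallel.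
exact: integral_ge0.
Qed.

Let lam0 : (0 < lam)%R.
Proof. by rewrite -lte_fin -lamE; exact: mean_area_gt0. Qed.

Let exposedE (y : R * R) (s : R) (w : Omega) :
  exposed (leaf_set w : set (leaf R)) y s <->
  missing [set q : leaf R | `[0%R, s[%classic (leaf_time q) /\
    [set z : grain R * (R * R) | (z.1 : set (R * R))° z.2] (q.2, (y - leaf_place q)%R)]
    (leaf_set w).
Proof.
split=> [ex|miss q Zq qs /leaf_interiorE yq].
  apply/seteqP; split=> // q [Zq [/=]]; rewrite in_itv/= => qs yq.
  by apply: (ex q Zq qs); exact/leaf_interiorE.
by rewrite -[False]/(set0 q) -miss.
Qed.

(** A point is still exposed at time [s] when none of the leaves of a Poisson
    number, of mean [s] times the mean area of the grain, covers it. *)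
Let exposed_probability (y : R * R) (s : R) : (0 <= s)%R ->
  P [set w | exposed (leaf_set w : set (leaf R)) y s] = (expR (- lam * s))%:E.
Proof.
move=> s0.
rewrite (_ : [set w | _] = leaf_set @^-1` missing
  [set q : leaf R | `[0%R, s[%classic (leaf_time q) /\
    [set z : grain R * (R * R) | (z.1 : set (R * R))° z.2] (q.2, (y - leaf_place q)%R)]);
  last by apply/seteqP; split=> w /exposedE.
have mi := @measurable_mem_interior R.
have mJ : measurable (`[0%R, s[%classic : set R) by exact: measurable_itv.
rewrite (leaves_void model); last exact: measurable_leaf_at mJ mi.
rewrite leaf_intensity_at//.
have lenE : length `[0%R, s[%classic = s%:E.
  rewrite /length lebesgue_measure_itv/= lte_fin; move: s0; rewrite le_eqVlt.
  by move=> /predU1P[<-|->]; rewrite ?ltxx// oppr0 adde0.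
rewrite lenE (eq_integral (fun F : grain R => area ((F : set (R * R))°) * s%:E)); last first.
  move=> F _; congr (area _ * _).
  by apply/seteqP; split=> z; [move=> /xsectionP|move=> h; apply/xsectionP].
rewrite ge0_integralZr//; last exact: measurable_area_interior.
by rewrite (mean_area_interior XE) lamE -EFinM -EFinN /= mulNr.
Qed.

Let seen_length (A : set (R * R)) (p : leaf R) := X p.2 [set y | A (y + leaf_place p)%R].

Let measurable_seen_length A : measurable A -> measurable_fun setT (seen_length A).
Proof.
move=> mA.
(* At time 0 and in the empty configuration nothing hides the leaf. *)
have mp : measurable_fun setT (fun p : leaf R =>
    ((((leaf_place p, 0%R), p.2) : leaf R), (set0 : configuration (leaf R)))).
  apply: measurable_fun_pair => //; apply: measurable_fun_pair => //.
  by apply: measurable_fun_pair => //; exact: measurable_leaf_place.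
rewrite (_ : seen_length A = exposed_length X A \o (fun p : leaf R =>
    ((((leaf_place p, 0%R), p.2) : leaf R), (set0 : configuration (leaf R))))).
  exact: measurableT_comp (measurable_exposed_length mX mA) mp.
apply/funext => p; rewrite /seen_length /exposed_length /=; congr (X _ _).
by apply/seteqP; split=> y; [move=> Ay; split => //=|move=> []].
Qed.

(** The added leaf does not hide itself, so its boundary is exposed as at an
    independent point. The exponential decay in time is written as a multiple of
    the exponential density, whose integral is 1. *)
Let mean_exposed_length (A : set (R * R)) (p : leaf R) : measurable A ->
  \int[P]_w exposed_length X A (p, leaf_set w `|` [set p]) =
  (lam^-1 * exponential_pdf lam (leaf_time p))%:E * seen_length A p.
Proof.
move=> mA; have [p0|p0] := ltP (leaf_time p) 0%R.
  rewrite lt0_exponential_pdf// mulr0 mul0e; apply: integral0_eq => w _.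
  rewrite /exposed_length (_ : exposed_part _ _ = set0) ?measure0//.
  by apply/seteqP; split=> // y [/=]; rewrite leNgt p0.
pose mu := lfmeasure_fun (X p.2).
pose B := [set y : R * R | A (y + leaf_place p)%R].
have mB : measurable B.
  by have := @measurable_translation R (leaf_place p) measurableT _ mA; rewrite setTI.
pose D : set (Omega * (R * R)) := [set u |
  exposed (leaf_set u.1 : set (leaf R)) (u.2 + leaf_place p)%R (leaf_time p)] `&` (setT `*` B).
have mD : measurable D.
  apply: measurableI; last exact: measurableX.
  have mu2 : measurable_fun setT (fun u : Omega * (R * R) =>
      (leaf_set u.1, ((u.2 + leaf_place p)%R : (R * R)%type, leaf_time p))).
    apply: measurable_fun_pair.
      exact: measurableT_comp (measurable_support (measurable_leaves x t S)) measurable_fst.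
    apply: measurable_fun_pair => //.
    exact: measurableT_comp (@measurable_translation R (leaf_place p)) measurable_snd.
  by have := @mu2 measurableT _ measurable_exposed; rewrite setTI.
transitivity ((P \x mu) D).
  apply: eq_integral => w _; rewrite /exposed_length /=; congr (X _ _).
  apply/seteqP; split=> y.
    by move=> [_ Ay ex]; apply/xsectionP; split=> //= q Zq; apply: ex; left.
  move=> /xsectionP[/= ex [_ Ay]]; split=> //= q [Zq|->]; first exact: ex.
  by rewrite ltxx andbF.
rewrite product_measure_ysection//.
transitivity (\int[mu]_y ((expR (- lam * leaf_time p))%:E * (\1_B y : R)%:E)).
  apply: eq_integral => y _; rewrite indicE.
  case: (boolP (y \in B)) => [/set_mem By|nB]; last first.
    rewrite mule0 (_ : ysection D y = set0) ?measure0//.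
    by apply/seteqP; split=> // w /ysectionP[_ [_ By]]; rewrite mem_set in nB.
  rewrite mule1 -(exposed_probability (y + leaf_place p)%R p0); congr (P _).
  apply/seteqP; split=> w; first by move=> /ysectionP[].
  by move=> ex; apply/ysectionP.
rewrite ge0_integralZl//; last by apply/measurable_EFinP; exact: measurable_indic.
rewrite integral_indic// setIT; congr (_%:E * _).
by rewrite exponential_pdfE// mulrA mulVf ?mul1r// gt_eqF.
Qed.

(** By translation invariance, each piece of boundary visits [A] for a set of
    places of area [area A]. *)
Let mean_seen_length (A : set (R * R)) (F : grain R) (s : R) : measurable A ->
  \int[@area R]_z seen_length A ((z, s), F) = area A * X F setT.
Proof.
move=> mA; pose mu := lfmeasure_fun (X F).
pose D : set ((R * R) * (R * R)) := [set u | A (u.2 + u.1)%R].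
have mD : measurable D.
  have madd : measurable_fun setT (fun u : (R * R) * (R * R) => (u.2 + u.1)%R : (R * R)%type).
    apply/measurable_fun_pairP; split; apply: measurable_funD.
    - exact: measurableT_comp measurable_fst measurable_snd.
    - exact: measurableT_comp measurable_fst measurable_fst.
    - exact: measurableT_comp measurable_snd measurable_snd.
    - exact: measurableT_comp measurable_snd measurable_fst.
  by have := @madd measurableT _ mA; rewrite setTI.
transitivity ((@area R \x mu) D).
  apply: eq_integral => z _; congr (X _ _).
  by apply/seteqP; split=> y; [move=> h; apply/xsectionP|move=> /xsectionP].
rewrite product_measure_ysection//.
transitivity (\int[mu]_y cst (area A) y); last exact: integral_cst.
apply: eq_integral => y _ /=; rewrite -(area_translate y mA); congr area.
by apply/seteqP; split=> z; [move=> /ysectionP|move=> h; apply/ysectionP];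
  rewrite /D /= addrC.
Qed.

Let mean_weight : \int[@length R]_s (lam^-1 * exponential_pdf lam s)%:E = (lam^-1)%:E.
Proof.
under eq_integral do rewrite EFinM.
rewrite ge0_integralZl//.
- rewrite -[RHS]mule1 -(integral_exponential_pdf lam0); congr (_ * _).
  (* The density is integrated over the alias of [R] that carries Lebesgue measure. *)
  have mid : measurable_fun setT (fun s : measurableTypeR R => s : R) by move=> _ B; rewrite setTI.
  transitivity (\int[image_measure lebesgue_measure mid]_s (exponential_pdf lam s)%:E).
    by apply: eq_measure_integral => B mB _; rewrite /= /pushforward.
  rewrite ge0_integral_image//.
  + by apply/measurable_EFinP; exact: measurable_exponential_pdf.
  + by move=> s; rewrite lee_fin exponential_pdf_ge0// ltW.
- by apply/measurable_EFinP; exact: measurable_exponential_pdf.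
- by move=> s _; rewrite lee_fin exponential_pdf_ge0// ltW.
- by rewrite lee_fin invr_ge0 ltW.
Qed.

(** Mecke's formula turns the sum over the leaves into an integral over place,
    time and grain, which factors into [area A], the integral [lam^-1] of
    [exp (- lam s)] over time and the mean boundary length. *)
Lemma dead_leaves_intensity :
  has_intensity P (fun w A => H (dlm_boundary x t S w `&` A))
    ((\int[Q]_F area (F : set (R * R)))^-1 * \int[Q]_F H (boundary (F : set (R * R)))).
Proof.
move=> A mA.
have mlen := measurable_exposed_length mX mA.
have mleaf_set : measurable_fun setT leaf_set.
  exact: measurable_support (measurable_leaves x t S).
have len0 z : 0 <= exposed_length X A z by exact: measure_ge0.
transitivity (\int[P]_w \sum_(i <oo) exposed_length X A (leaves x t S i w, leaf_set w)).
  apply: ae_eq_integral_any => [w|w|]; [exact: outer_measure_ge0|exact: nneseries_ge0|].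
  apply: filterS (leaves_good Q_interior model Q_parallel mX XE) => w [_ lenE _].
  exact: lenE.
rewrite integral_nneseries//; last first.
  move=> i; apply: (measurableT_comp mlen).
  by apply: measurable_fun_pair => //; exact: measurable_leaves.
rewrite (leaves_mecke model)//.
pose f (z : (R * R * R) * grain R) : \bar R :=
  (lam^-1 * exponential_pdf lam z.1.2)%:E * seen_length A z.
have weight_ge0 s : 0 <= (lam^-1 * exponential_pdf lam s)%:E.
  by rewrite lee_fin mulr_ge0 ?invr_ge0 ?exponential_pdf_ge0// ltW.
have f0 z : 0 <= f z by rewrite mule_ge0// measure_ge0.
have mweight : measurable_fun setT (fun s : R => (lam^-1 * exponential_pdf lam s)%:E).
  apply/measurable_EFinP; apply: measurable_funM => //.
  exact: measurable_exponential_pdf.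
have mf : measurable_fun setT f.
  apply: emeasurable_funM; last exact: measurable_seen_length.
  exact: measurableT_comp mweight (@measurable_leaf_time R).
transitivity (\int[@volume R \x Q]_z f z).
  by apply: eq_integral => p _; exact: mean_exposed_length.
rewrite fubini_tonelli2//.
transitivity (\int[Q]_F ((lam^-1)%:E * area A * X F setT)).
  apply: eq_integral => F _; rewrite /fubini_G.
  have mfF : measurable_fun setT (fun z : R * R * R => f (z, F)).
    by apply: (measurableT_comp mf); exact: measurable_fun_pair.
  transitivity (\int[@area R \x @length R]_z f (z, F)).
    by apply: eq_measure_integral => B mB _; exact: volumeE.
  rewrite fubini_tonelli1// /fubini_F.
  transitivity (\int[@area R]_z ((lam^-1)%:E * seen_length A ((z, 0%R), F))).
    apply: eq_integral => z _.
    transitivity (\int[@length R]_s ((lam^-1 * exponential_pdf lam s)%:E *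
      seen_length A ((z, 0%R), F))); first by [].
    by rewrite ge0_integralZr// mean_weight.
  rewrite ge0_integralZl//.
  - by rewrite mean_seen_length// muleA.
  - have mz : measurable_fun setT (fun z : R * R => ((z, 0%R), F) : leaf R).
      by apply: measurable_fun_pair => //; exact: measurable_fun_pair.
    exact: measurableT_comp (measurable_seen_length mA) mz.
  - by rewrite lee_fin invr_ge0 ltW.
rewrite ge0_integralZl//; last 2 first.
- exact: measurable_evaluation.
- by rewrite mule_ge0// lee_fin invr_ge0 ltW.
rewrite lamE inver gt_eqF// -muleA (muleC (area A)) muleA; congr (_ * _ * _).
apply: ae_eq_integral_any => [F|F|]; [exact: measure_ge0|exact: outer_measure_ge0|].
by apply: filterS XE => F FE; rewrite -FE// setTI.
Qed.

End mean_boundary_length.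

Theorem theorem3p1 (R : realType) (Q : probability (grain R) R)
  (d : measure_display) (Omega : measurableType d) (P : probability Omega R)
  (x : nat -> {RV P >-> (R * R)%type}) (t : nat -> {RV P >-> R})
  (S : nat -> {RV P >-> grain R})
  (Q_interior : 0 < Q [set F : grain R | (F : set (R * R))° !=set0])
  (model : dead_leaves_model x t S Q)
  (Q_boundary : random_measure Q (fun (F : grain R) (A : set (R * R)) =>
     hausdorff1 (A `&` boundary (F : set (R * R)))))
  (Q_parallel : \int[Q]_F area (minkowski_sum F (eball 1%R)) < +oo) :
  let lambda := \int[Q]_F area F in
  let phi := fun (w : Omega) (A : set (R * R)) =>
    hausdorff1 (dlm_boundary x t S w `&` A) in
  stationary_random_measure P phi /\
  has_intensity P phi
    (lambda^-1 * \int[Q]_F hausdorff1 (boundary (F : set (R * R)))).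
Proof.
move=> lambda phi; have [X XE] := Q_boundary.
have mX : measurable_fun setT X by exact: measurable_funPT.
split; first exact: (dead_leaves_stationary Q_interior model Q_parallel mX XE).
exact: (dead_leaves_intensity Q_interior model Q_parallel mX XE).
Qed.
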